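(* Let $n\in\mathbb{N}$ and let $D\subset\mathbb{T}^n$ be an origin-symmetric convex body. Then $$|D|^{-1}W_n(D)\le A_{\mathbb{R}^n}(D)\le (a_{\mathbb{R}^n}(D))^{-1}.$$
   Context: $\mathbb{T}^n=\mathbb{R}^n/\mathbb{Z}^n$, identified with $[-1/2,1/2)^n$ and equipped with Lebesgue measure; an origin-symmetric convex body $D\subset\mathbb{T}^n$ is an origin-symmetric convex body in $\mathbb{R}^n$ contained in $[-1/2,1/2)^n$; $|D|$ is its volume. For $f\in L^1(\mathbb{T}^n)$ (complex-valued), $\widehat f_\nu=\int_{\mathbb{T}^n}f(x)e^{-2\pi i\nu x}\,dx$, $\nu\in\mathbb{Z}^n$; for $h\in L^1(\mathbb{R}^n)$, $\widehat h(\xi)=\int_{\mathbb{R}^n}h(x)e^{-2\pi i\xi x}\,dx$, $\xi\in\mathbb{R}^n$. $\operatorname{supp}$ denotes the closure of the set where a function is non-zero. $L^1_+(\mathbb{T}^n)=\{f\in L^1(\mathbb{T}^n):\widehat f_\nu\ge 0\text{ for all }\nu\in\mathbb{Z}^n\}$. The sharp Wiener constant is $$W_n(D)=\sup_{f\in L^1_+(\mathbb{T}^n)\setminus\{0\}}\frac{\int_{\mathbb{T}^n}|f|^2\,dx}{|D|^{-1}\int_D|f|^2\,dx},$$ where functions with $\int_D|f|^2\,dx=\infty$ are disregarded and $c/0=+\infty$ for $c>0$; that is, $W_n(D)$ is the smallest constant $W$ with $\int_{\mathbb{T}^n}|f|^2\,dx\le W|D|^{-1}\int_D|f|^2\,dx$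 for all $f\in L^1_+(\mathbb{T}^n)$. Delsarte problem: $A_{\mathbb{R}^n}(D)=\inf h(0)$ over all (continuous) $h\in L^1(\mathbb{R}^n)$ with $\widehat h\ge0$, $h(x)\le0$ for all $x\in\mathbb{R}^n\setminus D$ (so $h$ is real-valued there), and $\widehat h(0)=1$. Non-periodic Turán problem: $a_{\mathbb{R}^n}(D)=\sup\widehat h(0)$ over all (continuous) $h\in L^1(\mathbb{R}^n)$ with $\widehat h\ge0$, $\operatorname{supp}h\subset D$, $h(0)=1$. *)

(* Defs.v *)
From HB Require Import structures.
From mathcomp Require Import all_boot all_order all_algebra.
From mathcomp Require Import all_classical all_reals all_analysis.
From mathcomp Require Import complex.

Set Implicit Arguments.
Unset Strict Implicit.
Unset Printing Implicit Defensive.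

Import Order.TTheory GRing.Theory Num.Theory.
Import numFieldNormedType.Exports.

Local Open Scope classical_set_scope.
Local Open Scope ring_scope.
Local Open Scope complex_scope.

(* The sigma-algebra on R^n is the one generated by the coordinates, as the
   library does for n.-tuple; it is the Borel sigma-algebra of 'rV[R]_n. *)
Section measurable_rV.
Variables (R : realType) (n : nat).

Definition rV_coord (i : 'I_n) (v : 'rV[R]_n) : measurableTypeR R := v ord0 i.

Let rV_set0 : g_sigma_preimage rV_coord set0.
Proof. exact: sigma_algebra0. Qed.

Let rV_setC A : g_sigma_preimage rV_coord A -> g_sigma_preimage rV_coord (~` A).
Proof. exact: sigma_algebraC. Qed.

Let rV_bigcup (F : (set 'rV[R]_n)^nat) :
  (forall i, g_sigma_preimage rV_coord (F i)) ->
  g_sigma_preimage rV_coord (\bigcup_i F i).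
Proof. exact: sigma_algebra_bigcup. Qed.

HB.instance Definition _ := @isMeasurable.Build default_measure_display
  'rV[R]_n (g_sigma_preimage rV_coord) rV_set0 rV_setC rV_bigcup.

Lemma measurable_rV_coord i : measurable_fun setT (rV_coord i).
Proof.
move=> _ Y mY; rewrite setTI; apply: sub_sigma_algebra => /=.
rewrite -bigcup_seq/=; exists i => /=; first by rewrite mem_index_enum.
by exists Y => //; rewrite setTI.
Qed.

Lemma measurable_fun_rVP d (T : measurableType d) (f : T -> 'rV[R]_n) :
  (forall i, measurable_fun setT (rV_coord i \o f)) -> measurable_fun setT f.
Proof.
move=> mf _ A mA; rewrite setTI.
suff : preimage_set_system setT f (g_sigma_preimage rV_coord) `<=` measurable.
  by apply; exists A => //; rewrite setTI.
rewrite -g_sigma_preimage_comp.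
apply: smallest_sub; first exact: sigma_algebra_measurable.
rewrite -bigcup_seq; apply: bigcup_sub => i _ B [C mC <-]; exact: mf.
Qed.

End measurable_rV.

(* Lebesgue measure on R^n, as an iterated product measure: on R^(n+1) it is
   the image of lebesgue_measure \x (Lebesgue measure on R^n) under the
   identification R * R^n = R^(n+1). *)
Section lebesgue_rV_succ.
Variables (R : realType) (n : nat).

Definition rV_cons (p : measurableTypeR R * 'rV[R]_n) : 'rV[R]_n.+1 :=
  \row_i oapp (p.2 ord0) (p.1 : R) (unlift ord0 i).

Definition rV_uncons (v : 'rV[R]_n.+1) : measurableTypeR R * 'rV[R]_n :=
  (v ord0 ord0, \row_j v ord0 (lift ord0 j)).

Lemma rV_consK : cancel rV_cons rV_uncons.
Proof.
case=> x v; rewrite /rV_uncons mxE unlift_none/=; congr pair.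
by apply/rowP => j; rewrite !mxE liftK.
Qed.

Lemma rV_unconsK : cancel rV_uncons rV_cons.
Proof.
move=> v; apply/rowP => i; rewrite mxE.
by case: unliftP => [j|] ->; rewrite /= ?mxE.
Qed.

Lemma measurable_rV_cons : measurable_fun setT rV_cons.
Proof.
apply: measurable_fun_rVP => i; case: (unliftP ord0 i) => [j|] ->.
- rewrite (_ : _ \o _ = rV_coord j \o snd).
    by apply: measurableT_comp => //; exact: measurable_rV_coord.
  by apply/funext => p; rewrite /rV_coord/= mxE liftK.
- rewrite (_ : _ \o _ = fst)//.
  by apply/funext => p; rewrite /rV_coord/= mxE unlift_none.
Qed.

Lemma measurable_rV_uncons : measurable_fun setT rV_uncons.
Proof.
apply/measurable_fun_pairP; split; first exact: measurable_rV_coord.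
apply: measurable_fun_rVP => i.
rewrite (_ : _ \o _ = rV_coord (lift ord0 i)); first exact: measurable_rV_coord.
by apply/funext => v; rewrite /rV_coord/= mxE.
Qed.

Variable mu : {sigma_finite_measure set 'rV[R]_n -> \bar R}.

Definition lebesgue_rV_succ : set 'rV[R]_n.+1 -> \bar R :=
  pushforward (@lebesgue_measure R \x mu)%E rV_cons.

Let lebesgue_rV_succ0 : lebesgue_rV_succ set0 = 0%E.
Proof. by rewrite /lebesgue_rV_succ /pushforward preimage_set0 measure0. Qed.

Let lebesgue_rV_succ_ge0 A : (0 <= lebesgue_rV_succ A)%E.
Proof. exact: (measure_ge0 (@lebesgue_measure R \x mu)%E). Qed.

Let lebesgue_rV_succ_sigma_additive : semi_sigma_additive lebesgue_rV_succ.
Proof. by apply: measure_semi_sigma_additive; exact: measurable_rV_cons. Qed.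

HB.instance Definition _ := isMeasure.Build _ _ _ lebesgue_rV_succ
  lebesgue_rV_succ0 lebesgue_rV_succ_ge0 lebesgue_rV_succ_sigma_additive.

Let sigma_finite_lebesgue_rV_succ : sigma_finite setT lebesgue_rV_succ.
Proof.
have /sigma_finiteP[F [FT ndF Foo]] := sigma_finiteT (@lebesgue_measure R).
have /sigma_finiteP[G [GT ndG Goo]] := sigma_finiteT mu.
exists (fun k => rV_uncons @^-1` (F k `*` G k)).
  apply/esym/seteqP; split=> // v _.
  have [i _ Fi] : (\bigcup_i F i) (rV_uncons v).1 by rewrite -FT.
  have [j _ Gj] : (\bigcup_j G j) (rV_uncons v).2 by rewrite -GT.
  exists (maxn i j) => //; split.
  - by move: Fi; apply/subsetPset/ndF/leq_maxl.
  - by move: Gj; apply/subsetPset/ndG/leq_maxr.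
move=> k; have [mFk Fk_oo] := Foo k; have [mGk Gk_oo] := Goo k; split.
  rewrite -[X in measurable X]setTI; apply: measurable_rV_uncons => //.
  exact: measurableX.
rewrite /lebesgue_rV_succ /pushforward -comp_preimage.
rewrite (_ : _ \o _ = id); last by apply/funext => p; exact: rV_consK.
by rewrite preimage_id product_measure1E// lte_mul_pinfty// ge0_fin_numE.
Qed.

HB.instance Definition _ := @Measure_isSigmaFinite.Build _ _ _
  lebesgue_rV_succ sigma_finite_lebesgue_rV_succ.

End lebesgue_rV_succ.

Fixpoint lebesgue_rV (R : realType) (n : nat) :
    {sigma_finite_measure set 'rV[R]_n -> \bar R} :=
  if n is n'.+1 then lebesgue_rV_succ (lebesgue_rV R n')
  else \d_(0 : 'rV[R]_0).

Section fourier.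
Variables (R : realType) (n : nat).
Implicit Types (A : set 'rV[R]_n) (f h : 'rV[R]_n -> R[i]).

Definition cintegrable A f : Prop :=
  (lebesgue_rV R n).-integrable A (fun x => (complex.Re (f x))%:E) /\
  (lebesgue_rV R n).-integrable A (fun x => (complex.Im (f x))%:E).

Definition cintegral A f : R[i] :=
  (\int[lebesgue_rV R n]_(x in A) complex.Re (f x)) +i*
  (\int[lebesgue_rV R n]_(x in A) complex.Im (f x)).

Definition cis (t : R) : R[i] := cos t +i* sin t.

Definition dotmul (u v : 'rV[R]_n) : R := \sum_(i < n) u ord0 i * v ord0 i.

Definition fourier_on A f (xi : 'rV[R]_n) : R[i] :=
  cintegral A (fun x => f x * cis (- (2 * pi * dotmul xi x))).

(* The torus R^n/Z^n as the cell [-1/2, 1/2)^n; a function on the torus is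
   represented by any f : 'rV[R]_n -> R[i], only its values on the cell being
   used. *)
Definition torus : set 'rV[R]_n :=
  [set x : 'rV[R]_n | forall i, - 2^-1 <= x ord0 i < 2^-1].

Definition fourier_coef f (nu : 'rV[int]_n) : R[i] :=
  fourier_on torus f (map_mx intr nu).

Definition fourier h (xi : 'rV[R]_n) : R[i] := fourier_on setT h xi.

(* In R[i], [0 <= z] means that z is real and nonnegative. *)
Definition L1_plus f : Prop :=
  cintegrable torus f /\ forall nu : 'rV[int]_n, 0 <= fourier_coef f nu.

Definition sqr_mass A f : \bar R :=
  (\int[lebesgue_rV R n]_(x in A) ((Normc.normc (f x) ^+ 2)%:E))%E.

Definition vol A : \bar R := lebesgue_rV R n A.

Definition origin_symmetric_convex_body (D : set 'rV[R]_n) : Prop :=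
  [/\ compact D, convex_set D, D° !=set0 & forall x, D x -> D (- x)].

(* Nonzero means nonzero as an element of L^1, i.e. not almost everywhere zero.
   In \bar R one has 0^-1 = +oo, so that c / 0 = +oo for 0 < c <= +oo. *)
Definition wiener_constant (D : set 'rV[R]_n) : \bar R :=
  ereal_sup [set (sqr_mass torus f / ((vol D)^-1 * sqr_mass D f))%E |
    f in [set f | [/\ L1_plus f,
      ~ {ae lebesgue_rV R n, forall x, torus x -> f x = 0} &
      (sqr_mass D f < +oo)%E]]].

Definition continuous_L1 h : Prop :=
  continuous (h : 'rV[R]_n -> R[i]^o) /\ cintegrable setT h.

(* [h 0] is automatically real in the next definition: a continuous integrable
   function with nonnegative Fourier transform satisfies h(-x) = conj(h(x)). *)
Definition delsarte_constant (D : set 'rV[R]_n) : \bar R :=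
  ereal_inf [set (complex.Re (h 0))%:E | h in [set h |
    [/\ continuous_L1 h, forall xi, 0 <= fourier h xi,
        forall x, ~ D x -> h x <= 0 & fourier h 0 = 1]]].

Definition turan_constant (D : set 'rV[R]_n) : \bar R :=
  ereal_sup [set (complex.Re (fourier h 0))%:E | h in [set h |
    [/\ continuous_L1 h, forall xi, 0 <= fourier h xi,
        closure [set x | h x != 0] `<=` D & h 0 = 1]]].

End fourier.

(* Main.v *)
Require Import Defs.
From mathcomp Require Import all_boot all_order all_algebra.
From mathcomp Require Import all_classical all_reals all_analysis.
From mathcomp Require Import measurable_realfun.
From mathcomp Require Import complex zify ring lra.

(** Let f be in L^1_+, let h be admissible in the Delsarte problem, and r = Re h. The
first inequality asserts that the square mass of f over the torus is at most r 0
times its square mass over D.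

Suppose first that f is a trigonometric polynomial F with coefficients a_nu >= 0.
Then |F|^2 is a combination of the cos (2 pi (nu - ka) x) with nonnegative
coefficients a_nu a_ka, and r has nonnegative integral against each of them, so the
integral of r |F|^2 over R^n is at least the part nu = ka, the sum of the a_nu^2. It is
also at most r 0 times the integral of |F|^2 over D, since r <= 0 off D, D is
symmetric, |F|^2 is even and r x + r (- x) <= 2 r 0. This is [pos_def_trig_le]. The
last fact, [pos_def_max], follows from r 0 >= 0 for continuous positive definite r,
applied to a second difference of r; and r 0 >= 0 because r has nonnegative integral
against narrow Gaussians, these being bounded limits of exponentials of positive
combinations of cosines ([multiplier_gaussian]).

A general f is only known to be integrable on the torus and square integrable on D.
It is convolved with the kernel K_N proportional to the product of the
cos (pi x_i)^(2 N): its Fourier coefficients are ratios of binomial coefficients, lie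
in [0, 1] and tend to 1, and K_N tends to 0 geometrically away from the lattice
([kernel_bound]). On a smaller body s D, the values of f outside D contribute a
uniformly small amount to f * K_N, since x - y stays away from the lattice for x in
s D and y in the cell outside D ([body_gap]); the values of f inside D contribute at
most the square mass of f over D, by Bessel's inequality. Applying the polynomial case
to r (. / s) and f * K_N, and letting N tend to infinity and s to 1, bounds every
finite sum of squares of Fourier coefficients of f by r 0 times the square mass over D
([local_l2_bound]).

It remains to pass from the coefficients to the square mass of f over the torus when f
is only known to be integrable ([l2_le_of_coefs]). For f = u + i v, trigonometric
polynomials are dense in L^2 with respect to the weight 1 + |u| + |v|, so polynomials
near the truncations of f can be paired with f. Density holds because the bounded
functions that preserve the closure of the polynomials under multiplication form an
algebra closed under bounded limits, which contains the indicators of half circles,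
hence those of all Borel sets ([trig_dense]).

For the second inequality, if h is admissible in the Turan problem and the integral c
of h is positive, then h / c is admissible in the Delsarte problem, with value 1 / c at 0
([delsarte_le_turan]). *)

Set Implicit Arguments.
Unset Strict Implicit.
Unset Printing Implicit Defensive.

Import Order.TTheory GRing.Theory Num.Theory.
Import numFieldNormedType.Exports.

Local Open Scope classical_set_scope.
Local Open Scope ring_scope.
Local Open Scope complex_scope.

(** * Borel sets and measurable functions on R^n *)

Section measurability.
Variables (R : realType) (n : nat).

Lemma measurable_coord (i : 'I_n) :
  measurable_fun setT (fun v : 'rV[R]_n => v ord0 i).
Proof. exact: measurable_rV_coord. Qed.

Lemma measurable_rV_box (c : 'rV[R]_n) (e : R) :
  measurable [set v : 'rV[R]_n | forall i, `|v ord0 i - c ord0 i| < e].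
Proof.
rewrite (_ : mkset _ = \bigcap_(i in [set: 'I_n])
    (fun v : 'rV[R]_n => v ord0 i) @^-1` ball (c ord0 i) e).
  apply: fin_bigcap_measurable => // i _; rewrite -[X in measurable X]setTI.
  by apply: measurable_coord => //; exact: measurable_ball.
apply/seteqP; split=> [v H i _|v H i].
  by rewrite /preimage/= -ball_normE/= distrC; exact: H.
by have := H i I; rewrite /preimage/= -ball_normE/= distrC.
Qed.

(** The coordinates generate the Borel sets: an open set is the countable union
of the boxes with rational center and radius 1/(k+1) that it contains. *)
Lemma open_measurable_rV (U : set 'rV[R]_n) : open U -> measurable U.
Proof.
move=> oU.
pose B (p : 'rV[rat]_n * nat) := [set v : 'rV[R]_n |
  forall i, `|v ord0 i - (map_mx ratr p.1 : 'rV[R]_n) ord0 i| < p.2.+1%:R^-1].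
pose C p : set 'rV[R]_n := if `[< B p `<=` U >] then B p else set0.
rewrite (_ : U = \bigcup_p C p).
  apply: countable_bigcupT_measurable; first exact: countableP.
  by move=> p; rewrite /C; case: asboolP => // _; exact: measurable_rV_box.
apply/seteqP; split=> [x Ux|x [p _]]; last first.
  by rewrite /C; case: asboolP => // h /h.
have /nbhs_ballP[e /= e0 eU] : nbhs x U by apply: open_nbhs_nbhs.
pose k := Num.bound (2 / e).
have k0 : 0 < k.+1%:R^-1 :> R by rewrite invr_gt0 ltr0n.
have ke : k.+1%:R^-1 * 2 < e.
  rewrite -ltr_pdivlMr// invf_plt ?posrE ?divr_gt0// ?ltr0n//.
  rewrite invf_div; apply: le_lt_trans (ler_norm _) _.
  rewrite (lt_le_trans (archi_boundP _))// -/k ?ler_nat//.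
  by rewrite (ger0_norm _) ?divr_ge0// ltW.
have qP i : exists q : rat, `|x ord0 i - ratr q| < k.+1%:R^-1.
  have [|q] := @rat_in_itvoo R (x ord0 i - k.+1%:R^-1) (x ord0 i + k.+1%:R^-1).
    by rewrite ltrD2l (lt_trans _ k0)// oppr_lt0.
  by rewrite in_itv/= => h; exists q; rewrite ltr_distlC.
pose q := fun i => projT1 (cid (qP i)).
exists (\row_i q i, k) => //; rewrite /C asboolT => [|v /= Bv].
  by move=> i /=; rewrite !mxE; exact: (projT2 (cid (qP i))).
apply: eU; split=> // i j; rewrite ord1 /ball/=.
have := Bv j; rewrite !mxE/= => v1; have v2 := projT2 (cid (qP j)).
rewrite -/(q j) in v2.
rewrite (_ : _ - _ = (x ord0 j - ratr (q j)) - (v ord0 j - ratr (q j))); last by ring.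
apply: le_lt_trans (ler_normB _ _) _.
move: (k.+1%:R^-1) v1 v2 ke => r v1 v2 ke; lra.
Qed.

Lemma closed_measurable_rV (A : set 'rV[R]_n) : closed A -> measurable A.
Proof.
move=> cA; rewrite -(setCK A); apply: measurableC; apply: open_measurable_rV.
exact: closed_openC.
Qed.

Lemma measurable_sumr d (T : measurableType d) (I : Type) (s : seq I)
    (D : set T) (h : I -> T -> R) :
  (forall i, measurable_fun D (h i)) ->
  measurable_fun D (fun x => \sum_(i <- s) h i x).
Proof.
move=> mh; elim: s => [|i s ih].
  by under eq_fun do rewrite big_nil; exact: measurable_cst.
by under eq_fun do rewrite big_cons; exact: measurable_funD.
Qed.

Lemma measurable_prodr d (T : measurableType d) (I : Type) (s : seq I)
    (D : set T) (h : I -> T -> R) :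
  (forall i, measurable_fun D (h i)) ->
  measurable_fun D (fun x => \prod_(i <- s) h i x).
Proof.
move=> mh; elim: s => [|i s ih].
  by under eq_fun do rewrite big_nil; exact: measurable_cst.
by under eq_fun do rewrite big_cons; exact: measurable_funM.
Qed.

Lemma measurable_dotmul (u : 'rV[R]_n) : measurable_fun setT (dotmul u).
Proof.
by apply: measurable_sumr => i; apply: measurable_funM => //; exact: measurable_coord.
Qed.

Lemma measurable_cos_dotmul (u : 'rV[R]_n) (b : R) :
  measurable_fun setT (fun x => cos (dotmul u x + b)).
Proof.
apply: measurableT_comp.
  by apply: continuous_measurable_fun; exact: continuous_cos.
by apply: measurable_funD => //; exact: measurable_dotmul.
Qed.

Lemma measurable_sin_dotmul (u : 'rV[R]_n) (b : R) :
  measurable_fun setT (fun x => sin (dotmul u x + b)).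
Proof.
apply: measurableT_comp.
  by apply: continuous_measurable_fun; exact: continuous_sin.
by apply: measurable_funD => //; exact: measurable_dotmul.
Qed.

Lemma measurable_affine_rV (s : R) (t : 'rV[R]_n) :
  measurable_fun setT (fun x : 'rV[R]_n => s *: x + t).
Proof.
apply: measurable_fun_rVP => i.
rewrite (_ : _ \o _ = fun x : 'rV[R]_n => s * x ord0 i + t ord0 i); last first.
  by apply/funext => x; rewrite /rV_coord/= !mxE.
apply: measurable_funD => //; apply: measurable_funM => //.
exact: measurable_coord.
Qed.

End measurability.

(** * Affine changes of variables *)

Section change_of_variables.
Variable R : realType.
Local Notation leb := (@lebesgue_measure R).
Local Notation mu := (lebesgue_rV R).
Local Open Scope ereal_scope.

(** The image of Lebesgue measure under an affine map, scaled back by the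
modulus of the slope, gives every interval its length. *)
Lemma ge0_integral_affine1 (s t : R) (f : R -> \bar R) :
  s != 0%R -> measurable_fun setT f -> (forall x, 0 <= f x) ->
  \int[leb]_x f x = `|s|%:E * \int[leb]_x f (s * x + t)%R.
Proof.
move=> s0 mf f0; pose phi := fun x : measurableTypeR R => (s * x + t)%R : measurableTypeR R.
have mphi : measurable_fun setT phi.
  by apply: measurable_funD => //; exact: measurable_funM.
pose nu : {measure set (measurableTypeR R) -> \bar R} :=
  mscale (NngNum (normr_ge0 s)) (pushforward leb phi).
have E A : measurable A -> leb A = nu mphi A.
  apply: lebesgue_measure_unique => _ [[a b]] _ <-.
  rewrite /nu/= /mscale/= /pushforward.
  have [sp|sn] := ltrP 0 s.
    rewrite (_ : phi @^-1` _ = `](a - t) / s, (b - t) / s]%classic)%R; last first.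
      apply/seteqP; split=> x; rewrite /= !in_itv/= /phi ltr_pdivrMr// ler_pdivlMr//;
        by rewrite ltrBlDr lerBrDr mulrC.
    rewrite !lebesgue_measure_itv/= !lte_fin ltr_pM2r ?invr_gt0// ltrD2r.
    case: ifPn => _; last by rewrite mule0.
    by rewrite -EFinD -EFinM gtr0_norm//; congr (_%:E); field; rewrite gt_eqF.
  have {}sn : (s < 0)%R by rewrite lt_neqAle s0.
  rewrite (_ : phi @^-1` _ = `[(b - t) / s, (a - t) / s[%classic)%R; last first.
    apply/seteqP; split=> x; rewrite /= !in_itv/= /phi ltr_ndivlMr// ler_ndivrMr//;
      by rewrite ltrBlDr lerBrDr mulrC andbC.
  rewrite !lebesgue_measure_itv/= !lte_fin ltr_nM2r ?invr_lt0// ltrD2r.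
  case: ifPn => _; last by rewrite mule0.
  by rewrite -EFinD -EFinM ltr0_norm//; congr (_%:E); field; rewrite lt_eqF.
rewrite (eq_measure_integral (nu mphi)) => [|A mA _]; last exact: E.
rewrite ge0_integral_mscale//; congr (_ * _).
by rewrite ge0_integral_pushforward.
Qed.

Lemma ge0_integral_rV_succ n (g : 'rV[R]_n.+1 -> \bar R) :
  measurable_fun setT g -> (forall x, 0 <= g x) ->
  \int[mu n.+1]_v g v = \int[leb]_x \int[mu n]_w g (rV_cons (x, w)).
Proof.
move=> mg g0.
have := @ge0_integral_pushforward _ _ _ _ R _ (@measurable_rV_cons R n)
  (leb \x mu n) setT g measurableT mg (fun x _ => g0 x).
rewrite /= => ->; rewrite preimage_setT.
rewrite (fubini_tonelli1 (g \o @rV_cons R n))//.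
  by apply: measurableT_comp => //; exact: measurable_rV_cons.
by move=> p; exact: g0.
Qed.

Lemma rV_cons_affine n (s : R) (t : 'rV[R]_n.+1) x (w : 'rV[R]_n) :
  (s *: rV_cons (x, w) + t =
   rV_cons (s * x + (rV_uncons t).1, s *: w + (rV_uncons t).2))%R.
Proof.
apply/rowP => i; rewrite !mxE; case: unliftP => [j|] -> /=; by rewrite ?mxE.
Qed.

Lemma ge0_integral_affine n (s : R) (t : 'rV[R]_n) (f : 'rV[R]_n -> \bar R) :
  s != 0%R -> measurable_fun setT f -> (forall x, 0 <= f x) ->
  \int[mu n]_x f x = (`|s| ^+ n)%:E * \int[mu n]_x f (s *: x + t)%R.
Proof.
move=> s0; elim: n => [|n IH] in t f *.
  move=> mf f0; rewrite expr0 mul1e; apply: eq_integral => x _; congr f.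
  by apply/rowP => -[].
move=> mf f0; rewrite ge0_integral_rV_succ//.
have mF : measurable_fun setT (fun x => \int[mu n]_w f (rV_cons (x, w))).
  apply: (measurable_fun_fubini_tonelli_F (f \o @rV_cons R n)) => //.
    by apply: measurableT_comp => //; exact: measurable_rV_cons.
  by move=> p; exact: f0.
have msec x : measurable_fun setT (fun w => f (rV_cons (x, w))).
  exact: (measurableT_comp mf
    (measurableT_comp (@measurable_rV_cons R n) (@pair1_measurable _ _ _ _ x))).
rewrite [LHS](ge0_integral_affine1 (rV_uncons t).1 s0 mF); last first.
  by move=> x; exact: integral_ge0.
rewrite exprS EFinM -muleA; congr (_ * _).
rewrite ge0_integral_rV_succ//; last first.
  by apply: measurableT_comp => //; exact: measurable_affine_rV.
rewrite -ge0_integralZl//; last 2 first.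
- apply: (measurable_fun_fubini_tonelli_F
    (fun p => f (s *: rV_cons p + t)%R)) => //.
    apply: measurableT_comp => //.
    apply: (measurableT_comp (measurable_affine_rV s t)).
    exact: measurable_rV_cons.
- by move=> x _; exact: integral_ge0.
apply: eq_integral => x _; rewrite (IH (rV_uncons t).2)//.
by congr (_ * _); apply: eq_integral => w _; rewrite rV_cons_affine.
Qed.

Lemma integral_affine n (s : R) (t : 'rV[R]_n) (f : 'rV[R]_n -> R) :
  s != 0%R -> measurable_fun setT f ->
  (mu n).-integrable setT (EFin \o f) ->
  (mu n).-integrable setT (EFin \o (fun x => f (s *: x + t)%R)) /\
  (\int[mu n]_x f x = `|s| ^+ n * \int[mu n]_x f (s *: x + t))%R.
Proof.
move=> s0 mf /integrableP[mf' fi].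
have k0 : (0 < `|s| ^+ n)%R by rewrite exprn_gt0// normr_gt0.
have mg : measurable_fun setT (fun x : 'rV[R]_n => f (s *: x + t)%R).
  by apply: measurableT_comp => //; exact: measurable_affine_rV.
have gi : (mu n).-integrable setT (EFin \o (fun x => f (s *: x + t)%R)).
  apply/integrableP; split; first exact/measurable_EFinP.
  move: fi; rewrite (ge0_integral_affine t s0)//; last by exact: measurableT_comp.
  rewrite ltNge leye_eq => /negP h; rewrite ltNge leye_eq; apply/negP => /eqP gy.
  by apply: h; rewrite /= in gy *; rewrite gy muleC gt0_mulye.
split=> //; rewrite /Rintegral.
have <- : (fine (`|s| ^+ n)%:E = `|s| ^+ n)%R by [].
rewrite -fineM//; last exact: integrable_fin_num.
congr fine; rewrite integralE [in RHS]integralE.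
have hp := @ge0_integral_affine n s t (EFin \o f)^\+ s0.
have hn := @ge0_integral_affine n s t (EFin \o f)^\- s0.
rewrite hp//; last exact: measurable_funepos.
rewrite hn//; last exact: measurable_funeneg.
rewrite [RHS]muleBr; last 2 first.
- by [].
- by apply: fin_num_adde_defr; exact: (integrable_pos_fin_num _ gi).
by congr (_ * _ - _ * _); apply: eq_integral => x _; rewrite ?funeposE ?funenegE.
Qed.

End change_of_variables.

(** * Integrals of products over the coordinates *)

Section integrability.
Context d (T : measurableType d) (R : realType) (mu : {measure set T -> \bar R}).
Variables (D : set T) (mD : measurable D).

Lemma EFin_Rintegral (f : T -> R) : mu.-integrable D (EFin \o f) ->
  (\int[mu]_(x in D) (f x)%:E = (\int[mu]_(x in D) f x)%R%:E)%E.
Proof. by move=> fi; rewrite /Rintegral fineK//; exact: integrable_fin_num. Qed.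

Lemma measurable_integrand (f : T -> R) :
  mu.-integrable D (EFin \o f) -> measurable_fun D f.
Proof. by move=> fi; apply/measurable_EFinP; case/integrableP : fi. Qed.

Lemma integrable_mulr_bounded (f k : T -> R) (C : R) :
  mu.-integrable D (EFin \o f) -> measurable_fun D k ->
  (forall x, D x -> `|k x| <= C) ->
  mu.-integrable D (EFin \o (fun x => f x * k x)).
Proof.
move=> fi mk kC.
have Cfi : mu.-integrable D (EFin \o (fun x => C * f x)).
  by have := integrableZl mD C fi; apply: eq_integrable.
apply: le_integrable Cfi => //.
  apply/measurable_EFinP; apply: measurable_funM => //.
  by apply/measurable_EFinP; case/integrableP : fi.
move=> x Dx; rewrite lee_fin/= !normrM mulrC ler_wpM2r//.
by rewrite (le_trans (kC x Dx))// ler_norm.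
Qed.

Lemma integrable_addr (f g : T -> R) :
  mu.-integrable D (EFin \o f) -> mu.-integrable D (EFin \o g) ->
  mu.-integrable D (EFin \o (fun x => f x + g x)).
Proof. by move=> fi gi; have := integrableD mD fi gi; apply: eq_integrable. Qed.

Lemma integrable_subr (f g : T -> R) :
  mu.-integrable D (EFin \o f) -> mu.-integrable D (EFin \o g) ->
  mu.-integrable D (EFin \o (fun x => f x - g x)).
Proof. by move=> fi gi; have := integrableB mD fi gi; apply: eq_integrable. Qed.

Lemma integrable_scaler (k : R) (f : T -> R) :
  mu.-integrable D (EFin \o f) -> mu.-integrable D (EFin \o (fun x => k * f x)).
Proof. by move=> fi; have := integrableZl mD k fi; apply: eq_integrable. Qed.

Lemma integrable_sumr (I : Type) (s : seq I) (h : I -> T -> R) :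
  (forall i, mu.-integrable D (EFin \o h i)) ->
  mu.-integrable D (EFin \o (fun x => \sum_(i <- s) h i x)).
Proof.
move=> hi; have := @integrable_sum _ _ _ mu D mD I s xpredT _ (fun i _ => hi i).
by apply: eq_integrable => // x _ /=; rewrite sumEFin.
Qed.

Lemma Rintegral_sumr (I : Type) (s : seq I) (h : I -> T -> R) :
  (forall i, mu.-integrable D (EFin \o h i)) ->
  \int[mu]_(x in D) (\sum_(i <- s) h i x) = \sum_(i <- s) \int[mu]_(x in D) h i x.
Proof.
move=> hi; elim: s => [|i s ih].
  by rewrite big_nil; under eq_Rintegral do rewrite big_nil; rewrite Rintegral_cst// mul0r.
rewrite big_cons -ih -RintegralD//; last exact: integrable_sumr.
by apply: eq_Rintegral => x _; rewrite big_cons.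
Qed.

End integrability.

Section tensor.
Variable R : realType.
Local Notation leb := (@lebesgue_measure R).
Local Notation mu := (lebesgue_rV R).

Lemma integral_rV_succ n (f : 'rV[R]_n.+1 -> R) :
  measurable_fun setT f -> (mu n.+1).-integrable setT (EFin \o f) ->
  (\int[mu n.+1]_v (f v)%:E = \int[leb]_x \int[mu n]_w (f (rV_cons (x, w)))%:E)%E.
Proof.
move=> mf /integrableP[mf' fi].
have i2 : (leb \x mu n)%E.-integrable setT ((EFin \o f) \o @rV_cons R n).
  apply/integrableP; split.
    by apply: measurableT_comp => //; exact: measurable_rV_cons.
  apply: le_lt_trans fi.
  have := @ge0_integral_pushforward _ _ _ _ R _ (@measurable_rV_cons R n)
    (leb \x mu n)%E setT (fun v => `|(EFin \o f) v|%E) measurableT.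
  by move=> <-//; apply: measurableT_comp.
have := @integral_pushforward _ _ _ _ R _ (@measurable_rV_cons R n)
  (leb \x mu n)%E setT (EFin \o f) mf'.
rewrite /= preimage_setT => /(_ i2 measurableT) ->.
exact/esym/(integral12_prod_meas1 i2).
Qed.

Lemma rV_cons0 n (x : R) (w : 'rV[R]_n) : rV_cons (x, w) ord0 ord0 = x.
Proof. by rewrite mxE unlift_none. Qed.

Lemma rV_consS n (x : R) (w : 'rV[R]_n) i :
  rV_cons (x, w) ord0 (lift ord0 i) = w ord0 i.
Proof. by rewrite mxE liftK. Qed.

Lemma dotmul_rV_cons n (al : 'rV[R]_n.+1) (x : R) (w : 'rV[R]_n) :
  dotmul al (rV_cons (x, w)) = al ord0 ord0 * x + dotmul (rV_uncons al).2 w.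
Proof.
rewrite /dotmul big_ord_recl rV_cons0; congr (_ + _).
by apply: eq_bigr => i _; rewrite rV_consS mxE.
Qed.

Definition tensor n (t : R -> R) (x : 'rV[R]_n) : R := \prod_(i < n) t (x ord0 i).

Lemma tensor_rV_cons n t (x : R) (w : 'rV[R]_n) :
  tensor t (rV_cons (x, w)) = t x * tensor t w.
Proof.
rewrite /tensor big_ord_recl rV_cons0; congr (_ * _).
by apply: eq_bigr => i _; rewrite rV_consS.
Qed.

Lemma measurable_tensor n (t : R -> R) : measurable_fun setT t ->
  measurable_fun setT (@tensor n t).
Proof.
move=> mt; apply: measurable_prodr => i.
by apply: measurableT_comp => //; exact: measurable_coord.
Qed.

Lemma integrable_tensor n (t : R -> R) : measurable_fun setT t ->
  leb.-integrable setT (EFin \o t) ->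
  (mu n).-integrable setT (EFin \o @tensor n t).
Proof.
move=> mt ti.
have mT m : measurable_fun setT (EFin \o @tensor m t).
  by apply/measurable_EFinP; exact: measurable_tensor.
have mA m : measurable_fun setT (fun w => `|(EFin \o @tensor m t) w|%E).
  exact: (measurableT_comp (@abse_measurable R setT) (mT m)).
elim: n => [|n /integrableP[_ ih]]; apply/integrableP; split; try exact: mT.
  have /= E := integral_dirac (0 : 'rV[R]_0) measurableT (mA 0%N).
  rewrite [X in (X < _)%E]E.
  by rewrite diracT mul1e ltry.
rewrite ge0_integral_rV_succ//.
rewrite (eq_integral (fun x : measurableTypeR R =>
    `|(t x)%:E| * \int[mu n]_w `|(EFin \o @tensor n t) w|))%E.
  have C0 : (0 <= \int[mu n]_w `|(EFin \o @tensor n t) w|)%E by exact: integral_ge0.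
  case/integrableP: ti => mt' ti.
  rewrite ge0_integralZr//; last by apply: measurableT_comp => //; exact: mt'.
  by rewrite lte_mul_pinfty// ?integral_ge0// ge0_fin_numE ?integral_ge0.
move=> x _; rewrite -ge0_integralZl//; last exact: mA.
by apply: eq_integral => w _; rewrite /= tensor_rV_cons normrM.
Qed.

(** Cosines of sums of phases integrate coordinate by coordinate: carrying the
phase b through the recursion makes the sine parts disappear. *)
Lemma integral_tensor_cos n (t : R -> R) (al : 'rV[R]_n) (p : 'I_n -> R) :
  measurable_fun setT t -> leb.-integrable setT (EFin \o t) ->
  (forall i b, \int[leb]_x (t x * cos (al ord0 i * x + b)) = p i * cos b) ->
  forall b, \int[mu n]_x (tensor t x * cos (dotmul al x + b)) =
    (\prod_i p i) * cos b.
Proof.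
move=> mt ti; elim: n => [|n ih] in al p *.
  move=> _ b.
  have mf : measurable_fun setT
      (fun x : 'rV[R]_0 => (tensor t x * cos (dotmul al x + b))%:E).
    apply/measurable_EFinP; apply: measurable_funM; first exact: measurable_tensor.
    exact: measurable_cos_dotmul.
  have /= E := integral_dirac (0 : 'rV[R]_0) measurableT mf.
  rewrite /Rintegral [X in fine X]E diracT mul1e /tensor /dotmul !big_ord0 add0r.
  by [].
move=> tp b.
have intg m (a : 'rV[R]_m) c : (mu m).-integrable setT
    (EFin \o (fun x => tensor t x * cos (dotmul a x + c))).
  apply: (@integrable_mulr_bounded _ _ _ _ _ _ _ _ 1) => //.
  - exact: integrable_tensor.
  - exact: measurable_cos_dotmul.
  - by move=> x _; rewrite ler_norml cos_geN1 cos_le1.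
rewrite /Rintegral integral_rV_succ//; last first.
  apply: measurable_funM; first exact: measurable_tensor.
  exact: measurable_cos_dotmul.
transitivity (\int[leb]_x ((\prod_(i < n) p (lift ord0 i)) *
    (t x * cos (al ord0 ord0 * x + b)))).
  congr fine; apply: eq_integral => x _.
  rewrite (eq_integral (fun w => ((t x)%:E * (tensor t w *
      cos (dotmul (rV_uncons al).2 w + (al ord0 ord0 * x + b)))%:E)%E)); last first.
    move=> w _; rewrite -EFinM tensor_rV_cons dotmul_rV_cons mulrA.
    by congr (_ * cos _)%:E; ring.
  have ii := intg _ (rV_uncons al).2 (al ord0 ord0 * x + b).
  rewrite integralZl//.
  rewrite (EFin_Rintegral measurableT ii).
  rewrite (ih _ (fun i => p (lift ord0 i))) -?EFinM; first by congr EFin; ring.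
  by move=> i c; rewrite mxE tp.
rewrite RintegralZl//.
  by rewrite tp big_ord_recl; ring.
apply: (@integrable_mulr_bounded _ _ _ _ _ _ _ _ 1) => //.
- apply: measurableT_comp; first by apply: continuous_measurable_fun; exact: continuous_cos.
  by apply: measurable_funD => //; exact: measurable_funM.
- by move=> x _; rewrite ler_norml cos_geN1 cos_le1.
Qed.

End tensor.

(** * The indicator of an interval and the triangle function *)

Section one_dimensional.
Variable R : realType.
Local Notation leb := (@lebesgue_measure R).

Lemma Rintegral_indic_mul d (T : measurableType d)
    (mu : {measure set T -> \bar R}) (D : set T) (f : T -> R) :
  \int[mu]_x (\1_D x * f x) = \int[mu]_(x in D) f x.
Proof.
rewrite [RHS]Rintegral_mkcond; apply: eq_Rintegral => x _.
by rewrite patch_indic/= mulrC.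
Qed.

Lemma continuous_cos_affine (al b : R) : continuous (fun x => cos (al * x + b)).
Proof.
move=> x; apply: continuous_comp; last exact: continuous_cos.
by apply: continuousD; [exact: mulrl_continuous|exact: cst_continuous].
Qed.

Lemma continuous_itv_integrable (f : R -> R) (a b : R) :
  continuous f -> leb.-integrable `[a, b] (EFin \o f).
Proof.
move=> cf; apply: continuous_compact_integrable; first exact: segment_compact.
by apply: continuous_subspaceT.
Qed.

Lemma Rintegral_FTC2 (F f : R -> R) (a b : R) : a < b ->
  (forall x : R, is_derive x (1 : R) F (f x)) -> continuous f ->
  \int[leb]_(x in `[a, b]) f x = F b - F a.
Proof.
move=> ab dF cf.
have cF : continuous F.
  by move=> x; apply/differentiable_continuous/derivable1_diffP; have [] := dF x.
rewrite /Rintegral (@continuous_FTC2 _ f F a b ab)//.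
- exact: continuous_subspaceT.
- split=> [x _||]; first by have [] := dF x.
  + exact/cvg_at_right_filter/cF.
  + exact/cvg_at_left_filter/cF.
- by move=> x _; rewrite derive1E; have [_ ->] := dF x.
Qed.

Definition cell : R -> R := \1_(`[- 2^-1, 2^-1[%classic).

Lemma measurable_cell : measurable_fun setT cell.
Proof. exact: measurable_indic. Qed.

Lemma integrable_cell : leb.-integrable setT (EFin \o cell).
Proof.
exact: (@integrable_indic_itv R (- 2^-1) (2^-1) true true).
Qed.

Lemma integral_cell (f : R -> R) : continuous f ->
  \int[leb]_x (cell x * f x) = \int[leb]_(x in `[- 2^-1, 2^-1]) f x.
Proof.
move=> cf; rewrite Rintegral_indic_mul Rintegral_itv_bndo_bndc//.
apply: integrableS (continuous_itv_integrable (- 2^-1) (2^-1) cf) => //.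
exact: subset_itv_co_cc.
Qed.

Lemma integral_cell_cos0 (b : R) :
  \int[leb]_x (cell x * cos (0 * x + b)) = 1 * cos b.
Proof.
rewrite integral_cell; last exact: continuous_cos_affine.
under eq_Rintegral do rewrite mul0r add0r.
rewrite Rintegral_cst//= lebesgue_measure_itv/= lte_fin.
rewrite (_ : - 2^-1 < 2^-1 :> R) /=; last by lra.
by rewrite mulrC; congr (_ * _); lra.
Qed.

Lemma integral_cell_cos (al b : R) : al != 0 ->
  \int[leb]_x (cell x * cos (al * x + b)) = (2 * sin (al / 2) / al) * cos b.
Proof.
move=> al0; rewrite integral_cell; last exact: continuous_cos_affine.
have dF (x : R) : is_derive x 1 (fun x => al^-1 * sin (al * x + b)) (cos (al * x + b)).
  by apply: is_derive_eq; rewrite /GRing.scale/=; field.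
rewrite (Rintegral_FTC2 _ dF); [|by lra|exact: continuous_cos_affine].
rewrite mulrN !sinD sinN cosN.
by field.
Qed.

Definition triangle (rho x : R) : R := Num.max 0 (rho - `|x|).

Lemma continuous_triangle rho : continuous (triangle rho).
Proof.
move=> x; apply: (@continuous_max R R (fun=> 0) (fun x => rho - `|x|)).
  exact: cst_continuous.
by apply: continuousB; [exact: cst_continuous|exact: norm_continuous].
Qed.

Lemma measurable_triangle rho : measurable_fun setT (triangle rho).
Proof. by apply: continuous_measurable_fun; exact: continuous_triangle. Qed.

Lemma triangle_out rho x : ~ `[- rho, rho]%classic x -> triangle rho x = 0.
Proof.
move=> h; apply/max_idPl; rewrite subr_le0 leNgt; apply/negP => xr; apply: h.
by rewrite /= in_itv/= -ler_norml ltW.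
Qed.

Lemma triangle_indic rho :
  triangle rho = triangle rho \_ `[- rho, rho]%classic.
Proof.
apply/funext => x; rewrite patchE; case: ifPn => // /negP h.
by apply: triangle_out => xr; apply: h; rewrite inE.
Qed.

Lemma integrable_triangle rho : leb.-integrable setT (EFin \o triangle rho).
Proof.
have := continuous_itv_integrable (- rho) rho (continuous_triangle (rho := rho)).
by rewrite integrable_mkcond// restrict_EFin -triangle_indic.
Qed.

Lemma integral_triangle_split rho (f : R -> R) : 0 < rho -> continuous f ->
  \int[leb]_x (triangle rho x * f x) =
  \int[leb]_(x in `[- rho, 0]) ((rho + x) * f x) +
  \int[leb]_(x in `[0, rho]) ((rho - x) * f x).
Proof.
move=> r0 cf.
have cg : continuous (fun x => triangle rho x * f x).
  by move=> x; apply: continuousM; [exact: continuous_triangle|exact: cf].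
have -> : \int[leb]_x (triangle rho x * f x) =
    \int[leb]_(x in `[- rho, rho]) (triangle rho x * f x).
  rewrite [RHS]Rintegral_mkcond; apply: eq_Rintegral => x _; rewrite patchE.
  case: ifPn => // /negP h; rewrite triangle_out ?mul0r// => xr.
  by apply: h; rewrite inE.
have := @Rintegral_itvB R (fun x => triangle rho x * f x) (BLeft (- rho)) (BRight rho) 0.
move=> /(_ (continuous_itv_integrable _ _ cg)); rewrite !bnd_simp => h.
have /eqP := h ltac:(lra) ltac:(lra); rewrite subr_eq => /eqP ->.
rewrite addrC; congr (_ + _).
  apply: eq_Rintegral => x; rewrite inE/= in_itv/= => /andP[x1 x2].
  congr (_ * _); rewrite /triangle ler0_norm// opprK; apply/max_idPr; lra.
rewrite Rintegral_itv_obnd_cbnd; last first.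
  apply: integrableS (continuous_itv_integrable 0 rho cg) => //.
  exact: subset_itv_oc_cc.
apply: eq_Rintegral => x; rewrite inE/= in_itv/= => /andP[x1 x2].
by congr (_ * _); rewrite /triangle ger0_norm//; apply/max_idPr; lra.
Qed.

Lemma integral_triangle_cos rho (al b : R) : 0 < rho -> al != 0 ->
  \int[leb]_x (triangle rho x * cos (al * x + b)) =
  (2 * (1 - cos (al * rho)) / al ^+ 2) * cos b.
Proof.
move=> r0 al0; rewrite integral_triangle_split//; last exact: continuous_cos_affine.
have cc (s : R) : continuous (fun x => (rho + s * x) * cos (al * x + b)).
  move=> x.
  apply: (@continuousM _ _ (fun x => rho + s * x) (fun x => cos (al * x + b))); last first.
    exact: continuous_cos_affine.
  by apply: continuousD; [exact: cst_continuous|exact: mulrl_continuous].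
have dF (x : R) : is_derive x 1 (fun x => (rho + x) * (al^-1 * sin (al * x + b))
   + al^-2 * cos (al * x + b)) ((rho + x) * cos (al * x + b)).
  by apply: is_derive_eq; rewrite /GRing.scale/=; field.
have dG (x : R) : is_derive x 1 (fun x => (rho - x) * (al^-1 * sin (al * x + b))
   - al^-2 * cos (al * x + b)) ((rho - x) * cos (al * x + b)).
  by apply: is_derive_eq; rewrite /GRing.scale/=; field.
rewrite (Rintegral_FTC2 _ dF); last 2 first.
- by lra.
- by have := cc 1; under eq_fun do rewrite mul1r.
rewrite (Rintegral_FTC2 _ dG)//; last first.
  by have := cc (-1); under eq_fun do rewrite mulN1r.
rewrite mulrN !cosD !sinD !mulr0 cosN sin0 cos0 sinN.
by field.
Qed.

(** The Fourier transform of a triangle is a Fejer kernel, hence nonnegative. *)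
Lemma triangle_fourier_ge0 rho (al : R) : 0 < rho ->
  exists2 p : R, 0 <= p &
    forall b, \int[leb]_x (triangle rho x * cos (al * x + b)) = p * cos b.
Proof.
move=> r0; have [->|al0] := eqVneq al 0.
  exists (\int[leb]_x triangle rho x).
    by apply: Rintegral_ge0 => x _; rewrite le_max lexx.
  move=> b; rewrite -RintegralZr//; last exact: integrable_triangle.
  by apply: eq_Rintegral => x _; rewrite mul0r add0r.
exists (2 * (1 - cos (al * rho)) / al ^+ 2).
  by rewrite divr_ge0 ?sqr_ge0// mulr_ge0// subr_ge0 cos_le1.
by move=> b; exact: integral_triangle_cos.
Qed.

End one_dimensional.

(** * Trigonometric polynomials on the torus *)

Section trigonometric_polynomials.
Variables (R : realType) (n : nat).
Local Notation mu := (lebesgue_rV R n).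
Local Notation T := (@torus R n).

Lemma indic_torus : \1_T = tensor (@cell R) :> ('rV[R]_n -> R).
Proof.
apply/funext => x; rewrite indicE /tensor /cell.
have [/set_mem xT|/negP xT] := boolP (x \in T).
  rewrite big1// => i _; rewrite indicE mem_set//= in_itv/=; exact: xT.
apply/esym/eqP/prodf_eq0; have [i /negP xi] : exists i, ~ (- 2^-1 <= x ord0 i < 2^-1).
  by apply/existsNP => h; apply: xT; rewrite inE.
by exists i => //; rewrite indicE memNset//= in_itv/=; exact/negP.
Qed.

Lemma measurable_torus : measurable T.
Proof.
apply/(@measurable_indicP _ _ R); rewrite indic_torus; apply: measurable_tensor.
exact: measurable_cell.
Qed.

Lemma integral_torus (f : 'rV[R]_n -> R) :
  \int[mu]_(x in T) f x = \int[mu]_x (tensor (@cell R) x * f x).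
Proof. by rewrite -indic_torus Rintegral_indic_mul. Qed.

Definition phase (nu : 'rV[int]_n) (x : 'rV[R]_n) : R :=
  2 * pi * dotmul (map_mx intr nu) x.

Lemma dotmulZl (c : R) (u x : 'rV[R]_n) : dotmul (c *: u) x = c * dotmul u x.
Proof. by rewrite /dotmul mulr_sumr; apply: eq_bigr => i _; rewrite mxE mulrA. Qed.

Lemma dotmulDl (u v x : 'rV[R]_n) : dotmul (u + v) x = dotmul u x + dotmul v x.
Proof. by rewrite /dotmul -big_split/=; apply: eq_bigr => i _; rewrite mxE mulrDl. Qed.

Lemma dotmulDr (u x y : 'rV[R]_n) : dotmul u (x + y) = dotmul u x + dotmul u y.
Proof. by rewrite /dotmul -big_split/=; apply: eq_bigr => i _; rewrite mxE mulrDr. Qed.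

Lemma dotmulZr (c : R) (u x : 'rV[R]_n) : dotmul u (c *: x) = c * dotmul u x.
Proof. by rewrite /dotmul mulr_sumr; apply: eq_bigr => i _; rewrite mxE mulrCA. Qed.

Lemma dotmulNr (u x : 'rV[R]_n) : dotmul u (- x) = - dotmul u x.
Proof. by rewrite -scaleN1r dotmulZr mulN1r. Qed.

Lemma dotmulNl (u x : 'rV[R]_n) : dotmul (- u) x = - dotmul u x.
Proof. by rewrite -scaleN1r dotmulZl mulN1r. Qed.

Lemma dotmul0l (x : 'rV[R]_n) : dotmul 0 x = 0.
Proof. by rewrite -[0](scale0r 0) dotmulZl mul0r. Qed.

Lemma phaseE nu x : phase nu x = dotmul ((2 * pi) *: map_mx intr nu) x.
Proof. by rewrite dotmulZl. Qed.

Lemma phaseD nu nu' x : phase (nu + nu') x = phase nu x + phase nu' x.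
Proof. by rewrite /phase map_mxD dotmulDl mulrDr. Qed.

Lemma phaseN nu x : phase (- nu) x = - phase nu x.
Proof. by rewrite /phase map_mxN -scaleN1r dotmulZl; ring. Qed.

Lemma phaseB nu nu' x : phase (nu - nu') x = phase nu x - phase nu' x.
Proof. by rewrite phaseD phaseN. Qed.

Lemma phaseBr nu x y : phase nu (x - y) = phase nu x - phase nu y.
Proof. by rewrite /phase dotmulDr dotmulNr mulrDr mulrN. Qed.

Lemma phaseNr nu x : phase nu (- x) = - phase nu x.
Proof. by rewrite /phase dotmulNr mulrN. Qed.

Lemma phase0 x : phase 0 x = 0.
Proof. by rewrite /phase map_mx0 dotmul0l mulr0. Qed.

Lemma measurable_cos_phase nu A : measurable_fun A (fun x => cos (phase nu x)).
Proof.
apply: measurable_funTS; under eq_fun do rewrite phaseE -[dotmul _ _]addr0.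
exact: measurable_cos_dotmul.
Qed.

Lemma measurable_sin_phase nu A : measurable_fun A (fun x => sin (phase nu x)).
Proof.
apply: measurable_funTS; under eq_fun do rewrite phaseE -[dotmul _ _]addr0.
exact: measurable_sin_dotmul.
Qed.

(** Carrying the phase b gives the sine integrals as well (take b = - pi / 2). *)
Lemma integral_torus_cos nu b :
  \int[mu]_(x in T) cos (phase nu x + b) = (nu == 0)%:R * cos b.
Proof.
rewrite integral_torus; under eq_Rintegral do rewrite phaseE.
rewrite (integral_tensor_cos (p := fun i => (nu ord0 i == 0)%:R)); last 3 first.
- exact: measurable_cell.
- exact: integrable_cell.
- move=> i c; rewrite !mxE; have [->|ni0] := eqVneq (nu ord0 i) 0.
    by rewrite mulr0; exact: integral_cell_cos0.
  have pi0 : pi != 0 :> R by rewrite gt_eqF// pi_gt0.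
  rewrite integral_cell_cos; last first.
    by rewrite !mulf_neq0// ?intr_eq0// pnatr_eq0.
  rewrite mulr0n (_ : _ / 2 = pi * (nu ord0 i)%:~R); last by field.
  suff -> : sin (pi * (nu ord0 i)%:~R) = 0 :> R by rewrite mulr0 mul0r.
  case: (nu ord0 i) => k.
    by rewrite -pmulrn mulr_natr -[_ *+ _]add0r (alternatingn (@sinDpi R)) sin0 mulr0.
  rewrite NegzE mulrNz mulrN sinN; apply/eqP; rewrite oppr_eq0; apply/eqP.
  by rewrite -pmulrn mulr_natr -[_ *+ _]add0r (alternatingn (@sinDpi R)) sin0 mulr0.
congr (_ * _); have [->|nu0] := eqVneq nu 0.
  by rewrite big1// => i _; rewrite mxE eqxx.
apply/eqP/prodf_eq0; have [i /eqP ni] : exists i, nu ord0 i <> 0.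
  apply/existsNP => h; case/eqP: nu0; apply/rowP => i; rewrite h mxE//.
by exists i => //; rewrite (negbTE ni).
Qed.

Lemma integral_torus_sin nu : \int[mu]_(x in T) sin (phase nu x) = 0.
Proof.
have := integral_torus_cos nu (- (pi / 2)); rewrite cosN cos_pihalf mulr0 => <-.
by apply: eq_Rintegral => x _; rewrite cosBpihalf.
Qed.

Lemma vol_torus : mu T = 1%E.
Proof.
have H (x : \bar R) : fine x = 1 -> x = 1%E.
  by case: x => [r /= ->//|/= /esym/eqP|/= /esym/eqP]; rewrite oner_eq0.
apply: H; have := integral_torus_cos 0 0; rewrite eqxx cos0 mulr1.
under eq_Rintegral do rewrite phase0 addr0 cos0.
by rewrite Rintegral_cst ?mul1r//; exact: measurable_torus.
Qed.

Lemma integrable_torus (A : set 'rV[R]_n) (f : 'rV[R]_n -> R) (C : R) :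
  measurable A -> A `<=` T -> measurable_fun A f ->
  (forall x, A x -> `|f x| <= C) -> mu.-integrable A (EFin \o f).
Proof.
move=> mA AT mf fC; apply: measurable_bounded_integrable => //.
  have mT := measurable_torus.
  have h : (mu A <= mu T)%E by apply: le_measure; rewrite ?inE.
  by rewrite (le_lt_trans h)// vol_torus ltry.
exists C; split; first exact: num_real.
by move=> M CM x Ax /=; rewrite (le_trans (fC x Ax))// ltW.
Qed.

(** Real and imaginary parts of the trigonometric polynomial with coefficients
a nu + i b nu at the frequencies nu of s. *)
Definition tre (s : seq 'rV[int]_n) (a b : 'rV[int]_n -> R) (x : 'rV[R]_n) : R :=
  \sum_(nu <- s) (a nu * cos (phase nu x) - b nu * sin (phase nu x)).
Definition tim (s : seq 'rV[int]_n) (a b : 'rV[int]_n -> R) (x : 'rV[R]_n) : R :=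
  \sum_(nu <- s) (a nu * sin (phase nu x) + b nu * cos (phase nu x)).

Lemma measurable_tre s a b A : measurable_fun A (tre s a b).
Proof.
apply: measurable_sumr => nu; apply: measurable_funB; apply: measurable_funM => //.
  exact: measurable_cos_phase.
exact: measurable_sin_phase.
Qed.

Lemma measurable_tim s a b A : measurable_fun A (tim s a b).
Proof.
apply: measurable_sumr => nu; apply: measurable_funD; apply: measurable_funM => //.
  exact: measurable_sin_phase.
exact: measurable_cos_phase.
Qed.

Lemma trig_bound (a b c s : R) : `|c| <= 1 -> `|s| <= 1 ->
  `|a * c + b * s| <= `|a| + `|b|.
Proof.
move=> c1 s1; rewrite (le_trans (ler_normD _ _))// !normrM.
by rewrite lerD// ler_piMr.
Qed.

Lemma tre_bound s a b x : `|tre s a b x| <= \sum_(nu <- s) (`|a nu| + `|b nu|).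
Proof.
apply: le_trans (ler_norm_sum _ _ _) _; apply: ler_sum => nu _.
by rewrite -mulNr -[`|b nu|]normrN trig_bound// ?cos_max ?sin_max.
Qed.

Lemma tim_bound s a b x : `|tim s a b x| <= \sum_(nu <- s) (`|a nu| + `|b nu|).
Proof.
apply: le_trans (ler_norm_sum _ _ _) _; apply: ler_sum => nu _.
by rewrite trig_bound// ?cos_max ?sin_max.
Qed.

Lemma tre2Dtim2 s a b x : tre s a b x ^+ 2 + tim s a b x ^+ 2 =
  \sum_(nu <- s) \sum_(ka <- s)
    ((a nu * a ka + b nu * b ka) * cos (phase (nu - ka) x) +
     (a nu * b ka - b nu * a ka) * sin (phase (nu - ka) x)).
Proof.
rewrite !expr2 /tre /tim !big_distrlr/= -big_split/=; apply: eq_bigr => nu _.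
rewrite -big_split/=; apply: eq_bigr => ka _; rewrite phaseB cosB sinB; ring.
Qed.

Lemma integrable_tre2Dtim2 A s a b : measurable A -> A `<=` T ->
  mu.-integrable A (EFin \o (fun x => tre s a b x ^+ 2 + tim s a b x ^+ 2)).
Proof.
move=> mA AT; set C := \sum_(nu <- s) (`|a nu| + `|b nu|).
apply: (integrable_torus (C := C ^+ 2 + C ^+ 2)) => //.
  apply: measurable_funD; apply: measurable_funX.
    exact: measurable_tre.
  exact: measurable_tim.
move=> x _; rewrite (le_trans (ler_normD _ _))// !normrX lerD//.
  by rewrite ler_pXn2r ?nnegrE ?tre_bound// (le_trans _ (tre_bound s a b x)).
by rewrite ler_pXn2r ?nnegrE ?tim_bound// (le_trans _ (tim_bound s a b x)).
Qed.

Lemma parseval s a b : uniq s ->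
  \int[mu]_(x in T) (tre s a b x ^+ 2 + tim s a b x ^+ 2) =
  \sum_(nu <- s) (a nu ^+ 2 + b nu ^+ 2).
Proof.
move=> us; have mT := measurable_torus.
have icos nu : mu.-integrable T (EFin \o (fun x => cos (phase nu x))).
  apply: (integrable_torus (C := 1)) => //; first exact: measurable_cos_phase.
  by move=> x _; exact: cos_max.
have isin nu : mu.-integrable T (EFin \o (fun x => sin (phase nu x))).
  apply: (integrable_torus (C := 1)) => //; first exact: measurable_sin_phase.
  by move=> x _; exact: sin_max.
under eq_Rintegral do rewrite tre2Dtim2.
have iterm nu ka : mu.-integrable T (EFin \o (fun x =>
    ((a nu * a ka + b nu * b ka) * cos (phase (nu - ka) x) +
     (a nu * b ka - b nu * a ka) * sin (phase (nu - ka) x)))).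
  by apply: integrable_addr => //; exact: integrable_scaler.
rewrite Rintegral_sumr//; last by move=> nu; exact: integrable_sumr.
rewrite big_seq [RHS]big_seq; apply: eq_bigr => nu nus; rewrite Rintegral_sumr//.
rewrite (bigD1_seq nu)//= big1_seq => [|ka /andP[kanu _]].
  rewrite RintegralD//; [|exact: integrable_scaler..].
  rewrite !RintegralZl// integral_torus_sin mulr0.
  have := integral_torus_cos (nu - nu) 0; under eq_Rintegral do rewrite addr0.
  by move=> ->; rewrite subrr eqxx cos0 !addr0 !mulr1 !expr2.
rewrite RintegralD//; [|exact: integrable_scaler..].
rewrite !RintegralZl// integral_torus_sin mulr0.
have := integral_torus_cos (nu - ka) 0; under eq_Rintegral do rewrite addr0.
by move=> ->; rewrite subr_eq0 eq_sym (negbTE kanu) mul0r mulr0 addr0.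
Qed.

Section pairing.
Variables (A : set 'rV[R]_n) (mA : measurable A) (u v : 'rV[R]_n -> R).
Hypotheses (iu : mu.-integrable A (EFin \o u)) (iv : mu.-integrable A (EFin \o v)).

(** Real and imaginary parts of the Fourier coefficients of 1_A (u + i v). *)
Definition cre nu := \int[mu]_(x in A) (u x * cos (phase nu x) + v x * sin (phase nu x)).
Definition cim nu := \int[mu]_(x in A) (v x * cos (phase nu x) - u x * sin (phase nu x)).

Lemma integrable_mul_cos (w : 'rV[R]_n -> R) nu : mu.-integrable A (EFin \o w) ->
  mu.-integrable A (EFin \o (fun x => w x * cos (phase nu x))).
Proof.
move=> iw; apply: (@integrable_mulr_bounded _ _ _ _ _ mA _ _ 1) => //.
  exact: measurable_cos_phase.
by move=> x _; exact: cos_max.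
Qed.

Lemma integrable_mul_sin (w : 'rV[R]_n -> R) nu : mu.-integrable A (EFin \o w) ->
  mu.-integrable A (EFin \o (fun x => w x * sin (phase nu x))).
Proof.
move=> iw; apply: (@integrable_mulr_bounded _ _ _ _ _ mA _ _ 1) => //.
  exact: measurable_sin_phase.
by move=> x _; exact: sin_max.
Qed.

Lemma integrable_cre nu :
  mu.-integrable A (EFin \o (fun x => u x * cos (phase nu x) + v x * sin (phase nu x))).
Proof.
by apply: integrable_addr => //; [exact: integrable_mul_cos|exact: integrable_mul_sin].
Qed.

Lemma integrable_cim nu :
  mu.-integrable A (EFin \o (fun x => v x * cos (phase nu x) - u x * sin (phase nu x))).
Proof.
by apply: integrable_subr => //; [exact: integrable_mul_cos|exact: integrable_mul_sin].
Qed.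

(** The integrand is the real part of f times the conjugate of the polynomial, for
f = u + i v. *)
Lemma integral_pairing s a b :
  mu.-integrable A (EFin \o (fun x => u x * tre s a b x + v x * tim s a b x)) /\
  \int[mu]_(x in A) (u x * tre s a b x + v x * tim s a b x) =
  \sum_(nu <- s) (a nu * cre nu + b nu * cim nu).
Proof.
have E x : u x * tre s a b x + v x * tim s a b x = \sum_(nu <- s)
    (a nu * (u x * cos (phase nu x) + v x * sin (phase nu x)) +
     b nu * (v x * cos (phase nu x) - u x * sin (phase nu x))).
  rewrite /tre /tim !mulr_sumr -big_split/=; apply: eq_bigr => nu _; ring.
have iF nu : mu.-integrable A (EFin \o (fun x =>
    (a nu * (u x * cos (phase nu x) + v x * sin (phase nu x)) +
     b nu * (v x * cos (phase nu x) - u x * sin (phase nu x))))).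
  apply: integrable_addr => //; apply: integrable_scaler => //.
    exact: integrable_cre.
  exact: integrable_cim.
split.
  by under [X in EFin \o X]eq_fun do rewrite E; exact: integrable_sumr.
under eq_Rintegral do rewrite E.
rewrite Rintegral_sumr//; apply: eq_bigr => nu _.
have ire := integrable_cre nu; have iim := integrable_cim nu.
by rewrite RintegralD// ?RintegralZl//; exact: integrable_scaler.
Qed.

(** Integrate |f - p|^2 >= 0 over A, where p is the partial Fourier sum of 1_A f;
the mass of p over A is at most its mass over the torus, which Parseval gives. *)
Lemma bessel s : A `<=` T -> uniq s ->
  mu.-integrable A (EFin \o (fun x => u x ^+ 2 + v x ^+ 2)) ->
  \sum_(nu <- s) (cre nu ^+ 2 + cim nu ^+ 2) <=
  \int[mu]_(x in A) (u x ^+ 2 + v x ^+ 2).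
Proof.
move=> AT us i2.
have [ip Ep] := integral_pairing s cre cim.
have it := integrable_tre2Dtim2 s cre cim mA AT.
pose p x := u x * tre s cre cim x + v x * tim s cre cim x.
have h : 0 <= \int[mu]_(x in A) ((u x ^+ 2 + v x ^+ 2) - 2 * p x +
    (tre s cre cim x ^+ 2 + tim s cre cim x ^+ 2)).
  apply: Rintegral_ge0 => x _; rewrite /p.
  have := sqr_ge0 (u x - tre s cre cim x).
  have := sqr_ge0 (v x - tim s cre cim x); nra.
have i3 : mu.-integrable A (EFin \o (fun x => 2 * p x)) by exact: integrable_scaler.
rewrite RintegralD// in h; last exact: integrable_subr.
rewrite RintegralB// RintegralZl// Ep in h.
have h2 : \int[mu]_(x in A) (tre s cre cim x ^+ 2 + tim s cre cim x ^+ 2) <=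
    \sum_(nu <- s) (cre nu ^+ 2 + cim nu ^+ 2).
  rewrite -parseval// /Rintegral fine_le//.
  - exact: integrable_fin_num it.
  - apply: integrable_fin_num; first exact: measurable_torus.
    by apply: integrable_tre2Dtim2 => //; exact: measurable_torus.
  - apply: ge0_subset_integral => //; first exact: measurable_torus.
    + apply/measurable_EFinP; apply: measurable_funD; apply: measurable_funX.
        exact: measurable_tre.
      exact: measurable_tim.
    + by move=> x _; rewrite lee_fin addr_ge0// sqr_ge0.
have E2 : \sum_(nu <- s) (cre nu * cre nu + cim nu * cim nu) =
    \sum_(nu <- s) (cre nu ^+ 2 + cim nu ^+ 2).
  by apply: eq_bigr => nu _; rewrite !expr2.
rewrite E2 in h; lra.
Qed.

End pairing.

End trigonometric_polynomials.

(** * Limits of bounded functions *)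

Section bounded_limits.
Variable R : realType.

Lemma bounded_cvg_integral d (T : measurableType d) (mu : {measure set T -> \bar R})
    (D : set T) (f : T -> R) (k_ : nat -> T -> R) (k : T -> R) (C : R) :
  measurable D -> mu.-integrable D (EFin \o f) ->
  (forall j, measurable_fun D (k_ j)) -> (forall j x, D x -> `|k_ j x| <= C) ->
  (forall x, D x -> k_ ^~ x @ \oo --> k x) ->
  (fun j => \int[mu]_(x in D) (f x * k_ j x)) @ \oo --> \int[mu]_(x in D) (f x * k x).
Proof.
move=> mD fi mk kC kk.
have mf : measurable_fun D f by apply/measurable_EFinP; case/integrableP : fi.
have mkl : measurable_fun D k by apply: measurable_fun_cvg kk.
have kC' x : D x -> `|k x| <= C.
  by move=> Dx; apply: cvgr_to_le (cvg_norm (kk x Dx)) _; apply: nearW => j; exact: kC.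
have iC : mu.-integrable D (fun x => (C * `|f x|)%:E).
  by apply: (integrable_scaler mD C (f := fun x => `|f x|)); exact: integrable_norm.
have [|||||_ _ h] := @dominated_convergence _ T R mu D mD
  (fun j x => (f x * k_ j x)%:E) (fun x => (f x * k x)%:E) (fun x => (C * `|f x|)%:E).
- by move=> j; apply/measurable_EFinP; exact: measurable_funM.
- by apply/measurable_EFinP; exact: measurable_funM.
- apply: aeW => x Dx; apply/cvg_EFin; first exact: nearW.
  by apply: cvgM; [exact: cvg_cst|exact: kk].
- exact: iC.
- by apply: aeW => x j Dx; rewrite lee_fin normrM mulrC ler_wpM2r// kC.
have ik : mu.-integrable D (EFin \o (fun x => f x * k x)).
  exact: (integrable_mulr_bounded mD fi mkl kC').
by have := h; rewrite EFin_Rintegral// => /fine_cvgP[_].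
Qed.

(** The exponential is a limit of polynomials with nonnegative coefficients,
uniformly bounded on bounded sets. *)
Lemma exp_closed (T : Type) (P : (T -> R) -> Prop) :
  (forall c : R, 0 <= c -> P (fun=> c)) ->
  (forall f g, P f -> P g -> P (fun x => f x + g x)) ->
  (forall f g, P f -> P g -> P (fun x => f x * g x)) ->
  (forall (k_ : nat -> T -> R) k C, (forall j, P (k_ j)) ->
     (forall j x, `|k_ j x| <= C) -> (forall x, k_ ^~ x @ \oo --> k x) -> P k) ->
  forall k C, (forall x, `|k x| <= C) -> P k -> P (fun x => expR (k x)).
Proof.
move=> Pc PD PM Plim k C kC Pk.
apply: (Plim (fun j x => series (exp_coeff (k x)) j) _ (expR C)).
- move=> j; have PX i : P (fun x => exp_coeff (k x) i).
    rewrite /exp_coeff/=; apply: (PM _ (fun=> i`!%:R^-1)); last first.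
      by apply: Pc; rewrite invr_ge0.
    elim: i => [|i ih]; first by under eq_fun do rewrite expr0; exact: Pc.
    by under eq_fun do rewrite exprS; exact: PM.
  elim: j => [|j ih].
    by under eq_fun do rewrite /series/= big_geq//; exact: Pc.
  by under eq_fun do rewrite /series/= big_nat_recr//=; exact: PD.
- move=> j x; have C0 : 0 <= C by exact: le_trans (kC x).
  rewrite /series/=; apply: le_trans (ler_norm_sum _ _ _) _.
  apply: (@le_trans _ _ (series (exp_coeff C) j)).
    rewrite /series/=; apply: ler_sum => i _.
    rewrite /exp_coeff/= normrM normrX normfV normr_nat ler_wpM2r ?invr_ge0//.
    by rewrite lerXn2r ?nnegrE.
  apply: nondecreasing_cvgn_le; last exact: is_cvg_series_exp_coeff.
  apply: nondecreasing_series => i _ _.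
  by rewrite /exp_coeff/= divr_ge0// exprn_ge0.
- move=> x; exact: is_cvg_series_exp_coeff.
Qed.

(** 2 (1 - cos (t / m)) m^2 = t^2 (sin h / h)^2 with h = t / (2 m). *)
Lemma cvg_versine (t : R) :
  (fun m : nat => 2 * m.+1%:R ^+ 2 * (1 - cos (m.+1%:R^-1 * t))) @ \oo --> t ^+ 2.
Proof.
have [->|t0] := eqVneq t 0.
  under eq_fun do rewrite mulr0 cos0 subrr mulr0.
  by rewrite expr0n; exact: cvg_cst.
pose h m : R := m.+1%:R^-1 * (t / 2).
have h0 : (forall m, h m != 0) /\ h @ \oo --> 0.
  split=> [m|]; first by rewrite /h !mulf_neq0// invr_eq0 pnatr_eq0.
  by rewrite -(mul0r (t / 2)); apply: cvgM; [exact: cvg_harmonic|exact: cvg_cst].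
have ds : is_derive (0 : R) 1 (@sin R) (cos 0) by exact: is_derive_sin.
have hl : (fun y : R => y^-1 * sin y) @ (0 : R)^' --> (1 : R).
  have /= dd := @ex_derive _ _ _ _ _ _ _ ds; have /= dv := @derive_val _ _ _ _ _ _ _ ds.
  have := dd; rewrite /derivable; move/cvg_ex => [l hl].
  have l1 : l = 1 by rewrite -(@cos0 R) -dv; apply/esym/cvg_lim.
  rewrite -l1; apply: cvg_trans hl; apply: near_eq_cvg; apply: nearW => y.
  by rewrite /GRing.scale/= sin0 subr0 addr0 mulr1.
have H := (cvgr_dnbhsP _ _ _).1 hl h h0.
have H2 : (fun m => ((h m)^-1 * sin (h m)) ^+ 2 * t ^+ 2) @ \oo --> t ^+ 2.
  rewrite -[X in _ --> X]mul1r -(expr1n R 2); apply: cvgM; last exact: cvg_cst.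
  by rewrite !expr2; apply: cvgM.
apply: cvg_trans H2; apply: near_eq_cvg; apply: nearW => m.
have m0 : m.+1%:R != 0 :> R by rewrite pnatr_eq0.
have -> : m.+1%:R^-1 * t = h m *+ 2.
  by rewrite /h mulr2n; move: m.+1%:R m0 => w m0; field.
rewrite cos_mulr2n cos2sin2; move: (sin (h m)) => z; rewrite /h.
by move: m.+1%:R m0 => w m0; field; rewrite t0 m0.
Qed.

End bounded_limits.

(** * Positive definite functions *)

Section positive_definite.
Variables (R : realType) (n : nat).
Local Notation mu := (lebesgue_rV R n).
Implicit Types (r k : 'rV[R]_n -> R).

(** Integrating against cosines only, this says that the even part of r has a
nonnegative Fourier transform, which is all that pairing r with even functions
can see. *)
Definition pos_def r : Prop :=
  mu.-integrable setT (EFin \o r) /\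
  forall al : 'rV[R]_n, 0 <= \int[mu]_x (r x * cos (dotmul al x)).

Lemma measurable_cos_dotmul0 (al : 'rV[R]_n) :
  measurable_fun setT (fun x => cos (dotmul al x)).
Proof.
by under eq_fun do rewrite -[dotmul _ _]addr0; exact: measurable_cos_dotmul.
Qed.

Lemma integrable_mul_cos_dotmul r (al : 'rV[R]_n) : mu.-integrable setT (EFin \o r) ->
  mu.-integrable setT (EFin \o (fun x => r x * cos (dotmul al x))).
Proof.
move=> ri; apply: (@integrable_mulr_bounded _ _ _ _ _ measurableT _ _ 1) => //.
  exact: measurable_cos_dotmul0.
by move=> x _; exact: cos_max.
Qed.

(** Multipliers form a cone closed under products and bounded limits. This is what
replaces Fourier inversion: it shows that Gaussians are multipliers, so that r has
nonnegative integral against every Gaussian centered at 0. *)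
Definition multiplier k : Prop :=
  [/\ measurable_fun setT k, exists C, forall x, `|k x| <= C &
      forall r, pos_def r -> pos_def (fun x => r x * k x)].

Lemma multiplier_cst (c : R) : 0 <= c -> multiplier (fun=> c).
Proof.
move=> c0; split=> //; first by exists `|c|.
move=> r [ri rp]; split.
  by under [X in EFin \o X]eq_fun do rewrite mulrC; exact: integrable_scaler.
move=> al; rewrite (_ : \int[mu]_x _ = c * \int[mu]_x (r x * cos (dotmul al x))).
  by rewrite mulr_ge0.
rewrite -RintegralZl//; last exact: integrable_mul_cos_dotmul.
by apply: eq_Rintegral => x _; rewrite mulrCA -mulrA mulrCA.
Qed.

Lemma multiplierD k1 k2 :
  multiplier k1 -> multiplier k2 -> multiplier (fun x => k1 x + k2 x).
Proof.
move=> [m1 [C1 b1] p1] [m2 [C2 b2] p2]; split; first exact: measurable_funD.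
  by exists (C1 + C2) => x; rewrite (le_trans (ler_normD _ _))// lerD.
move=> r pr; have [i1 q1] := p1 r pr; have [i2 q2] := p2 r pr; split.
  under [X in EFin \o X]eq_fun do rewrite mulrDr.
  exact: integrable_addr.
move=> al; have := addr_ge0 (q1 al) (q2 al).
rewrite -RintegralD//; [|exact: integrable_mul_cos_dotmul..].
by under eq_Rintegral do rewrite -mulrDl -mulrDr.
Qed.

Lemma multiplierM k1 k2 :
  multiplier k1 -> multiplier k2 -> multiplier (fun x => k1 x * k2 x).
Proof.
move=> [m1 [C1 b1] p1] [m2 [C2 b2] p2]; split; first exact: measurable_funM.
  by exists (C1 * C2) => x; rewrite normrM ler_pM.
move=> r pr; have := p2 _ (p1 r pr).
by under eq_fun do rewrite -mulrA.
Qed.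

Lemma multiplier_lim (k_ : nat -> 'rV[R]_n -> R) k (C : R) :
  (forall j, multiplier (k_ j)) -> (forall j x, `|k_ j x| <= C) ->
  (forall x, k_ ^~ x @ \oo --> k x) -> multiplier k.
Proof.
move=> mk kC kk.
have mm : measurable_fun setT k.
  by apply: (measurable_fun_cvg (h := k_)) => // j; have [] := mk j.
have kC' x : `|k x| <= C.
  by apply: cvgr_to_le (cvg_norm (kk x)) _; exact: nearW.
split=> //; first by exists C.
move=> r pr; have [ri _] := pr; split.
  exact: integrable_mulr_bounded.
move=> al; have h := @bounded_cvg_integral R _ _ mu setT
  (fun x => r x * cos (dotmul al x)) k_ k C measurableT
  (integrable_mul_cos_dotmul al ri).
have {}h := h (fun j => let: And3 m _ _ := mk j in m) (fun j x _ => kC j x) (fun x _ => kk x).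
under eq_Rintegral do rewrite mulrAC.
apply: cvgr_to_ge h _; apply: nearW => j.
under eq_Rintegral do rewrite mulrAC.
by have [_ _ /(_ r pr)[_ /(_ al)]] := mk j.
Qed.

(** The product of two cosines is a half sum of cosines, so multiplying by a
cosine averages two values of the Fourier transform. *)
Lemma multiplier_cos (be : 'rV[R]_n) : multiplier (fun x => cos (dotmul be x)).
Proof.
split; [exact: measurable_cos_dotmul0|by exists 1 => x; exact: cos_max|].
move=> r [ri rp]; split; first exact: integrable_mul_cos_dotmul.
move=> al; have := addr_ge0 (rp (be + al)) (rp (be - al)).
rewrite -RintegralD//; [|exact: integrable_mul_cos_dotmul..].
rewrite (_ : \int[mu]_x _ = \int[mu]_x (2 * (r x * cos (dotmul be x) * cos (dotmul al x)))).
  rewrite RintegralZl//; first by rewrite pmulr_rge0.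
  by apply: integrable_mul_cos_dotmul; exact: integrable_mul_cos_dotmul.
apply: eq_Rintegral => x _.
rewrite !dotmulDl dotmulNl.
by rewrite cosD cosB; ring.
Qed.

Lemma multiplier_exp k : multiplier k -> multiplier (fun x => expR (k x)).
Proof.
move=> mk; have [_ [C kC] _] := mk; apply: exp_closed kC mk.
- exact: multiplier_cst.
- exact: multiplierD.
- exact: multiplierM.
- exact: multiplier_lim.
Qed.

Lemma multiplier_sum (I : Type) (s : seq I) (k : I -> 'rV[R]_n -> R) :
  (forall i, multiplier (k i)) -> multiplier (fun x => \sum_(i <- s) k i x).
Proof.
move=> mk; elim: s => [|i s ih].
  by under eq_fun do rewrite big_nil; exact: multiplier_cst.
by under eq_fun do rewrite big_cons; exact: multiplierD.
Qed.

Definition sqnorm (x : 'rV[R]_n) : R := \sum_(i < n) x ord0 i ^+ 2.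

(** A Gaussian is the bounded pointwise limit of the functions
exp (- la * sum_i 2 m^2 (1 - cos (x_i / m))), each of which is a positive constant
times the exponential of a positive combination of cosines. *)
Lemma multiplier_gaussian (la : R) : 0 <= la ->
  multiplier (fun x => expR (- (la * sqnorm x))).
Proof.
move=> la0.
pose c m i x : R := cos (dotmul (m.+1%:R^-1 *: delta_mx ord0 i : 'rV[R]_n) x).
have cE m i x : c m i x = cos (m.+1%:R^-1 * x ord0 i).
  rewrite /c dotmulZl /dotmul (bigD1 i)//= mxE !eqxx mul1r big1 ?addr0//.
  by move=> j ji; rewrite mxE (negbTE ji) andbF mul0r.
pose g m x := expR (- (la * \sum_(i < n) 2 * m.+1%:R ^+ 2 * (1 - c m i x))).
apply: (multiplier_lim (k_ := g) (C := 1)) => [m|m x|x].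
- have -> : g m = fun x => expR (- (la * \sum_(i < n) 2 * m.+1%:R ^+ 2)) *
      expR (\sum_(i < n) la * (2 * m.+1%:R ^+ 2) * c m i x).
    apply/funext => x; rewrite -expRD; congr expR.
    have -> : \sum_(i < n) 2 * m.+1%:R ^+ 2 * (1 - c m i x) =
        \sum_(i < n) 2 * m.+1%:R ^+ 2 - \sum_(i < n) 2 * m.+1%:R ^+ 2 * c m i x.
      by rewrite -sumrB; apply: eq_bigr => i _; ring.
    rewrite [X in _ = _ + X](_ : _ = la * \sum_(i < n) 2 * m.+1%:R ^+ 2 * c m i x).
      by ring.
    by rewrite mulr_sumr; apply: eq_bigr => i _; ring.
  apply: multiplierM; first by apply: multiplier_cst; exact: expR_ge0.
  apply: multiplier_exp; apply: multiplier_sum => i; apply: multiplierM.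
    by apply: multiplier_cst; rewrite !mulr_ge0// exprn_ge0.
  exact: multiplier_cos.
- rewrite ger0_norm ?expR_ge0// -expR0 ler_expR oppr_le0 mulr_ge0//.
  apply: sumr_ge0 => i _; rewrite !mulr_ge0 ?exprn_ge0 ?subr_ge0 ?cos_le1//.
- apply: continuous_cvg; first exact: continuous_expR.
  apply: cvgN; apply: cvgM; first exact: cvg_cst.
  rewrite /sqnorm; apply: (@cvg_big _ _ +%R 0) => [|i _]; first exact: add_continuous.
  under eq_fun do rewrite cE.
  exact: cvg_versine.
Qed.

Lemma pos_def_gaussian r (la : R) : pos_def r -> 0 <= la ->
  0 <= \int[mu]_x (r x * expR (- (la * sqnorm x))).
Proof.
move=> pr /multiplier_gaussian[_ _ /(_ r pr)[_ /(_ 0)]].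
by under eq_Rintegral do rewrite dotmul0l cos0 mulr1.
Qed.

Lemma integral_scaled_torus (rho : R) : 0 < rho ->
  mu.-integrable setT (EFin \o (fun x => \1_(@torus R n) (rho^-1 *: x))) /\
  \int[mu]_x \1_(@torus R n) (rho^-1 *: x) = rho ^+ n.
Proof.
move=> r0.
have mT : measurable_fun setT (\1_(@torus R n) : _ -> R).
  by apply: measurable_indic; exact: measurable_torus.
have iT : mu.-integrable setT (EFin \o (\1_(@torus R n) : _ -> R)).
  by rewrite indic_torus; apply: integrable_tensor; [exact: measurable_cell|exact: integrable_cell].
have rV0 : rho^-1 != 0 by rewrite invr_eq0 gt_eqF.
have [i1] := integral_affine 0 rV0 mT iT.
have -> : \int[mu]_x \1_(@torus R n) x = 1 :> R.
  under eq_Rintegral do rewrite -[\1_ _ _]mulr1.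
  rewrite Rintegral_indic_mul Rintegral_cst ?mul1r; last exact: measurable_torus.
  by rewrite [X in fine X](@vol_torus R n).
move=> E; split; first by move: i1; under eq_fun do rewrite addr0.
move: E; under eq_Rintegral do rewrite addr0.
rewrite gtr0_norm ?invr_gt0// exprVn => /eqP.
have rn0 : rho ^+ n != 0 by rewrite expf_neq0// gt_eqF.
rewrite eq_sym mulrC => /eqP h; apply: (mulIf (x := (rho ^+ n)^-1)).
  by rewrite invr_eq0.
by rewrite h mulfV.
Qed.

(** If r were negative at 0, say r < - c on a neighborhood, its integral
against a narrow Gaussian exp (- la |x|^2) would be negative: on a small cube the
Gaussian is at least exp (- la eta^2 / 2), and off the neighborhood at most
exp (- la eta^2). *)
Lemma pos_def_ge0 r : pos_def r -> {for 0, continuous r} -> 0 <= r 0.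
Proof.
move=> pr cr; rewrite leNgt; apply/negP => r0.
have [ri _] := pr.
pose c := - r 0 / 2; have c0 : 0 < c by rewrite /c; lra.
have /nbhs_ballP[eta /= eta0 Heta] : \forall x \near (0 : 'rV[R]_n), r x < - c.
  have := cr; rewrite /prop_for /continuous_at => /cvgr_lt; apply.
  by rewrite /c; lra.
(* The cube of side rho has diameter less than eta; n.+1 rather than n avoids a
division by zero. *)
have [rho rho0 re] : exists2 rho, 0 < rho & rho * n.+1%:R = eta.
  exists (eta / n.+1%:R); first by rewrite divr_gt0// ltr0n.
  by rewrite divfK// pnatr_eq0.
pose N := \int[mu]_x `|r x|.
have N0 : 0 <= N by exact: Rintegral_ge0.
(* y is chosen so that c rho^n (1 + y) > N, hence N exp (- y) < c rho^n. *)
pose y := (N + 1) / (c * rho ^+ n).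
have cr0 : 0 < c * rho ^+ n by rewrite mulr_gt0// exprn_gt0.
have y0 : 0 < y by rewrite divr_gt0// ltr_wpDl.
pose la := 2 * y / eta ^+ 2.
have la0 : 0 < la by rewrite divr_gt0 ?exprn_gt0// mulr_gt0.
have [iT ET] := integral_scaled_torus rho0.
have inorm : mu.-integrable setT (EFin \o (fun x => `|r x|)) by exact: integrable_norm.
have sqnorm_cube x : @torus R n (rho^-1 *: x) -> sqnorm x <= eta ^+ 2 / 2.
  move=> xT; apply: (@le_trans _ _ (n%:R * (rho ^+ 2 / 4))).
    rewrite mulr_natl -[X in _ *+ X]card_ord -sumr_const; apply: ler_sum => i _.
    have := xT i; rewrite mxE => /andP[x1 x2].
    have x1' : - (rho / 2) <= x ord0 i by move: x1; rewrite ler_pdivlMl//; lra.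
    have x2' : x ord0 i <= rho / 2 by move: x2; rewrite ltr_pdivrMl//; lra.
    nra.
  rewrite -re exprMn -[n.+1%:R]natr1.
  have := ler0n R n; have := exprn_gt0 2 rho0.
  move: (n%:R : R) (rho ^+ 2) => w z z0 w0.
  have h1 := mulr_ge0 (ltW z0) w0; have h2 := mulr_ge0 (ltW z0) (mulr_ge0 w0 w0).
  nra.
have le1 x : (r x * expR (- (la * sqnorm x))) * expR y <=
    `|r x| * expR (- y) - c * \1_(@torus R n) (rho^-1 *: x).
  rewrite -mulrA -expRD.
  have lae : la * eta ^+ 2 = 2 * y by rewrite /la; field; rewrite gt_eqF.
  have [q1|q1] := leP (eta ^+ 2) (sqnorm x).
    rewrite indicE memNset => [|/sqnorm_cube]; last first.
      have := exprn_gt0 2 eta0; lra.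
    rewrite mulr0 subr0; apply: (@le_trans _ _ (`|r x| * expR (- (la * sqnorm x) + y))).
      by rewrite ler_wpM2r ?expR_ge0// ler_norm.
    rewrite ler_wpM2l// ler_expR.
    have : la * eta ^+ 2 <= la * sqnorm x by rewrite ler_wpM2l// ltW.
    lra.
  have rx : r x < - c.
    apply: Heta; split => // i j; rewrite ord1 -ball_normE/= mxE sub0r normrN.
    rewrite -(@ltr_pXn2r _ 2)// ?nnegrE ?normr_ge0// ?ltW// real_normK ?num_real//.
    apply: le_lt_trans q1; rewrite /sqnorm (bigD1 j)//= lerDl.
    by apply: sumr_ge0 => k _; exact: sqr_ge0.
  apply: (@le_trans _ _ (- c * \1_(@torus R n) (rho^-1 *: x))); last first.
    by rewrite mulNr lerDr mulr_ge0// expR_ge0.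
  have e0 := expR_gt0 (- (la * sqnorm x) + y).
  rewrite indicE; have [/set_mem xT|_] := boolP (rho^-1 *: x \in @torus R n); last first.
    by rewrite mulr0n mulr0; nra.
  have q2 : la * sqnorm x <= y.
    have q2 := sqnorm_cube _ xT; rewrite (le_trans (ler_wpM2l (ltW la0) q2))//.
    by rewrite -(ler_pM2l (_ : 0 < 2 :> R))// -lae; lra.
  have e1 : 1 <= expR (- (la * sqnorm x) + y).
    by rewrite -expR0 ler_expR; lra.
  rewrite mulr1n mulr1; nra.
have iG : mu.-integrable setT (EFin \o (fun x => r x * expR (- (la * sqnorm x)))).
  have [mG [C GC] _] := multiplier_gaussian (ltW la0).
  exact: (integrable_mulr_bounded measurableT ri mG (fun x _ => GC x)).
have : (\int[mu]_x (r x * expR (- (la * sqnorm x)))) * expR y <=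
    N * expR (- y) - c * rho ^+ n.
  rewrite -ET -RintegralZr// -RintegralZr// -RintegralZl// -RintegralB//.
  - apply: le_Rintegral => //.
    + by under [X in EFin \o X]eq_fun do rewrite mulrC; exact: integrable_scaler.
    + apply: integrable_subr => //; last exact: integrable_scaler.
      by under [X in EFin \o X]eq_fun do rewrite mulrC; exact: integrable_scaler.
  - by under [X in EFin \o X]eq_fun do rewrite mulrC; exact: integrable_scaler.
  - exact: integrable_scaler.
have h0 := pos_def_gaussian pr (ltW la0).
have h1 := mulr_ge0 h0 (expR_ge0 y).
have h2 : N * expR (- y) < c * rho ^+ n.
  rewrite expRN ltr_pdivrMr ?expR_gt0//.
  apply: (@lt_le_trans _ _ (c * rho ^+ n * (1 + y))); last first.
    by rewrite ler_wpM2l ?(ltW cr0)// expR_ge1Dx.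
  have -> : c * rho ^+ n * (1 + y) = c * rho ^+ n + (N + 1).
    by rewrite /y; move: (c * rho ^+ n) cr0 => z z0; field; rewrite gt_eqF.
  by lra.
lra.
Qed.

(** The second difference 2 r - r (. - x) - r (. + x) has Fourier transform
2 (1 - cos (al . x)) times that of r, so it is again positive definite, and its value
at 0 is nonnegative. *)
Lemma pos_def_max r (x : 'rV[R]_n) : pos_def r -> continuous r ->
  r x + r (- x) <= 2 * r 0.
Proof.
move=> pr cr; have [ri rp] := pr; have mr := measurable_integrand ri.
have shift t : mu.-integrable setT (EFin \o (fun y => r (y + t))) /\
    forall al, \int[mu]_y (r (y + t) * cos (dotmul al y)) =
      \int[mu]_y (r y * cos (dotmul al y - dotmul al t)).
  split.
    have [+ _] := integral_affine t (oner_neq0 _) mr ri.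
    by under eq_fun do rewrite scale1r.
  move=> al; pose f y := r y * cos (dotmul al y - dotmul al t).
  have mf : measurable_fun setT f.
    by apply: measurable_funM => //; exact: measurable_cos_dotmul.
  have fi : mu.-integrable setT (EFin \o f).
    apply: (@integrable_mulr_bounded _ _ _ _ _ measurableT _ _ 1) => //.
      exact: measurable_cos_dotmul.
    by move=> y _; exact: cos_max.
  have [_ ->] := integral_affine t (oner_neq0 _) mf fi.
  rewrite normr1 expr1n mul1r; apply: eq_Rintegral => y _.
  by rewrite /f scale1r dotmulDr addrK.
pose r1 y := 2 * r y - r (y + x) - r (y - x).
have [i1 E1] := shift x; have [i2 E2] := shift (- x).
have i3 : mu.-integrable setT (EFin \o (fun y => 2 * r y)) by exact: integrable_scaler.
have pr1 : pos_def r1.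
  split; first by apply: integrable_subr => //; exact: integrable_subr.
  move=> al; have ic := integrable_mul_cos_dotmul al.
  have ish t : mu.-integrable setT
      (EFin \o (fun y => r y * cos (dotmul al y - dotmul al t))).
    apply: (@integrable_mulr_bounded _ _ _ _ _ measurableT _ _ 1) => //.
      exact: measurable_cos_dotmul.
    by move=> y _; exact: cos_max.
  have -> : \int[mu]_y (r1 y * cos (dotmul al y)) =
      \int[mu]_y (2 * r y * cos (dotmul al y)) -
      \int[mu]_y (r (y + x) * cos (dotmul al y)) -
      \int[mu]_y (r (y - x) * cos (dotmul al y)).
    have i12 : mu.-integrable setT (EFin \o
        (fun y => 2 * r y * cos (dotmul al y) - r (y + x) * cos (dotmul al y))).
      by apply: integrable_subr => //; exact: ic.
    rewrite -RintegralB//; [|exact: ic..].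
    rewrite -RintegralB//; last exact: ic.
    by apply: eq_Rintegral => y _; rewrite /r1; ring.
  rewrite E1 E2.
  have -> : \int[mu]_y (2 * r y * cos (dotmul al y)) =
      2 * \int[mu]_y (r y * cos (dotmul al y)).
    rewrite -RintegralZl//; last exact: ic.
    by apply: eq_Rintegral => y _; rewrite mulrA.
  have E3 : \int[mu]_y (r y * cos (dotmul al y - dotmul al x)) +
      \int[mu]_y (r y * cos (dotmul al y - dotmul al (- x))) =
      2 * cos (dotmul al x) * \int[mu]_y (r y * cos (dotmul al y)).
    rewrite -RintegralD// -RintegralZl//; last exact: ic.
    by apply: eq_Rintegral => y _; rewrite dotmulNr opprK cosB cosD; ring.
  rewrite -addrA -opprD E3 -mulrBl mulr_ge0//.
have csh (t : 'rV[R]_n) : {for 0, continuous (fun y : 'rV[R]_n => r (y + t))}.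
  apply: (@continuous_comp _ _ _ (fun y : 'rV[R]_n => y + t) r 0); last exact: cr.
  by apply: continuousD; [exact: cvg_id|exact: cst_continuous].
have cr1 : {for 0, continuous r1}.
  apply: continuousB; last exact: csh.
  apply: continuousB; last exact: csh.
  by apply: continuousM; [exact: cst_continuous|exact: cr].
have := pos_def_ge0 pr1 cr1; rewrite /r1 !add0r; lra.
Qed.

End positive_definite.

(** * The inequality for polynomials with nonnegative coefficients *)

Section delsarte_inequality.
Variables (R : realType) (n : nat).
Local Notation mu := (lebesgue_rV R n).
Local Notation T := (@torus R n).

Lemma Rintegral_reflect (f : 'rV[R]_n -> R) : mu.-integrable setT (EFin \o f) ->
  mu.-integrable setT (EFin \o (fun x => f (- x))) /\
  \int[mu]_x f (- x) = \int[mu]_x f x.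
Proof.
move=> fi; have mf := measurable_integrand fi.
have n10 : (-1 : R) != 0 by rewrite oppr_eq0 oner_neq0.
have [+ ->] := integral_affine 0 n10 mf fi.
rewrite normrN normr1 expr1n mul1r.
under [X in EFin \o X]eq_fun do rewrite scaleN1r addr0.
by under [X in _ -> _ /\ _ = X]eq_Rintegral do rewrite scaleN1r addr0.
Qed.

Lemma pos_def_scale (r : 'rV[R]_n -> R) (s : R) : 0 < s -> pos_def r ->
  pos_def (fun x => r (s^-1 *: x)) /\
  \int[mu]_x r (s^-1 *: x) = s ^+ n * \int[mu]_x r x.
Proof.
move=> s0 [ri rp]; have mr := measurable_integrand ri.
have sV0 : s^-1 != 0 by rewrite invr_eq0 gt_eqF.
have sn0 : s ^+ n != 0 by rewrite expf_neq0// gt_eqF.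
have scal (f : 'rV[R]_n -> R) : mu.-integrable setT (EFin \o f) ->
    mu.-integrable setT (EFin \o (fun x => f (s^-1 *: x))) /\
    \int[mu]_x f (s^-1 *: x) = s ^+ n * \int[mu]_x f x.
  move=> fi; have [+ ->] := integral_affine 0 sV0 (measurable_integrand fi) fi.
  rewrite gtr0_norm ?invr_gt0// exprVn mulrA mulfV// mul1r.
  under [X in EFin \o X]eq_fun do rewrite addr0.
  by under [X in _ -> _ /\ _ = X]eq_Rintegral do rewrite addr0.
have [i1 E1] := scal r ri; split=> //; split=> // al.
have [_] := scal _ (integrable_mul_cos_dotmul (s *: al) ri).
under eq_Rintegral do rewrite dotmulZr dotmulZl mulrA mulVf ?mul1r ?gt_eqF//.
by move=> ->; rewrite mulr_ge0// exprn_ge0// ltW.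
Qed.

(** For a polynomial F with nonnegative coefficients, |F|^2 is a sum of cosines with
nonnegative coefficients, whose constant term already accounts for the left-hand
side. On the other hand r only counts on E, and since E and |F|^2 are
symmetric its values may be replaced there by (r x + r (- x)) / 2 <= r 0. *)
Lemma pos_def_trig_le (r : 'rV[R]_n -> R) (E : set 'rV[R]_n)
    (l : seq 'rV[int]_n) (a : 'rV[int]_n -> R) :
  pos_def r -> continuous r ->
  measurable E -> E `<=` T -> (forall x, E x -> E (- x)) ->
  (forall x, ~ E x -> r x <= 0) ->
  uniq l -> (forall nu, 0 <= a nu) ->
  (\int[mu]_x r x) * \sum_(nu <- l) a nu ^+ 2 <=
  r 0 * \int[mu]_(x in E) (tre l a (fun=> 0) x ^+ 2 + tim l a (fun=> 0) x ^+ 2).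
Proof.
move=> pr cr mE ET Esym rE ul a0; have [ri rp] := pr.
set b : 'rV[int]_n -> R := fun=> 0.
pose W x := tre l a b x ^+ 2 + tim l a b x ^+ 2.
have W0 x : 0 <= W x by rewrite addr_ge0// sqr_ge0.
have icos nu : mu.-integrable setT (EFin \o (fun x => r x * cos (phase nu x))).
  by under [X in EFin \o X]eq_fun do rewrite phaseE; exact: integrable_mul_cos_dotmul.
have WE x : r x * W x = \sum_(nu <- l) \sum_(ka <- l)
    (a nu * a ka) * (r x * cos (phase (nu - ka) x)).
  rewrite /W tre2Dtim2 mulr_sumr; apply: eq_bigr => nu _; rewrite mulr_sumr.
  by apply: eq_bigr => ka _; rewrite /b; ring.
have iterm nu ka : mu.-integrable setT (EFin \o (fun x =>
    (a nu * a ka) * (r x * cos (phase (nu - ka) x)))) by exact: integrable_scaler.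
have irW : mu.-integrable setT (EFin \o (fun x => r x * W x)).
  under [X in EFin \o X]eq_fun do rewrite WE.
  by apply: integrable_sumr => // nu; exact: integrable_sumr.
have lower : (\int[mu]_x r x) * \sum_(nu <- l) a nu ^+ 2 <= \int[mu]_x (r x * W x).
  under [leRHS]eq_Rintegral do rewrite WE.
  rewrite Rintegral_sumr//; last by move=> nu; exact: integrable_sumr.
  rewrite mulr_sumr [leLHS]big_seq [leRHS]big_seq; apply: ler_sum => nu nul.
  rewrite Rintegral_sumr// (bigD1_seq nu)//= RintegralZl//.
  under eq_Rintegral do rewrite subrr phase0 cos0 mulr1.
  rewrite mulrC expr2 lerDl; apply: sumr_ge0 => ka _.
  rewrite RintegralZl// mulr_ge0 ?mulr_ge0//.
  by under eq_Rintegral do rewrite phaseE; exact: rp.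
pose G x := \1_E x * W x.
have mW : measurable_fun setT W.
  by apply: measurable_funD; apply: measurable_funX; [exact: measurable_tre|exact: measurable_tim].
have iG : mu.-integrable setT (EFin \o G).
  have := integrable_tre2Dtim2 l a b mE ET; rewrite integrable_mkcond//.
  apply: eq_integrable => // x _; rewrite patchE /G /= indicE.
  by case: ifPn => _; rewrite ?mul1r ?mul0r.
have Geven x : G (- x) = G x.
  rewrite /G /W; congr (_ * (_ + _)).
  - rewrite !indicE (_ : (- x \in E) = (x \in E))//.
    by apply/idP/idP; rewrite !inE => /Esym//; rewrite opprK.
  - by rewrite /tre; congr (_ ^+ 2); apply: eq_bigr => nu _; rewrite phaseNr cosN /b !mul0r.
  - rewrite -[RHS]sqrrN /tim -sumrN; congr (_ ^+ 2); apply: eq_bigr => nu _.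
    by rewrite phaseNr sinN /b !mul0r; ring.
have irG : mu.-integrable setT (EFin \o (fun x => r x * G x)).
  pose C := \sum_(nu <- l) (`|a nu| + `|b nu|).
  apply: (@integrable_mulr_bounded _ _ _ _ _ measurableT _ _ (C ^+ 2 + C ^+ 2)) => //.
    by apply: measurable_funM => //; exact: measurable_indic.
  move=> x _; rewrite /G normrM (ger0_norm (W0 x)) ger0_norm; last by rewrite indicE.
  apply: (@le_trans _ _ (W x)); first by rewrite ler_piMl// indicE lern1; case: (_ \in _).
  by rewrite lerD// -ler_sqrt ?sqr_ge0// !sqrtr_sqr ler_normr ?tre_bound ?tim_bound.
have [iGr EG] := Rintegral_reflect irG.
apply: le_trans lower _.
apply: (@le_trans _ _ (\int[mu]_x (r x * G x))).
  apply: le_Rintegral => // x _; rewrite /G indicE.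
  have [/set_mem Ex|/negP Ex] := boolP (x \in E); first by rewrite mul1r.
  by rewrite mul0r mulr0 mulr_le0_ge0// rE// => /mem_set.
have iG2 : mu.-integrable setT (EFin \o (fun x => 2 * r 0 * G x)) by exact: integrable_scaler.
have : \int[mu]_x (r x * G x) + \int[mu]_x (r (- x) * G (- x)) <=
    \int[mu]_x (2 * r 0 * G x).
  rewrite -RintegralD//; apply: le_Rintegral => //; first exact: integrable_addr.
  move=> x _; rewrite Geven -mulrDl ler_wpM2r//; last exact: pos_def_max.
  by rewrite /G mulr_ge0// indicE.
rewrite EG RintegralZl// [\int[mu]_x G x]Rintegral_indic_mul -/W; lra.
Qed.

End delsarte_inequality.

(** * A binomial kernel *)

Section binomial_kernel.
Variables (R : realType) (n : nat).

Lemma leq_central_bin N k : ('C(2 * N, k) <= 'C(2 * N, N))%N.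
Proof.
have inc j : (j <= N)%N -> ('C(2 * N, N - j) <= 'C(2 * N, N))%N.
  elim: j => [|j ih] jN; first by rewrite subn0.
  apply: leq_trans (ih (ltnW jN)).
  have := mul_bin_left (2 * N) (N - j.+1).
  rewrite -subSn// subSS => E.
  have jN' : (0 < N - j)%N by rewrite subn_gt0.
  rewrite -(leq_pmul2l jN') E leq_mul2r; apply/orP; right.
  by lia.
have [kN|kN] := leqP k N; first by rewrite -(subKn kN) inc// leq_subr.
have [k2|k2] := leqP k (2 * N); last by rewrite bin_small.
rewrite -bin_sub// (_ : 2 * N - k = N - (k - N))%N; last by lia.
by apply: inc; lia.
Qed.

(** The central coefficient is the largest of 2 N + 1 coefficients of sum 4^N. *)
Lemma pow4_le_central_bin N : (4 ^ N <= (2 * N).+1 * 'C(2 * N, N))%N.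
Proof.
rewrite (_ : 4 = 2 ^ 2)%N// -expnM.
have -> : (2 ^ (2 * N) = \sum_(i < (2 * N).+1) 'C(2 * N, i))%N.
  by rewrite -[2%N]/(1 + 1)%N expnDn; apply: eq_bigr => i _; rewrite !exp1n !muln1.
rewrite -[X in (_ <= X * _)%N]card_ord -sum_nat_const.
by apply: leq_sum => i _; exact: leq_central_bin.
Qed.

(** For |m| <= N, the coefficient of cos (pi t)^(2 N) at frequency m, relative to the
one at frequency 0. *)
Definition binw (N : nat) (m : int) : R :=
  'C(2 * N, `|N%:Z + m|)%:R / 'C(2 * N, N)%:R.

Lemma central_bin_gt0 N : 0 < 'C(2 * N, N)%:R :> R.
Proof. by rewrite ltr0n bin_gt0 leq_pmull. Qed.

Lemma binw_ge0 N m : 0 <= binw N m.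
Proof. by rewrite divr_ge0. Qed.

Lemma binw_le1 N m : binw N m <= 1.
Proof. by rewrite ler_pdivrMr ?central_bin_gt0// mul1r ler_nat leq_central_bin. Qed.

(** The ratio of the coefficients at p + 1 and at p is 1 - (2 p + 1) / (N + p + 1). *)
Lemma cvg_binw_nat (p : nat) : (fun N => binw N p%:Z) @ \oo --> (1 : R).
Proof.
elim: p => [|p ih].
  under eq_fun do rewrite /binw addr0 absz_nat divff ?gt_eqF ?central_bin_gt0//.
  exact: cvg_cst.
have h : (fun N => (2 * p).+1%:R * harmonic (N + p)) @ \oo --> (2 * p).+1%:R * (0 : R).
  by apply: cvgM; [exact: cvg_cst|rewrite (cvg_shiftn p (harmonic (R := R))); exact: cvg_harmonic].
have h2 : (fun N => binw N p%:Z * (1 - (2 * p).+1%:R * harmonic (N + p))) @ \oo --> (1 : R).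
  rewrite -[X in _ --> X]mulr1; apply: cvgM => //.
  by rewrite -[X in _ --> X]subr0 -(mulr0 (2 * p).+1%:R); apply: cvgB => //; exact: cvg_cst.
apply: cvg_trans h2; apply: near_eq_cvg; near=> N.
have pN : (p <= N)%N by near: N; exact: nbhs_infty_ge.
rewrite /binw /harmonic -!PoszD !absz_nat addnS.
have /(congr1 (fun k => k%:R : R)) := mul_bin_left (2 * N) (N + p).
rewrite !natrM natrB; last by lia.
have z0 : (N + p).+1%:R != 0 :> R by rewrite pnatr_eq0.
have c0 := central_bin_gt0 N.
move=> E; have -> : 'C(2 * N, (N + p).+1)%:R =
    ((2 * N)%:R - (N + p)%:R) * 'C(2 * N, N + p)%:R / (N + p).+1%:R :> R.
  by apply: (mulfI z0); rewrite E natrM [RHS]mulrC divfK.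
have -> : 1 - (2 * p).+1%:R * (N + p).+1%:R^-1 = ((2 * N)%:R - (N + p)%:R) / (N + p).+1%:R :> R.
  rewrite -[X in X - _](divff z0) -mulrBl; congr (_ / _).
  by rewrite -!natr1 !natrM natrD; ring.
move: ('C(2 * N, N)%:R) c0 => c c0; move: ((N + p).+1%:R : R) z0 => z z0.
by field; rewrite z0 gt_eqF.
Unshelve. all: by end_near. Qed.

Lemma cvg_binw (m : int) : (fun N => binw N m) @ \oo --> (1 : R).
Proof.
case: m => [p|p]; first exact: cvg_binw_nat.
apply: cvg_trans (cvg_binw_nat p.+1); apply: near_eq_cvg; near=> N.
have pN : (p.+1 <= N)%N by near: N; exact: nbhs_infty_ge.
rewrite /binw NegzE subzn// !absz_nat -[in RHS]bin_sub; last by lia.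
by congr ('C(_, _)%:R / _); lia.
Unshelve. all: by end_near. Qed.

(** At the frequencies nu with all |nu_i| <= N, these are the Fourier coefficients of the
kernel K_N, the product over i of cos (pi x_i)^(2 N) normalized to have integral 1
over the torus. *)
Definition kw (N : nat) (nu : 'rV[int]_n) : R := \prod_(i < n) binw N (nu ord0 i).

Lemma kw_ge0 N nu : 0 <= kw N nu.
Proof. by apply: prodr_ge0 => i _; exact: binw_ge0. Qed.

Lemma kw_le1 N nu : kw N nu <= 1.
Proof. by apply: prodr_ile1 => i _; rewrite binw_ge0 binw_le1. Qed.

Lemma cvg_kw nu : (fun N => kw N nu) @ \oo --> (1 : R).
Proof.
have h := @cvg_big R _ *%R 1 xpredT mul_continuous _ \oo (index_enum 'I_n)
  (fun i N => binw N (nu ord0 i)) (fun=> 1 : R) _ (fun i _ => cvg_binw (nu ord0 i)).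
by move: h; rewrite big1_eq; apply.
Qed.

Definition freq N (phi : {ffun 'I_n -> 'I_(2 * N).+1}) : 'rV[int]_n :=
  \row_i ((phi i)%:Z - N%:Z).
Definition freqs N : seq 'rV[int]_n := [seq freq phi | phi : {ffun 'I_n -> 'I_(2 * N).+1}].

Lemma uniq_freqs N : uniq (freqs N).
Proof.
rewrite map_inj_uniq ?enum_uniq// => phi psi /rowP h; apply/ffunP => i.
by have := h i; rewrite !mxE => /addIr[] /val_inj.
Qed.

Lemma mem_freqs nu : exists N0, forall N, (N0 <= N)%N -> nu \in freqs N.
Proof.
exists (\sum_(i < n) `|nu ord0 i|)%N => N hN.
have b i : (`|nu ord0 i| <= N)%N.
  by apply: leq_trans hN; rewrite (bigD1 i)//= leq_addr.
apply/mapP; exists [ffun i => inord `|N%:Z + nu ord0 i|]; first exact: mem_enum.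
apply/rowP => i; have B := b i; rewrite mxE ffunE inordK.
  move: (nu ord0 i) B => m B; lia.
move: (nu ord0 i) B => m B; lia.
Qed.

Lemma cisD (x y : R) : cis (x + y) = cis x * cis y.
Proof.
rewrite /cis cosD sinD; apply/eqP; rewrite eq_complex/=.
by apply/andP; split; apply/eqP; ring.
Qed.

Lemma cis0 : cis 0 = 1 :> R[i].
Proof. by rewrite /cis cos0 sin0. Qed.

Lemma cisMn (x : R) k : cis (x *+ k) = cis x ^+ k.
Proof. by elim: k => [|k ih]; rewrite ?cis0// mulrS cisD ih exprS. Qed.

Lemma cis_sum (I : Type) (s : seq I) (F : I -> R) :
  cis (\sum_(i <- s) F i) = \prod_(i <- s) cis (F i).
Proof. by elim/big_rec2: _ => [|i x y _ <-]; rewrite ?cis0 ?cisD. Qed.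

Lemma normc_cis (x : R) : Normc.normc (cis x) = 1.
Proof. by rewrite /Normc.normc/= cos2Dsin2 sqrtr1. Qed.

Lemma normcX (z : R[i]) k : Normc.normc (z ^+ k) = Normc.normc z ^+ k.
Proof.
elim: k => [|k ih]; first by rewrite !expr0 Normc.normc1.
by rewrite !exprS Normc.normcM ih.
Qed.

Lemma normc_prod (I : Type) (s : seq I) (F : I -> R[i]) :
  Normc.normc (\prod_(i <- s) F i) = \prod_(i <- s) Normc.normc (F i).
Proof. by elim/big_rec2: _ => [|i x y _ <-]; rewrite ?Normc.normc1 ?Normc.normcM. Qed.

(** Up to the central coefficient the sum is cis (- N t) (1 + cis t)^(2 N), and
|1 + cis t|^2 = 2 (1 + cos t). *)
Lemma sum_binw_cis N (t : R) :
  Normc.normc (\sum_(j < (2 * N).+1) (binw N (j%:Z - N%:Z))%:C * cis ((j%:Z - N%:Z)%:~R * t)) =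
  (4 ^ N)%:R / 'C(2 * N, N)%:R * ((1 + cos t) / 2) ^+ N.
Proof.
set C : R := 'C(2 * N, N)%:R; have C0 : 0 < C by exact: central_bin_gt0.
have -> : \sum_(j < (2 * N).+1) (binw N (j%:Z - N%:Z))%:C * cis ((j%:Z - N%:Z)%:~R * t) =
    C^-1%:C * (cis (- (N%:R * t)) * (1 + cis t) ^+ (2 * N)).
  rewrite exprDn !mulr_sumr; apply: eq_bigr => j _.
  have -> : (j%:Z - N%:Z)%:~R * t = - (N%:R * t) + t *+ j.
    by rewrite intrB -!pmulrn -mulr_natr; ring.
  rewrite cisD cisMn expr1n mul1r -mulr_natl /binw addrC subrK absz_nat.
  by rewrite rmorphM/= rmorph_nat; ring.
rewrite !Normc.normcM normc_cis normcX mul1r exprM.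
have -> : Normc.normc (1 + cis t) ^+ 2 = 4 * ((1 + cos t) / 2).
  rewrite /Normc.normc/= sqr_sqrtr ?addr_ge0 ?sqr_ge0// add0r.
  by have := cos2Dsin2 t; rewrite sqrrD => E; rewrite expr1n mul1r -addrA E; lra.
have -> : Normc.normc C^-1%:C = C^-1.
  by rewrite /Normc.normc/= expr0n addr0 sqrtr_sqr ger0_norm// invr_ge0 ltW.
by rewrite exprMn natrX; ring.
Qed.

(** In the product form of K_N, the i-th factor is at most (2 N + 1) q^N and the others
are at most 2 N + 1. *)
Lemma kernel_bound N (z : 'rV[R]_n) (i : 'I_n) (q : R) :
  (1 + cos (2 * pi * z ord0 i)) / 2 <= q ->
  `|\sum_(nu <- freqs N) kw N nu * cos (phase nu z)| <= (2 * N).+1%:R ^+ n * q ^+ N /\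
  `|\sum_(nu <- freqs N) kw N nu * sin (phase nu z)| <= (2 * N).+1%:R ^+ n * q ^+ N.
Proof.
move=> hq; pose S : R[i] := \sum_(nu <- freqs N) (kw N nu)%:C * cis (phase nu z).
have Re_S : complex.Re S = \sum_(nu <- freqs N) kw N nu * cos (phase nu z).
  rewrite /S; elim/big_rec2: _ => [//|nu x [a b] _ /= <-].
  by rewrite mul0r subr0.
have Im_S : complex.Im S = \sum_(nu <- freqs N) kw N nu * sin (phase nu z).
  rewrite /S; elim/big_rec2: _ => [//|nu x [a b] _ /= <-].
  by rewrite mul0r addr0.
suff h : Normc.normc S <= (2 * N).+1%:R ^+ n * q ^+ N.
  have nS : Normc.normc S = Num.sqrt (complex.Re S ^+ 2 + complex.Im S ^+ 2).
    by case: (S).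
  rewrite -Re_S -Im_S; split; apply: le_trans h; rewrite nS -sqrtr_sqr;
    by rewrite ler_wsqrtr// ?lerDl ?lerDr sqr_ge0.
have -> : S = \prod_(k < n) \sum_(j < (2 * N).+1)
    (binw N (j%:Z - N%:Z))%:C * cis ((j%:Z - N%:Z)%:~R * (2 * pi * z ord0 k)).
  rewrite bigA_distr_bigA /S /freqs big_image/=; apply: eq_bigr => phi _.
  rewrite big_split/= -cis_sum; congr (_ * cis _).
    rewrite /kw rmorph_prod/=; apply: eq_bigr => k _; by rewrite mxE.
  rewrite /phase /dotmul mulr_sumr; apply: eq_bigr => k _; rewrite !mxE; ring.
rewrite normc_prod; under eq_bigr do rewrite sum_binw_cis.
rewrite big_split/= prodr_const card_ord.
have c4 : (4 ^ N)%:R / 'C(2 * N, N)%:R <= (2 * N).+1%:R :> R.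
  by rewrite ler_pdivrMr ?central_bin_gt0// -natrM ler_nat pow4_le_central_bin.
have u01 k : 0 <= ((1 + cos (2 * pi * z ord0 k)) / 2) ^+ N <= 1.
  have := cos_le1 (2 * pi * z ord0 k); have := cos_geN1 (2 * pi * z ord0 k).
  by move=> h1 h2; rewrite exprn_ge0 ?exprn_ile1//; lra.
apply: ler_pM => //.
- by apply: prodr_ge0 => k _; case/andP: (u01 k).
- by rewrite lerXn2r ?nnegrE// divr_ge0.
- rewrite (bigD1 i)//=; apply: (@le_trans _ _ (((1 + cos (2 * pi * z ord0 i)) / 2) ^+ N)).
    have p1 : \prod_(k < n | k != i) ((1 + cos (2 * pi * z ord0 k)) / 2) ^+ N <= 1.
      by apply: prodr_ile1 => k _; exact: u01.
    by have /andP[u0 _] := u01 i; rewrite ler_piMr.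
  have := cos_geN1 (2 * pi * z ord0 i) => h1.
  by rewrite lerXn2r ?nnegrE//; lra.
Qed.

(** Bernoulli's inequality gives p < 1 with q <= p^(n+1); then p^N remains once the
other n factors p^N have absorbed (2 N + 1)^n. *)
Lemma cvg_poly_geometric (q : R) : 0 <= q < 1 ->
  (fun N => (2 * N).+1%:R ^+ n * q ^+ N) @ \oo --> (0 : R).
Proof.
move=> /andP[q0 q1].
pose p := 1 - (1 - q) / n.+1%:R.
have n0 : 0 < n.+1%:R :> R by rewrite ltr0n.
have n1 : 1 <= n.+1%:R :> R by rewrite ler1n.
have p1 : p < 1 by rewrite /p ltrBlDr ltrDl divr_gt0// subr_gt0.
have p0 : 0 <= p.
  by rewrite subr_ge0 ler_pdivrMr// mul1r; lra.
have bern k (x : R) : 0 <= 1 + x -> 1 + k%:R * x <= (1 + x) ^+ k.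
  move=> x1; elim: k => [|k ih]; first by rewrite mul0r addr0 expr0.
  rewrite exprS; apply: le_trans (ler_wpM2l x1 ih).
  by rewrite -natr1; have := ler0n R k; nra.
have qp : q <= p ^+ n.+1.
  have E : n.+1%:R * - ((1 - q) / n.+1%:R) = q - 1.
    by move: n.+1%:R n0 => z z0; field; rewrite gt_eqF.
  by have := bern n.+1 _ p0; rewrite E addrC subrK.
have [C hC] : exists C, forall N, (2 * N).+1%:R * p ^+ N <= C.
  have [->|pn0] := eqVneq p 0.
    exists 1 => -[|N]; first by rewrite muln0 expr0 mulr1.
    by rewrite expr0n mulr0.
  have {}p0 : 0 < p by rewrite lt_neqAle eq_sym pn0.
  pose h := p^-1 - 1; have h0 : 0 < h by rewrite subr_gt0 invf_gt1.
  exists (2 / h + 1) => N.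
  have e1 : p ^+ N * (1 + N%:R * h) <= 1.
    have := bern N h; rewrite (_ : 1 + h = p^-1); last by rewrite /h; ring.
    rewrite exprVn => /(_ (ltW _)); rewrite invr_gt0 => /(_ p0) hb.
    by rewrite mulrC -ler_pdivlMr ?exprn_gt0// div1r.
  have pN0 : 0 < p ^+ N by rewrite exprn_gt0.
  have pN1 : p ^+ N <= 1 by rewrite exprn_ile1// ltW.
  rewrite -natr1 natrM mulrDl mul1r lerD//.
  rewrite ler_pdivlMr//; nra.
have lim : (fun N => C ^+ n * p ^+ N) @ \oo --> (0 : R).
  rewrite -(mulr0 (C ^+ n)); apply: cvgM; first exact: cvg_cst.
  by apply: cvg_expr; rewrite ger0_norm.
apply: (squeeze_cvgr _ (cvg_cst (0 : R)) lim).
apply: nearW => N; rewrite mulr_ge0 ?exprn_ge0//=.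
apply: (@le_trans _ _ ((2 * N).+1%:R ^+ n * (p ^+ n.+1) ^+ N)).
  by rewrite ler_wpM2l ?exprn_ge0// lerXn2r ?nnegrE ?exprn_ge0.
rewrite exprS exprMn_comm; last exact: mulrC.
rewrite exprAC mulrCA mulrC -exprMn; apply: ler_wpM2r; first exact: exprn_ge0.
by rewrite lerXn2r ?nnegrE ?mulr_ge0 ?exprn_ge0// (le_trans _ (hC 0%N))// mulr_ge0// exprn_ge0.
Qed.

End binomial_kernel.

(** * Geometry of the body *)

Lemma cos_decr_circle (R : realType) (eta d : R) : 0 <= eta -> eta <= `|d| -> `|d| <= 1 - eta ->
  cos (2 * pi * d) <= cos (2 * pi * eta).
Proof.
move=> e0 d1 d2; have p0 := @pi_gt0 R.
have -> : cos (2 * pi * d) = cos (2 * pi * `|d|).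
  by case: (ger0P d) => // _; rewrite mulrN cosN.
move: (`|d|) d1 d2 (normr_ge0 d) => {}d d1 d2 d0.
have mono c : eta <= c -> c <= 2^-1 -> cos (2 * pi * c) <= cos (2 * pi * eta).
  move=> c1 c2; have c3 : 2 * pi * c <= pi by nra.
  have c4 : 2 * pi * eta <= 2 * pi * c by rewrite ler_wpM2l// mulr_ge0// ltW.
  have c5 : 0 <= 2 * pi * eta by rewrite !mulr_ge0// ltW.
  have [->//|ce] := eqVneq c eta.
  apply/ltW; rewrite ltr_cos ?in_itv/=; last 2 first.
  - by apply/andP; split; lra.
  - by apply/andP; split; lra.
  by rewrite ltr_pM2l ?mulr_gt0// lt_neqAle eq_sym ce.
have [d3|d3] := leP d 2^-1; first exact: mono.
rewrite (_ : 2 * pi * d = - (2 * pi * (1 - d)) + pi *+ 2); last by rewrite mulr2n; ring.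
by rewrite cosD2pi cosN; apply: mono; lra.
Qed.

Section body.
Variables (R : realType) (n : nat) (D : set 'rV[R]_n).
Hypotheses (bD : origin_symmetric_convex_body D) (DT : D `<=` @torus R n).

Lemma body_sym x : D x -> D (- x).
Proof. by case: bD => _ _ _; exact. Qed.

Lemma body_convex (s : R) x y : 0 <= s -> s <= 1 -> D x -> D y ->
  D (s *: x + (1 - s) *: y).
Proof.
move=> s0 s1 Dx Dy; case: bD => _ cD _ _.
have := cD x y (Itv01 s0 s1); rewrite !inE => /(_ Dx Dy).
by rewrite /conv/=; apply.
Qed.

Lemma body_closed : closed D.
Proof. by case: bD => cD _ _ _; apply: compact_closed => //; exact: norm_hausdorff. Qed.

Lemma body_measurable : measurable D.
Proof. by apply: closed_measurable_rV; exact: body_closed. Qed.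

(** Averaging a ball about an interior point p with its mirror image about - p gives
one about 0. *)
Lemma body_cube : exists2 rho, 0 < rho & forall x : 'rV[R]_n, (forall i, `|x ord0 i| < rho) -> D x.
Proof.
case: bD => _ _ [p pD] _; have : nbhs p D by exact: pD.
move=> /nbhs_ballP[rho /= rho0 prho]; exists rho => // x xrho.
have D1 : D (p + x).
  apply: prho; split => // i j; rewrite ord1 -ball_normE/= mxE.
  by rewrite (_ : _ - _ = - x ord0 j) ?normrN//; ring.
have D2 : D (x - p).
  rewrite -[x - p]opprK opprB; apply: body_sym; apply: prho; split => // i j.
  rewrite ord1 -ball_normE/= !mxE.
  by rewrite (_ : _ - _ = x ord0 j)//; ring.
have -> : x = 2^-1 *: (p + x) + (1 - 2^-1) *: (x - p); last first.
  by apply: body_convex => //; lra.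
by apply/rowP => i; rewrite !mxE; field.
Qed.

Lemma body_coord_le x i : D x -> `|x ord0 i| <= 2^-1.
Proof.
move=> /DT /(_ i) /andP[x1 x2]; rewrite ler_norml x1/=; exact: ltW.
Qed.

Lemma scaled_body_sub s x : 0 < s -> s <= 1 -> D (s^-1 *: x) -> D x.
Proof.
move=> s0 s1 Dx; have D0 : D 0.
  have [rho rho0] := body_cube; apply => i; by rewrite mxE normr0.
have := body_convex (ltW s0) s1 Dx D0.
by rewrite scaler0 addr0 scalerA mulfV ?scale1r// gt_eqF.
Qed.

(** On the circle R/Z, a point of the shrunken body s D stays at a definite
distance, in some coordinate, from every point y of the cell outside D: otherwise y
would be a convex combination of points of D, namely s (x / s) + (1 - s) z with z
near 0. The distance is meant modulo 1, and is controlled since s D lies in the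
smaller cell s T. *)
Lemma body_gap s : 0 < s -> s < 1 -> exists2 q : R, 0 <= q < 1 &
  forall x y, D (s^-1 *: x) -> @torus R n y -> ~ D y ->
    exists i, (1 + cos (2 * pi * (x - y) ord0 i)) / 2 <= q.
Proof.
move=> s0 s1; have [rho rho0 cubeD] := body_cube.
pose eta := Num.min ((1 - s) * rho) ((1 - s) / 2).
have eta0 : 0 < eta by rewrite lt_min mulr_gt0 ?subr_gt0//= divr_gt0 ?subr_gt0.
have eta1 : eta <= (1 - s) * rho by rewrite ge_min lexx.
have eta2 : eta <= (1 - s) / 2 by rewrite ge_min lexx orbT.
have p0 := @pi_gt0 R.
exists ((1 + cos (2 * pi * eta)) / 2).
  have : cos (2 * pi * eta) < cos 0.
    rewrite ltr_cos ?in_itv/= ?mulr_gt0//; first by rewrite lexx ltW.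
    by rewrite ltW ?mulr_gt0//=; nra.
  by rewrite cos0 => h; have := cos_geN1 (2 * pi * eta); lra.
move=> x y Dx Ty nDy.
have [i hi] : exists i, eta <= `|(x - y) ord0 i|.
  apply/not_existsP => h; apply: nDy.
  have -> : y = s *: (s^-1 *: x) + (1 - s) *: ((1 - s)^-1 *: (y - x)).
    by rewrite !scalerA !mulfV ?gt_eqF ?subr_gt0// !scale1r addrC subrK.
  apply: body_convex => //; [lra|lra|].
  apply: cubeD => i; rewrite mxE normrM gtr0_norm ?invr_gt0 ?subr_gt0//.
  rewrite ltr_pdivrMl ?subr_gt0//; apply: lt_le_trans eta1.
  by rewrite -opprB mxE normrN ltNge; apply/negP; exact: h.
exists i; rewrite ler_pM2r ?invr_gt0// lerD2l; apply: cos_decr_circle => //.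
  exact: ltW.
have := body_coord_le i Dx; rewrite mxE normrM gtr0_norm ?invr_gt0//.
rewrite ler_pdivrMl// => xs.
have ys : `|y ord0 i| <= 2^-1.
  by have /andP[y1 y2] := Ty i; rewrite ler_norml y1/= ltW.
by rewrite !mxE (le_trans (ler_normB _ _))//; lra.
Qed.

End body.

(** * The bound on Fourier coefficients *)

Section localisation.
Variables (R : realType) (n : nat).
Local Notation mu := (lebesgue_rV R n).
Local Notation T := (@torus R n).

Lemma sum_extend (I : eqType) (s1 s2 : seq I) (F : I -> R) :
  uniq s1 -> uniq s2 -> {subset s1 <= s2} ->
  \sum_(i <- s1) F i = \sum_(i <- s2) (if i \in s1 then F i else 0).
Proof.
move=> u1 u2 s12; rewrite -big_mkcond/= -[RHS]big_filter; apply: perm_big.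
apply: uniq_perm => //; first exact: filter_uniq.
by move=> i; rewrite mem_filter; case: (boolP (i \in s1)) => // /s12 ->.
Qed.

Lemma le_sum_subseq (I : eqType) (s1 s2 : seq I) (F : I -> R) :
  uniq s1 -> uniq s2 -> {subset s1 <= s2} -> (forall i, 0 <= F i) ->
  \sum_(i <- s1) F i <= \sum_(i <- s2) F i.
Proof.
move=> u1 u2 s12 F0; rewrite (sum_extend F u1 u2 s12); apply: ler_sum => i _.
by case: ifP.
Qed.

Lemma Rintegral_splitT (D : set 'rV[R]_n) (f : 'rV[R]_n -> R) :
  measurable D -> D `<=` T -> mu.-integrable T (EFin \o f) ->
  \int[mu]_(x in T) f x = \int[mu]_(x in D) f x + \int[mu]_(x in T `\` D) f x.
Proof.
move=> mD DT fi; have mT := @measurable_torus R n.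
rewrite -[in LHS](setDUK DT) Rintegral_setU//.
- exact: measurableD.
- by rewrite setDUK.
- by apply/disj_set2P; rewrite setDIK.
Qed.

Lemma le_integral_tre2Dtim2 (A : set 'rV[R]_n) l a b :
  measurable A -> A `<=` T -> uniq l ->
  \int[mu]_(x in A) (tre l a b x ^+ 2 + tim l a b x ^+ 2) <=
  \sum_(nu <- l) (a nu ^+ 2 + b nu ^+ 2).
Proof.
move=> mA AT ul; have mT := @measurable_torus R n.
have iT := integrable_tre2Dtim2 l a b mT (fun x h => h).
rewrite -parseval// (Rintegral_splitT mA AT iT) lerDl.
by apply: Rintegral_ge0 => x _; rewrite addr_ge0// sqr_ge0.
Qed.

Lemma le_integral_kernel (A : set 'rV[R]_n) (u v P Q : 'rV[R]_n -> R) (be : R) :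
  measurable A -> mu.-integrable A (EFin \o u) -> mu.-integrable A (EFin \o v) ->
  mu.-integrable A (EFin \o (fun y => u y * P y + v y * Q y)) ->
  (forall y, A y -> `|P y| <= be) -> (forall y, A y -> `|Q y| <= be) ->
  `|\int[mu]_(y in A) (u y * P y + v y * Q y)| <=
  be * \int[mu]_(y in A) (`|u y| + `|v y|).
Proof.
move=> mA iu iv iP hP hQ.
have iuv : mu.-integrable A (EFin \o (fun y => `|u y| + `|v y|)).
  by apply: integrable_addr => //; exact: integrable_norm.
apply: le_trans (le_normr_Rintegral mA iP) _.
rewrite -RintegralZl//; apply: le_Rintegral => //.
- exact: (integrable_norm iP).
- exact: integrable_scaler.
- move=> y Ay; rewrite (le_trans (ler_normD _ _))// !normrM mulrDr lerD//.
    by rewrite mulrC ler_wpM2r// hP.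
  by rewrite mulrC ler_wpM2r// hQ.
Qed.

Variables (D : set 'rV[R]_n) (u v r : 'rV[R]_n -> R).
Hypotheses (bD : origin_symmetric_convex_body D) (DT : D `<=` T).
Hypotheses (pr : pos_def r) (cr : continuous r).
Hypotheses (rD : forall x, ~ D x -> r x <= 0) (r1 : \int[mu]_x r x = 1).
Hypotheses (iu : mu.-integrable T (EFin \o u)) (iv : mu.-integrable T (EFin \o v)).
Hypothesis i2 : mu.-integrable D (EFin \o (fun x => u x ^+ 2 + v x ^+ 2)).
Hypothesis cre_ge0 : forall nu, 0 <= cre T u v nu.
Hypothesis cim0 : forall nu, cim T u v nu = 0.

Let M0 := \int[mu]_(x in D) (u x ^+ 2 + v x ^+ 2).
Let B := T `\` D.
Let L := \int[mu]_(y in B) (`|u y| + `|v y|).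

Let mT : measurable T := @measurable_torus R n.
Let mD : measurable D := body_measurable bD.
Let mB : measurable B := measurableD mT mD.
Let iuB : mu.-integrable B (EFin \o u).
Proof. by apply: integrableS iu => //; exact: subDsetl. Qed.
Let ivB : mu.-integrable B (EFin \o v).
Proof. by apply: integrableS iv => //; exact: subDsetl. Qed.
Let iuD : mu.-integrable D (EFin \o u).
Proof. exact: integrableS iu. Qed.
Let ivD : mu.-integrable D (EFin \o v).
Proof. exact: integrableS iv. Qed.

Let creE nu : cre T u v nu = cre D u v nu + cre B u v nu.
Proof. by apply: Rintegral_splitT => //; exact: integrable_cre. Qed.

Let cimE nu : cim T u v nu = cim D u v nu + cim B u v nu.
Proof. by apply: Rintegral_splitT => //; exact: integrable_cim. Qed.

(** The polynomial is the convolution of 1_B (u + i v) with K_N, and the hypothesis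
bounds K_N (x - y) for y in B. *)
Let tail_le N x be :
  (forall y, B y -> `|\sum_(nu <- freqs n N) kw R N nu * cos (phase nu (x - y))| <= be /\
                    `|\sum_(nu <- freqs n N) kw R N nu * sin (phase nu (x - y))| <= be) ->
  `|tre (freqs n N) (fun nu => kw R N nu * cre B u v nu)
                    (fun nu => kw R N nu * cim B u v nu) x| <= be * L /\
  `|tim (freqs n N) (fun nu => kw R N nu * cre B u v nu)
                    (fun nu => kw R N nu * cim B u v nu) x| <= be * L.
Proof.
move=> h; split.
- pose a nu := kw R N nu * cos (phase nu x); pose b nu := - (kw R N nu * sin (phase nu x)).
  have [ip Ep] := integral_pairing mB iuB ivB (freqs n N) a b.
  rewrite (_ : tre _ _ _ x = \sum_(nu <- freqs n N) (a nu * cre B u v nu + b nu * cim B u v nu)).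
    rewrite -Ep; apply: le_integral_kernel => // y By; have [h1 h2] := h y By.
      apply: le_trans h1; rewrite le_eqVlt; apply/orP; left; apply/eqP; congr `|_|.
      by apply: eq_bigr => nu _; rewrite /a /b phaseBr cosB; ring.
    apply: le_trans h2; rewrite le_eqVlt -normrN; apply/orP; left; apply/eqP; congr `|_|.
    by rewrite /tim -sumrN; apply: eq_bigr => nu _; rewrite /a /b phaseBr sinB; ring.
  by apply: eq_bigr => nu _; rewrite /a /b; ring.
- pose a nu := kw R N nu * sin (phase nu x); pose b nu := kw R N nu * cos (phase nu x).
  have [ip Ep] := integral_pairing mB iuB ivB (freqs n N) a b.
  rewrite (_ : tim _ _ _ x = \sum_(nu <- freqs n N) (a nu * cre B u v nu + b nu * cim B u v nu)).
    rewrite -Ep; apply: le_integral_kernel => // y By; have [h1 h2] := h y By.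
      apply: le_trans h2; rewrite le_eqVlt; apply/orP; left; apply/eqP; congr `|_|.
      by apply: eq_bigr => nu _; rewrite /a /b phaseBr sinB; ring.
    apply: le_trans h1; rewrite le_eqVlt; apply/orP; left; apply/eqP; congr `|_|.
    by apply: eq_bigr => nu _; rewrite /a /b phaseBr cosB; ring.
  by apply: eq_bigr => nu _; rewrite /a /b; ring.
Qed.

Let inner_le N :
  \sum_(nu <- freqs n N) ((kw R N nu * cre D u v nu) ^+ 2 + (kw R N nu * cim D u v nu) ^+ 2)
  <= M0.
Proof.
apply: le_trans (bessel mD iuD ivD DT (uniq_freqs n N) i2).
apply: ler_sum => nu _; have k0 := kw_ge0 R N nu; have k1 := kw_le1 R N nu.
have k2 : kw R N nu ^+ 2 <= 1 by rewrite exprn_ile1.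
by rewrite !exprMn -mulrDr ler_piMl// addr_ge0// sqr_ge0.
Qed.

Let r0_ge0 : 0 <= r 0.
Proof. by apply: pos_def_ge0 => //; exact: cr. Qed.

(** The inequality for polynomials with nonnegative coefficients, applied on s D to
r (. / s) and to the convolution of f with K_N, which is split into the
contributions of D and of its complement B. The first one is bounded in L^2 by
Bessel's inequality, the second one uniformly on s D. *)
Let smoothed_bound N (s q de : R) : 0 < s -> s <= 1 -> 0 < de ->
  (forall x y, D (s^-1 *: x) -> T y -> ~ D y ->
    exists i, (1 + cos (2 * pi * (x - y) ord0 i)) / 2 <= q) ->
  s ^+ n * \sum_(nu <- freqs n N) (kw R N nu * cre T u v nu) ^+ 2 <=
  r 0 * ((1 + de) * M0 +
    (1 + de^-1) * (2 * L ^+ 2) * ((2 * N).+1%:R ^+ n * q ^+ N) ^+ 2).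
Proof.
move=> s0 s1 de0 gap; set l := freqs n N; set be := _ * q ^+ N.
pose E := [set x | D (s^-1 *: x)].
have mE : measurable E.
  rewrite -[E]setTI; have := measurable_affine_rV s^-1 (0 : 'rV[R]_n).
  by under eq_fun do rewrite addr0; move=> h; exact: h.
have ET : E `<=` T by move=> x Ex; apply: DT; exact: (scaled_body_sub bD s0 s1).
have Esym x : E x -> E (- x) by rewrite /E/= scalerN; exact: body_sym.
have [prs rs1] := pos_def_scale s0 pr.
have crs : continuous (fun x : 'rV[R]_n => r (s^-1 *: x)).
  move=> x; apply: (@continuous_comp _ _ _ (fun x : 'rV[R]_n => s^-1 *: x) r x); last exact: cr.
  exact: scaler_continuous.
pose a nu := kw R N nu * cre T u v nu.
have a0 nu : 0 <= a nu by rewrite mulr_ge0// kw_ge0.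
have := pos_def_trig_le prs crs mE ET Esym (fun x h => rD h) (uniq_freqs n N) a0.
rewrite rs1 r1 mulr1 scaler0 => /le_trans; apply; rewrite ler_wpM2l//.
pose F1 (t : seq 'rV[int]_n -> ('rV[int]_n -> R) -> ('rV[int]_n -> R) -> 'rV[R]_n -> R) :=
  t l (fun nu => kw R N nu * cre D u v nu) (fun nu => kw R N nu * cim D u v nu).
pose F2 (t : seq 'rV[int]_n -> ('rV[int]_n -> R) -> ('rV[int]_n -> R) -> 'rV[R]_n -> R) :=
  t l (fun nu => kw R N nu * cre B u v nu) (fun nu => kw R N nu * cim B u v nu).
(* f has real Fourier coefficients, so the imaginary parts of the two contributions
cancel. *)
have c0 nu : cim B u v nu = - cim D u v nu.
  by apply/eqP; rewrite -addr_eq0 addrC -cimE cim0.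
have Ere x : tre l a (fun=> 0) x = F1 (@tre R n) x + F2 (@tre R n) x.
  rewrite /F1 /F2 /tre -big_split/=; apply: eq_bigr => nu _.
  by rewrite /a creE c0; ring.
have Eim x : tim l a (fun=> 0) x = F1 (@tim R n) x + F2 (@tim R n) x.
  rewrite /F1 /F2 /tim -big_split/=; apply: eq_bigr => nu _.
  by rewrite /a creE c0; ring.
have iF1 := integrable_tre2Dtim2 l (fun nu => kw R N nu * cre D u v nu)
  (fun nu => kw R N nu * cim D u v nu) mE ET.
have icst c : mu.-integrable E (EFin \o (fun=> c)).
  by apply: (integrable_torus (C := `|c|)).
apply: (@le_trans _ _ (\int[mu]_(x in E) ((1 + de) * (F1 (@tre R n) x ^+ 2 + F1 (@tim R n) x ^+ 2) +
    (1 + de^-1) * (2 * L ^+ 2) * be ^+ 2))).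
  apply: le_Rintegral => //.
  - exact: integrable_tre2Dtim2.
  - by apply: integrable_addr => //; exact: integrable_scaler.
  move=> x Ex; rewrite Ere Eim.
  have [h1 h2] : `|F2 (@tre R n) x| <= be * L /\ `|F2 (@tim R n) x| <= be * L.
    apply: tail_le => y [Ty nDy].
    by have [i hi] := gap x y Ex Ty nDy; exact: kernel_bound hi.
  have sq (p w : R) : (p + w) ^+ 2 <= (1 + de) * p ^+ 2 + (1 + de^-1) * w ^+ 2.
    have := sqr_ge0 (de * p - w) => h.
    rewrite -subr_ge0 (_ : _ - _ = de^-1 * (de * p - w) ^+ 2); last by field; rewrite gt_eqF.
    by rewrite mulr_ge0// invr_ge0 ltW.
  have b2 (w : R) : `|w| <= be * L -> w ^+ 2 <= L ^+ 2 * be ^+ 2.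
    move=> h; rewrite -exprMn [L * be]mulrC -[w ^+ 2]real_normK ?num_real//.
    by rewrite lerXn2r ?nnegrE// (le_trans _ h).
  have k0 : 0 <= 1 + de^-1 by rewrite addr_ge0// invr_ge0 ltW.
  have := ler_wpM2l k0 (b2 _ h1); have := ler_wpM2l k0 (b2 _ h2).
  have := sq (F1 (@tre R n) x) (F2 (@tre R n) x).
  have := sq (F1 (@tim R n) x) (F2 (@tim R n) x).
  lra.
rewrite RintegralD//; last exact: integrable_scaler.
rewrite RintegralZl// Rintegral_cst//; apply: lerD.
  rewrite ler_wpM2l ?addr_ge0 ?(ltW de0)//.
  apply: le_trans (inner_le N).
  by apply: le_integral_tre2Dtim2 => //; exact: uniq_freqs.
have muE : (mu E <= 1)%E.
  by rewrite -(@vol_torus R n); apply: le_measure; rewrite ?inE.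
have fE : fine (mu E) <= 1.
  by rewrite -lee_fin fineK// ge0_fin_numE// (le_lt_trans muE) ?ltry.
rewrite ler_piMr//; apply: mulr_ge0; last exact: sqr_ge0.
apply: mulr_ge0; first by rewrite addr_ge0// invr_ge0 ltW.
by apply: mulr_ge0 => //; exact: sqr_ge0.
Qed.

(** Let N go to infinity, then s to 1 and de to 0 together. *)
Lemma local_l2_bound (S : seq 'rV[int]_n) : uniq S ->
  \sum_(nu <- S) cre T u v nu ^+ 2 <= r 0 * M0.
Proof.
move=> uS; set X := \sum_(nu <- S) _.
have lim_N (s de : R) : 0 < s -> s < 1 -> 0 < de -> s ^+ n * X <= r 0 * ((1 + de) * M0).
  move=> s0 s1 de0; have [q q01 gap] := body_gap bD DT s0 s1.
  have mem : exists N0, forall N, (N0 <= N)%N -> {subset S <= freqs n N}.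
    elim: (S) => [|nu S' [N0 ih]]; first by exists 0%N.
    have [N1 h1] := mem_freqs nu; exists (maxn N0 N1) => N.
    rewrite geq_max => /andP[N0N N1N] ka; rewrite inE => /predU1P[->|]; last exact: ih.
    exact: h1.
  have [N0 sub] := mem.
  have lhs : (fun N => s ^+ n * \sum_(nu <- S) (kw R N nu * cre T u v nu) ^+ 2) @ \oo -->
      s ^+ n * X.
    apply: cvgM; first exact: cvg_cst.
    apply: (@cvg_big R _ +%R 0) => [|nu _]; first exact: add_continuous.
    rewrite -[cre T u v nu in X in _ --> X]mul1r; rewrite expr2.
    under eq_fun do rewrite expr2.
    by apply: cvgM; apply: cvgM; [exact: cvg_kw|exact: cvg_cst|exact: cvg_kw|exact: cvg_cst].
  have rhs : (fun N => r 0 * ((1 + de) * M0 +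
      (1 + de^-1) * (2 * L ^+ 2) * ((2 * N).+1%:R ^+ n * q ^+ N) ^+ 2)) @ \oo -->
      r 0 * ((1 + de) * M0 + (1 + de^-1) * (2 * L ^+ 2) * (0 * 0)).
    apply: cvgM; first exact: cvg_cst.
    apply: cvgD; first exact: cvg_cst.
    apply: cvgM; first exact: cvg_cst.
    under eq_fun do rewrite expr2.
    by apply: cvgM; exact: cvg_poly_geometric.
  rewrite mulr0 mulr0 addr0 in rhs.
  apply: (ler_cvg_to lhs rhs); near=> N.
  apply: le_trans (smoothed_bound N s0 (ltW s1) de0 gap).
  rewrite ler_wpM2l ?exprn_ge0 ?(ltW s0)//.
  apply: le_sum_subseq => //; first exact: uniq_freqs.
    by apply: sub; near: N; exact: nbhs_infty_ge.
  by move=> nu; exact: sqr_ge0.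
have h1 : (fun k => (1 - harmonic k.+1) ^+ n * X) @ \oo --> (1 - 0) ^+ n * X.
  apply: cvgM; last exact: cvg_cst.
  have h0 : (fun k => 1 - harmonic k.+1) @ \oo --> (1 - 0 : R).
    apply: cvgB; first exact: cvg_cst.
    by rewrite (cvg_shiftS (harmonic (R := R))); exact: cvg_harmonic.
  exact: (cvg_comp _ _ h0 (@exprn_continuous R n (1 - 0))).
have h2 : (fun k => r 0 * ((1 + harmonic k) * M0)) @ \oo --> r 0 * ((1 + 0) * M0).
  apply: cvgM; first exact: cvg_cst.
  apply: cvgM; last exact: cvg_cst.
  by apply: cvgD; [exact: cvg_cst|exact: cvg_harmonic].
have := ler_cvg_to h1 h2; rewrite subr0 expr1n addr0 !mul1r; apply.
apply: nearW => k; apply: lim_N.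
- by rewrite subr_gt0 /harmonic/= invf_lt1 ?ltr1n// ltr0n.
- by rewrite ltrBlDr ltrDl /harmonic/= invr_gt0 ltr0n.
- by rewrite /harmonic/= invr_gt0 ltr0n.
Unshelve. all: by end_near. Qed.

End localisation.

(** * Density of function algebras in weighted L^2 *)

Section bounded_functions.
Context d (X : measurableType d) (R : realType).
Implicit Types (f g p q : X -> R) (P : (X -> R) -> Prop).

Definition bounded_measurable g : Prop :=
  measurable_fun setT g /\ exists C, forall x, `|g x| <= C.

Record function_algebra P : Prop := FunctionAlgebra {
  algebra_bounded : forall p, P p -> bounded_measurable p ;
  algebra1 : P (fun=> 1) ;
  algebraZ : forall c p, P p -> P (fun x => c * p x) ;
  algebraD : forall p q, P p -> P q -> P (fun x => p x + q x) ;
  algebraM : forall p q, P p -> P q -> P (fun x => p x * q x) }.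

Lemma bounded_measurableD f g : bounded_measurable f -> bounded_measurable g ->
  bounded_measurable (fun x => f x + g x).
Proof.
move=> [mf [A fA]] [mg [B gB]]; split; first exact: measurable_funD.
by exists (A + B) => x; rewrite (le_trans (ler_normD _ _))// lerD.
Qed.

Lemma bounded_measurableM f g : bounded_measurable f -> bounded_measurable g ->
  bounded_measurable (fun x => f x * g x).
Proof.
move=> [mf [A fA]] [mg [B gB]]; split; first exact: measurable_funM.
by exists (A * B) => x; rewrite normrM ler_pM.
Qed.

Lemma bounded_measurable_cst c : bounded_measurable (fun=> c).
Proof. by split=> //; exists `|c|. Qed.

Lemma bounded_measurableB f g : bounded_measurable f -> bounded_measurable g ->
  bounded_measurable (fun x => f x - g x).
Proof.
move=> bf bg.
have := bounded_measurableD bf (bounded_measurableM (bounded_measurable_cst (-1)) bg).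
by under eq_fun do rewrite mulN1r.
Qed.

End bounded_functions.

Lemma sum_ltn (N t : nat) : (t <= N)%N -> (\sum_(j < N) (j < t) = t)%N.
Proof.
elim: N t => [|N ih] t; first by rewrite leqn0 => /eqP ->; rewrite big_ord0.
rewrite leq_eqVlt => /predU1P[->|tN].
  by rewrite (eq_bigr (fun=> 1%N)) ?sum1_card ?card_ord// => j _; rewrite ltn_ord.
by rewrite big_ord_recr/= ih// ltnNge -ltnS tN addn0.
Qed.

Section density.
Context d (X : measurableType d) (R : realType) (mu : {measure set X -> \bar R}).
Variables (D : set X) (mD : measurable D) (w : X -> R) (P : (X -> R) -> Prop).
Hypotheses (w0 : forall x, 0 <= w x) (iw : mu.-integrable D (EFin \o w)).
Hypothesis algP : function_algebra P.
Let Pb := algebra_bounded algP.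
Let P1 := algebra1 algP.
Let PZ := algebraZ algP.
Let PD := algebraD algP.
Let PM := algebraM algP.

Lemma integrable_weight g : bounded_measurable g ->
  mu.-integrable D (EFin \o (fun x => w x * g x)).
Proof.
move=> [mg [C gC]]; apply: (integrable_mulr_bounded mD iw (C := C)) => //.
exact: measurable_funTS.
Qed.

Definition dist2 (f g : X -> R) : R := \int[mu]_(x in D) (w x * (f x - g x) ^+ 2).

Lemma integrable_dist2 f g : bounded_measurable f -> bounded_measurable g ->
  mu.-integrable D (EFin \o (fun x => w x * (f x - g x) ^+ 2)).
Proof.
move=> bf bg; apply: (integrable_weight (g := fun x => (f x - g x) ^+ 2)).
have b := bounded_measurableB bf bg.
by under eq_fun do rewrite expr2; exact: bounded_measurableM.
Qed.

Lemma dist2_triangle f g h : bounded_measurable f -> bounded_measurable g ->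
  bounded_measurable h -> dist2 f h <= 2 * dist2 f g + 2 * dist2 g h.
Proof.
move=> bf bg bh; have i1 := integrable_dist2 bf bg; have i2 := integrable_dist2 bg bh.
rewrite -RintegralZl// -RintegralZl// -RintegralD//; [|exact: integrable_scaler..].
apply: le_Rintegral => //; first exact: integrable_dist2.
  by apply: integrable_addr => //; exact: integrable_scaler.
move=> x _; rewrite !mulrA ![2 * w x]mulrC -!mulrA -mulrDr ler_wpM2l//.
have := sqr_ge0 ((f x - g x) - (g x - h x)); nra.
Qed.

(** The closure of P in L^2 (w dmu), among bounded measurable functions. *)
Definition approximable g : Prop :=
  bounded_measurable g /\ forall e, 0 < e -> exists2 p, P p & dist2 g p < e.

Lemma approximable_alg p : P p -> approximable p.
Proof.
move=> Pp; split; first exact: Pb.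
move=> e e0; exists p => //; rewrite /dist2.
under eq_Rintegral do rewrite subrr expr0n mulr0.
by rewrite Rintegral_cst// mul0r.
Qed.

Lemma approximableD f g : approximable f -> approximable g ->
  approximable (fun x => f x + g x).
Proof.
move=> [bf af] [bg ag]; split; first exact: bounded_measurableD.
move=> e e0; have e4 : 0 < e / 4 by lra.
have [p Pp fp] := af _ e4; have [q Pq gq] := ag _ e4.
exists (fun x => p x + q x); first exact: PD.
apply: (@le_lt_trans _ _ (2 * dist2 f p + 2 * dist2 g q)); last by lra.
have i1 := integrable_dist2 bf (Pb Pp); have i2 := integrable_dist2 bg (Pb Pq).
rewrite -RintegralZl// -RintegralZl// -RintegralD//; [|exact: integrable_scaler..].
apply: le_Rintegral => //.
- by apply: integrable_dist2; apply: bounded_measurableD => //; exact: Pb.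
- by apply: integrable_addr => //; exact: integrable_scaler.
move=> x _; rewrite !mulrA ![2 * w x]mulrC -!mulrA -mulrDr ler_wpM2l//.
have := sqr_ge0 ((f x - p x) - (g x - q x)); nra.
Qed.

Lemma approximable_algM p g : P p -> approximable g ->
  approximable (fun x => p x * g x).
Proof.
move=> Pp [bg ag]; have [mp [C pC]] := Pb Pp; split.
  by apply: bounded_measurableM => //; exact: Pb.
move=> e e0; have e1 : 0 < e / (C ^+ 2 + 1).
  by rewrite divr_gt0// ltr_wpDl// sqr_ge0.
have [q Pq gq] := ag _ e1; exists (fun x => p x * q x); first exact: PM.
have i1 := integrable_dist2 bg (Pb Pq).
apply: (@le_lt_trans _ _ ((C ^+ 2 + 1) * dist2 g q)); last first.
  by rewrite mulrC -ltr_pdivlMr// ltr_wpDl// sqr_ge0.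
rewrite -RintegralZl//; apply: le_Rintegral => //.
- by apply: integrable_dist2; apply: bounded_measurableM => //; exact: Pb.
- exact: integrable_scaler.
move=> x _; rewrite -mulrBr exprMn mulrCA.
have w2 : 0 <= w x * (g x - q x) ^+ 2 by apply: mulr_ge0 => //; exact: sqr_ge0.
rewrite ler_wpM2r//.
have : p x ^+ 2 <= C ^+ 2.
  by rewrite -[p x ^+ 2]real_normK ?num_real// lerXn2r ?nnegrE// (le_trans _ (pC x)).
by move=> h; rewrite (le_trans h)// lerDl.
Qed.

Lemma approximable_lim (g_ : nat -> X -> R) g (C : R) :
  (forall j, approximable (g_ j)) -> (forall j x, `|g_ j x| <= C) ->
  (forall x, g_ ^~ x @ \oo --> g x) -> approximable g.
Proof.
move=> ag gC gg.
have gC' x : `|g x| <= C by apply: cvgr_to_le (cvg_norm (gg x)) _; exact: nearW.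
have bg : bounded_measurable g.
  split; last by exists C.
  by apply: (measurable_fun_cvg (h := g_)) => // j; have [[]] := ag j.
split=> // e e0; have e4 : 0 < e / 4 by lra.
have lim : (fun j => dist2 g (g_ j)) @ \oo --> \int[mu]_(x in D) (w x * (g x - g x) ^+ 2).
  apply: (bounded_cvg_integral (C := (C + C) ^+ 2)) => //.
  - move=> j; apply: measurable_funTS; apply: measurable_funX.
    by apply: measurable_funB; [have [] := bg|have [[]] := ag j].
  - move=> j x _; have h : `|g x - g_ j x| <= C + C.
      by rewrite (le_trans (ler_normB _ _))// lerD.
    by rewrite normrX lerXn2r ?nnegrE// (le_trans _ h).
  - move=> x _; rewrite expr2; under eq_fun do rewrite expr2.
    by apply: cvgM; apply: cvgB => //; exact: cvg_cst.
have z0 : \int[mu]_(x in D) (w x * (g x - g x) ^+ 2) = 0.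
  under eq_Rintegral do rewrite subrr expr0n mulr0.
  by rewrite Rintegral_cst// mul0r.
rewrite z0 in lim; move/cvgr_lt : lim => /(_ _ e4)[j0 _ /(_ j0 (leqnn _)) hj].
have [bj /(_ _ e4)[p Pp gp]] := ag j0; exists p => //.
have {}hj : dist2 g (g_ j0) < e / 4 := hj.
by apply: le_lt_trans (dist2_triangle bg bj (Pb Pp)) _; lra.
Qed.

(** Multiplication by a stable function preserves the closure of P. Stability, unlike
membership in the closure, is obviously inherited by products; with bounded limits
this makes the stable sets a sigma-algebra. *)
Definition stable m : Prop :=
  bounded_measurable m /\ forall g, approximable g -> approximable (fun x => m x * g x).

Lemma stable_alg p : P p -> stable p.
Proof. by move=> Pp; split; [exact: Pb|move=> g; exact: approximable_algM]. Qed.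

Lemma stable_cst c : stable (fun=> c).
Proof.
by apply: stable_alg; have := PZ c P1; under eq_fun do rewrite mulr1.
Qed.

Lemma stableD f g : stable f -> stable g -> stable (fun x => f x + g x).
Proof.
move=> [bf sf] [bg sg]; split; first exact: bounded_measurableD.
move=> h ah; have := approximableD (sf h ah) (sg h ah).
by under eq_fun do rewrite -mulrDl.
Qed.

Lemma stableM f g : stable f -> stable g -> stable (fun x => f x * g x).
Proof.
move=> [bf sf] [bg sg]; split; first exact: bounded_measurableM.
by move=> h ah; have := sf _ (sg h ah); under eq_fun do rewrite mulrA.
Qed.

Lemma stable_lim (k_ : nat -> X -> R) k C :
  (forall j, stable (k_ j)) -> (forall j x, `|k_ j x| <= C) ->
  (forall x, k_ ^~ x @ \oo --> k x) -> stable k.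
Proof.
move=> sk kC kk.
have kC' x : `|k x| <= C by apply: cvgr_to_le (cvg_norm (kk x)) _; exact: nearW.
split.
  split; last by exists C.
  by apply: (measurable_fun_cvg (h := k_)) => // j; have [[]] := sk j.
move=> g ag; have [[mg [B gB]] _] := ag.
apply: (approximable_lim (g_ := fun j x => k_ j x * g x) (C := C * B)) => [j|j x|x].
- by have [_] := sk j; apply.
- by rewrite normrM ler_pM.
- by apply: cvgM => //; exact: cvg_cst.
Qed.

Lemma stable_exp k : stable k -> stable (fun x => expR (k x)).
Proof.
move=> sk; have [[_ [C kC]] _] := sk; apply: exp_closed kC sk.
- by move=> c _; exact: stable_cst.
- exact: stableD.
- exact: stableM.
- exact: stable_lim.
Qed.

Definition stable_set (E : set X) : Prop := stable (\1_E : X -> R).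

(** As j goes to infinity, exp (- j exp (- j^2 t)) tends to 1 if t > 0, to 0
otherwise. *)
Lemma stable_pos k : stable k -> stable_set [set x | 0 < k x].
Proof.
move=> sk; pose z j x : R := expR (- (j.+1%:R * expR (- (j.+1%:R ^+ 2 * k x)))).
have ez (y : R) : expR (- y) <= (1 + y)^-1 \/ y <= -1.
  have [y1|y1] := ltP 0 (1 + y); last by right; lra.
  by left; rewrite expRN lef_pV2 ?posrE ?expR_gt0// expR_ge1Dx.
have zj (j : nat) : 0 < j.+1%:R :> R by rewrite ltr0n.
apply: (stable_lim (k_ := z) (C := 1)) => [j|j x|x].
- have cM (c : R) f : stable f -> stable (fun x => - (c * f x)).
    move=> sf; have := stableM (stable_cst (- c)) sf.
    by under eq_fun do rewrite mulNr.
  by apply: stable_exp; apply: (cM); apply: stable_exp; exact: cM.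
- rewrite ger0_norm ?expR_ge0// -expR0 ler_expR oppr_le0 mulr_ge0 ?expR_ge0//.
rewrite indicE; have [kx|kx] := ltP 0 (k x).
  rewrite mem_set//=.
  have h : (fun j => 1 - (k x)^-1 * harmonic j) @ \oo --> (1 - (k x)^-1 * 0 : R).
    apply: cvgB; first exact: cvg_cst.
    by apply: cvgM; [exact: cvg_cst|exact: cvg_harmonic].
  rewrite mulr0 subr0 in h.
  apply: (squeeze_cvgr _ h (cvg_cst (1 : R))); apply: nearW => j /=.
  apply/andP; split; last first.
    by rewrite /z -expR0 ler_expR oppr_le0 mulr_ge0// expR_ge0.
  have := expR_ge1Dx (- (j.+1%:R * expR (- (j.+1%:R ^+ 2 * k x)))).
  apply: le_trans; rewrite lerD2l lerN2 /harmonic/=.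
  have [h1|] := ez (j.+1%:R ^+ 2 * k x); last first.
    have := mulr_gt0 (exprn_gt0 2 (zj j)) kx; lra.
  apply: (@le_trans _ _ (j.+1%:R * (j.+1%:R ^+ 2 * k x)^-1)).
    rewrite ler_wpM2l// (le_trans h1)// lef_pV2 ?posrE.
    - by rewrite lerDr.
    - by rewrite ltr_wpDl// mulr_gt0 ?exprn_gt0.
    - by rewrite mulr_gt0 ?exprn_gt0.
  move: (j.+1%:R) (zj j) => t t0; rewrite le_eqVlt; apply/orP; left; apply/eqP.
  by field; rewrite !gt_eqF.
rewrite memNset/= => [|]; last by apply/negP; rewrite -leNgt.
apply: (squeeze_cvgr _ (cvg_cst (0 : R)) cvg_harmonic); apply: nearW => j /=.
rewrite expR_ge0/= /z.
apply: (@le_trans _ _ (expR (- j.+1%:R))).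
  rewrite ler_expR lerN2 ler_peMr// -expR0 ler_expR oppr_ge0.
  by rewrite mulr_ge0_le0// exprn_ge0.
have [h|] := ez (j.+1%:R); last by have := zj j; lra.
apply: le_trans h _; rewrite /harmonic/= lef_pV2 ?posrE ?addr_gt0//.
by rewrite lerDr.
Qed.

Lemma stable_setC E : stable_set E -> stable_set (~` E).
Proof.
move=> sE; have := stableD (stable_cst 1) (stableM (stable_cst (-1)) sE).
rewrite /stable_set; congr stable; apply/funext => x; rewrite !indicE in_setC.
by case: (_ \in _) => /=; rewrite ?mulr1 ?mulr0 ?subrr ?addr0.
Qed.

Lemma stable_setI A B : stable_set A -> stable_set B -> stable_set (A `&` B).
Proof.
move=> sA sB; have := stableM sA sB; rewrite /stable_set.
by congr stable; apply/funext => x; rewrite !indicE in_setI -natrM mulnb.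
Qed.

Lemma stable_setU A B : stable_set A -> stable_set B -> stable_set (A `|` B).
Proof.
move=> sA sB; rewrite -[A `|` B]setCK setCU; apply: stable_setC.
by apply: stable_setI; exact: stable_setC.
Qed.

Lemma stable_set0 : stable_set set0.
Proof. by rewrite /stable_set indic0; exact: stable_cst. Qed.

Lemma stable_setT : stable_set setT.
Proof. by rewrite -setC0; apply: stable_setC; exact: stable_set0. Qed.

Lemma stable_bigcup (F : (set X)^nat) : (forall j, stable_set (F j)) ->
  stable_set (\bigcup_j F j).
Proof.
move=> sF; apply: (stable_lim (k_ := fun N => \1_(\big[setU/set0]_(j < N) F j)) (C := 1)).
- by move=> N; apply: (big_ind stable_set) => //; [exact: stable_set0|exact: stable_setU].
- by move=> N x; rewrite indicE; case: (_ \in _); rewrite ?normr1 ?normr0.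
move=> x; rewrite [X in _ --> X]indicE.
have [/set_mem [j0 _ Fx]|/negP nF] := boolP (x \in _).
  apply: cvg_near_cst; near=> N; rewrite indicE mem_set//.
  rewrite -bigcup_mkord; exists j0 => //=; near: N; exact: nbhs_infty_gt.
apply: cvg_near_cst; apply: nearW => N; rewrite indicE memNset// => Fx.
apply: nF; rewrite inE; move: Fx; rewrite -bigcup_mkord => -[j _ Fx].
by exists j.
Unshelve. all: by end_near. Qed.

(** Distances are integrals over D, so they do not see the values outside D. *)
Lemma stable_set_eqD A B : measurable B -> A `&` D = B `&` D ->
  stable_set A -> stable_set B.
Proof.
move=> mB AB [bA sA].
have bB : bounded_measurable (\1_B : X -> R).
  split; first exact: measurable_indic.
  by exists 1 => x; rewrite indicE; case: (_ \in _); rewrite ?normr1 ?normr0.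
split=> // g ag; have [[bAg aAg] [bg _]] := (sA g ag, ag).
split; first exact: bounded_measurableM.
move=> e /aAg[p Pp h]; exists p => //; apply: le_lt_trans h.
rewrite le_eqVlt; apply/orP; left; apply/eqP; apply: eq_Rintegral => x /set_mem Dx.
suff -> : \1_B x = \1_A x :> R by [].
rewrite !indicE; congr (nat_of_bool _)%:R; apply/idP/idP; rewrite !inE => h.
  by have : (B `&` D) x by []; rewrite -AB => -[].
by have : (A `&` D) x by []; rewrite AB => -[].
Qed.

Hypothesis sets_stable : forall E, measurable E -> stable_set E.

(** A bounded measurable function with values in [0, K[ is within 1 / N of the
function floor (N g) / N, a finite sum of indicators. *)
Lemma approximable_bounded g : bounded_measurable g -> approximable g.
Proof.
have nneg h : bounded_measurable h -> (forall x, 0 <= h x) -> stable h.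
  move=> [mh [C hC]] h0; pose K := Num.bound C.
  have hK x : h x < K%:R.
    rewrite (le_lt_trans (ler_norm _))// (le_lt_trans (hC x))//.
    by rewrite /K archi_boundP// (le_trans _ (hC x)).
  pose E N j := [set x | j.+1%:R <= N.+1%:R * h x].
  pose hN N x : R := N.+1%:R^-1 * \sum_(j < K * N.+1) \1_(E N j) x.
  have hNE N x : hN N x = N.+1%:R^-1 * (Num.truncn (N.+1%:R * h x))%:R.
    rewrite /hN; congr (_ * _).
    have Nh0 : 0 <= N.+1%:R * h x by rewrite mulr_ge0.
    have tK : (Num.truncn (N.+1%:R * h x) <= K * N.+1)%N.
      rewrite -(ler_nat R); apply: (@le_trans _ _ (N.+1%:R * h x)); first by rewrite truncn_le.
      by rewrite natrM mulrC ler_wpM2r// ltW.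
    rewrite -[in RHS](sum_ltn tK) natr_sum; apply: eq_bigr => j _.
    rewrite indicE; congr (nat_of_bool _)%:R.
    by apply/idP/idP; rewrite inE /E/= truncn_gt_nat.
  have hNle N x : hN N x <= h x.
    by rewrite hNE ler_pdivrMl ?ltr0n// truncn_le mulr_ge0.
  have hNge N x : h x - harmonic N <= hN N x.
    rewrite hNE lerBlDr /harmonic/= -[X in _ + X]mulr1 -mulrDr ler_pdivlMl ?ltr0n//.
    by rewrite natr1 ltW// truncnS_gt.
  apply: (stable_lim (k_ := hN) (C := C)) => [N|N x|x].
  - apply: stableM; first exact: stable_cst.
    elim: (K * N.+1)%N => [|k ih].
      by under eq_fun do rewrite big_ord0; exact: stable_cst.
    under eq_fun do rewrite big_ord_recr/=.
    apply: stableD => //; apply: sets_stable; rewrite /E -[X in measurable X]setTI.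
    have : measurable_fun setT (fun x => N.+1%:R * h x) by exact: measurable_funM.
    move=> /(_ measurableT `[k.+1%:R, +oo[%classic (measurable_itv _)).
    by congr measurable; apply/seteqP; split=> x /=; rewrite in_itv/= andbT.
  - rewrite ger0_norm; first by rewrite (le_trans (hNle N x))// (le_trans (ler_norm _)).
    by rewrite hNE mulr_ge0// invr_ge0.
  - have lim : (fun N => h x - harmonic N) @ \oo --> (h x - 0).
      by apply: cvgB; [exact: cvg_cst|exact: cvg_harmonic].
    rewrite subr0 in lim.
    apply: (squeeze_cvgr _ lim (cvg_cst (h x))); apply: nearW => N /=.
    by rewrite hNge hNle.
move=> bg; have [mg [C gC]] := bg.
have s1 : stable (fun x => g x + C).
  apply: nneg; first by apply: bounded_measurableD => //; exact: bounded_measurable_cst.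
  by move=> x; have := gC x; rewrite ler_norml => /andP[]; lra.
have [_ s2] := stableD s1 (stable_cst (- C)).
have := s2 _ (approximable_alg P1).
by under eq_fun do rewrite mulr1 addrK.
Qed.

End density.

(** * Density of trigonometric polynomials *)

Section trig_polys.
Variables (R : realType) (n : nat).
Local Notation mu := (lebesgue_rV R n).
Local Notation T := (@torus R n).
Implicit Types (p q : 'rV[R]_n -> R) (nu : 'rV[int]_n).

Inductive trig_poly : ('rV[R]_n -> R) -> Prop :=
| trig_cos nu : trig_poly (fun x => cos (phase nu x))
| trig_sin nu : trig_poly (fun x => sin (phase nu x))
| trigD p q : trig_poly p -> trig_poly q -> trig_poly (fun x => p x + q x)
| trigZ c p : trig_poly p -> trig_poly (fun x => c * p x).

Lemma trig_cst (c : R) : trig_poly (fun=> c).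
Proof.
have := trigZ c (trig_cos 0).
by under eq_fun do rewrite phase0 cos0 mulr1.
Qed.

Lemma trigM_char p nu : trig_poly p ->
  trig_poly (fun x => p x * cos (phase nu x)) /\
  trig_poly (fun x => p x * sin (phase nu x)).
Proof.
elim=> {p} [ka|ka|p q _ [pc ps] _ [qc qs]|c p _ [pc ps]].
- split.
    have := trigZ 2^-1 (trigD (trig_cos (ka + nu)) (trig_cos (ka - nu))).
    by congr trig_poly; apply/funext => x; rewrite !phaseD !phaseN !cosD cosN sinN; field.
  have := trigZ 2^-1 (trigD (trig_sin (ka + nu)) (trigZ (-1) (trig_sin (ka - nu)))).
  by congr trig_poly; apply/funext => x; rewrite !phaseD !phaseN !sinD cosN sinN; field.
- split.
    have := trigZ 2^-1 (trigD (trig_sin (ka + nu)) (trig_sin (ka - nu))).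
    by congr trig_poly; apply/funext => x; rewrite !phaseD !phaseN !sinD cosN sinN; field.
  have := trigZ 2^-1 (trigD (trig_cos (ka - nu)) (trigZ (-1) (trig_cos (ka + nu)))).
  by congr trig_poly; apply/funext => x; rewrite !phaseD !phaseN !cosD cosN sinN; field.
- split; [have := trigD pc qc|have := trigD ps qs];
    by under eq_fun do rewrite -mulrDl.
- split; [have := trigZ c pc|have := trigZ c ps];
    by under eq_fun do rewrite mulrA.
Qed.

Lemma trigM p q : trig_poly p -> trig_poly q -> trig_poly (fun x => p x * q x).
Proof.
move=> tp; elim=> {q} [nu|nu|q1 q2 _ h1 _ h2|c q _ h].
- exact: (trigM_char nu tp).1.
- exact: (trigM_char nu tp).2.
- by have := trigD h1 h2; under eq_fun do rewrite -mulrDr.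
- by have := trigZ c h; under eq_fun do rewrite mulrCA.
Qed.

Lemma trig_bounded p : trig_poly p -> bounded_measurable p.
Proof.
elim=> {p} [nu|nu|p q _ bp _ bq|c p _ bp].
- by split; [exact: measurable_cos_phase|exists 1 => x; exact: cos_max].
- by split; [exact: measurable_sin_phase|exists 1 => x; exact: sin_max].
- exact: bounded_measurableD.
- by apply: (bounded_measurableM (f := fun=> c)) => //; exact: bounded_measurable_cst.
Qed.

Lemma trig_algebra : function_algebra trig_poly.
Proof.
split; [exact: trig_bounded|exact: trig_cst|exact: trigZ|exact: trigD|exact: trigM].
Qed.

(** The frequencies of the complex polynomial p + i q must be distinct, as Parseval's
identity requires. *)
Definition trig_pair p q : Prop := exists l a b,
  [/\ uniq l, p = tre l a b & q = tim l a b].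

Lemma trig_pairD p1 q1 p2 q2 : trig_pair p1 q1 -> trig_pair p2 q2 ->
  trig_pair (fun x => p1 x + p2 x) (fun x => q1 x + q2 x).
Proof.
move=> [l1 [a1 [b1 [u1 -> ->]]]] [l2 [a2 [b2 [u2 -> ->]]]].
pose e (l : seq 'rV[int]_n) (a : 'rV[int]_n -> R) nu := if nu \in l then a nu else 0.
exists (undup (l1 ++ l2)), (fun nu => e l1 a1 nu + e l2 a2 nu),
  (fun nu => e l1 b1 nu + e l2 b2 nu).
have uL := undup_uniq (l1 ++ l2).
have s1 : {subset l1 <= undup (l1 ++ l2)}.
  by move=> x; rewrite mem_undup mem_cat => ->.
have s2 : {subset l2 <= undup (l1 ++ l2)}.
  by move=> x; rewrite mem_undup mem_cat => ->; rewrite orbT.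
split=> //; apply/funext => x.
- rewrite /tre (sum_extend _ u1 uL s1) (sum_extend _ u2 uL s2) -big_split/=.
  apply: eq_bigr => nu _; rewrite /e.
  by case: (nu \in l1); case: (nu \in l2); ring.
- rewrite /tim (sum_extend _ u1 uL s1) (sum_extend _ u2 uL s2) -big_split/=.
  apply: eq_bigr => nu _; rewrite /e.
  by case: (nu \in l1); case: (nu \in l2); ring.
Qed.

Lemma trig_pairZ c p q : trig_pair p q ->
  trig_pair (fun x => c * p x) (fun x => c * q x).
Proof.
move=> [l [a [b [ul -> ->]]]]; exists l, (fun nu => c * a nu), (fun nu => c * b nu).
split=> //; apply/funext => x; rewrite /tre /tim mulr_sumr; apply: eq_bigr => nu _; ring.
Qed.

(** Multiplication by i. *)
Lemma trig_pairi p q : trig_pair p q -> trig_pair (fun x => - q x) p.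
Proof.
move=> [l [a [b [ul -> ->]]]]; exists l, (fun nu => - b nu), a.
split=> //; apply/funext => x; rewrite /tre /tim -?sumrN; apply: eq_bigr => nu _; ring.
Qed.

Lemma trig_pair_char nu : trig_pair (fun x => cos (phase nu x)) (fun x => sin (phase nu x)).
Proof.
exists [:: nu], (fun=> 1), (fun=> 0).
by split=> //; apply/funext => x; rewrite /tre /tim big_seq1; ring.
Qed.

Lemma trig_pair_real p : trig_poly p -> trig_pair p (fun=> 0).
Proof.
elim=> {p} [nu|nu|p q _ hp _ hq|c p _ hp].
- have := trig_pairZ 2^-1 (trig_pairD (trig_pair_char nu) (trig_pair_char (- nu))).
  by congr trig_pair; apply/funext => x; rewrite phaseN ?cosN ?sinN; field.
- have := trig_pairZ (- 2^-1) (trig_pairi (trig_pairD (trig_pair_char nu)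
    (trig_pairZ (-1) (trig_pair_char (- nu))))).
  by congr trig_pair; apply/funext => x; rewrite phaseN ?cosN ?sinN; field.
- by have := trig_pairD hp hq; congr trig_pair; apply/funext => x; rewrite addr0.
- by have := trig_pairZ c hp; congr trig_pair; apply/funext => x; rewrite mulr0.
Qed.

Lemma trig_pair_poly p q : trig_poly p -> trig_poly q -> trig_pair p q.
Proof.
move=> /trig_pair_real hp /trig_pair_real hq.
have hq' : trig_pair (fun=> 0) q.
  have := trig_pairi hq; congr trig_pair; apply/funext => x; exact: oppr0.
have := trig_pairD hp hq'.
by congr trig_pair; apply/funext => x; rewrite ?addr0 ?add0r.
Qed.

End trig_polys.

Section torus_density.
Variables (R : realType) (n : nat).
Local Notation mu := (lebesgue_rV R n).
Local Notation T := (@torus R n).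

Lemma sin2pi_gt0 (y : R) : -1 < y < 1 ->
  (0 < sin (2 * pi * y)) = (0 < y < 2^-1) || (y < - 2^-1).
Proof.
move=> /andP[y1 y2]; have p0 := @pi_gt0 R.
have pos z : 0 < z -> z < 2^-1 -> 0 < sin (2 * pi * z :> R).
  move=> z0 z1; apply: sin_gt0_pi; rewrite !mulr_gt0//=.
  by rewrite mulrAC gtr_pMl//; lra.
have nneg z : 0 <= z -> z <= 2^-1 -> 0 <= sin (2 * pi * z :> R).
  move=> z0 z1; apply: sin_ge0_pi; rewrite !mulr_ge0 ?(ltW p0)//=.
  by rewrite mulrAC ger_pMl//; lra.
have [ym|ym] := ltP y (- 2^-1).
  rewrite orbT (_ : 2 * pi * y = 2 * pi * (y + 1) - pi *+ 2); last by rewrite mulr2n; ring.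
  rewrite -[sin _]sinD2pi subrK; apply: pos; lra.
rewrite orbF; have [y0|y0] := ltP 0 y; last first.
  apply/negbTE; rewrite -leNgt -[y]opprK mulrN sinN oppr_le0; apply: nneg; lra.
have [yh|yh] /= := ltP y 2^-1; first exact: pos.
apply/negbTE; rewrite -leNgt (_ : 2 * pi * y = - (2 * pi * (1 - y)) + pi *+ 2).
  by rewrite sinD2pi sinN oppr_le0; apply: nneg; lra.
by rewrite mulr2n; ring.
Qed.

Variables (w : 'rV[R]_n -> R).
Hypotheses (w0 : forall x, 0 <= w x) (iw : mu.-integrable T (EFin \o w)).

Let mT := @measurable_torus R n.
Let P := @trig_poly R n.
Let st := stable_set mu T w P.

Let algP := trig_algebra R n.

Let half (i : 'I_n) (c : R) : set 'rV[R]_n := [set x | 0 < sin (2 * pi * (x ord0 i - c))].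

Let st_half i c : st (half i c).
Proof.
apply: (stable_pos mT w0 iw algP).
apply: (stable_alg mT w0 iw algP).
pose nu : 'rV[int]_n := delta_mx ord0 i.
have := trigD (trigZ (cos (2 * pi * c)) (trig_sin R nu))
  (trigZ (- sin (2 * pi * c)) (trig_cos R nu)).
congr trig_poly; apply/funext => x.
rewrite mulrBr sinB (_ : phase nu x = 2 * pi * x ord0 i); first by ring.
rewrite /phase /dotmul (bigD1 i)//= !mxE !eqxx mul1r big1 ?addr0// => j ji.
by rewrite !mxE (negbTE ji) andbF mul0r.
Qed.

Let halfP i c x : T x -> - 2^-1 <= c -> c < 2^-1 ->
  half i c x <-> c < x ord0 i /\ x ord0 i < c + 2^-1 \/ x ord0 i < c - 2^-1.
Proof.
move=> Tx c1 c2; have /andP[x1 x2] := Tx i; rewrite /half/= sin2pi_gt0; last first.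
  by apply/andP; split; lra.
split=> [/orP[/andP[h1 h2]|h]|[[h1 h2]|h]].
- by left; split; lra.
- by right; lra.
- by apply/orP; left; apply/andP; split; lra.
- by apply/orP; right; lra.
Qed.

Let ray (i : 'I_n) (a : R) : set 'rV[R]_n := [set x | a < x ord0 i].

Let measurable_ray i a : measurable (ray i a).
Proof.
rewrite -[ray i a]setTI.
have := @measurable_coord R n i measurableT `]a, +oo[%classic (measurable_itv _).
by congr measurable; apply/seteqP; split=> x /=; rewrite in_itv/= andbT.
Qed.

(** On the circle [-1/2, 1/2[, an interval ]a, 1/2[ is an intersection of two
open half circles if a >= 0, and a union of three of them if a < 0. *)
Let st_ray i a : st (ray i a).
Proof.
have stU := stable_setU mT w0 iw algP.
have stT := stable_setT mT w0 iw algP.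
have stE A : st A -> A `&` T = ray i a `&` T -> st (ray i a).
  move=> sA AE; exact: stable_set_eqD (measurable_ray i a) AE sA.
have st0 := stable_set0 mT w0 iw algP.
have [a1|a1] := leP 2^-1 a.
  apply: (stE set0) => //; rewrite set0I; apply/esym/seteqP; split=> // x [/= ax Tx].
  by have /andP[_] := Tx i; rewrite ltNge (le_trans a1)// ltW.
have [a2|a2] := ltP a (- 2^-1).
  apply: (stE setT) => //; rewrite setTI; apply/esym/seteqP; split=> [x []//|x Tx].
  by split=> //=; have /andP[h _] := Tx i; exact: lt_le_trans h.
have [a0|a0] := leP 0 a.
  apply: (stE (half i 0 `&` half i a)); first by apply: stable_setI; exact: st_half.
  apply/seteqP; split=> x [h Tx]; split=> //; have /andP[x1 x2] := Tx i.
    case: h => /(halfP _ Tx); rewrite /ray/= => h0 /(halfP _ Tx) h1.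
    by case: h0; [lra|lra| |]; case: h1; lra.
  by split; apply/(halfP _ Tx); (try lra); left; rewrite /ray/= in h; lra.
apply: (stE (half i a `|` half i (a / 2) `|` half i 0)).
  by apply: (stU); [apply: (stU); exact: st_half|exact: st_half].
apply/seteqP; split=> x [h Tx]; split=> //; have /andP[x1 x2] := Tx i.
  by rewrite /ray/=; case: h => [[]|] /(halfP _ Tx) h; case: h; lra.
rewrite /ray/= in h; have [x3|x3] := ltP (x ord0 i) (a + 2^-1).
  by left; left; apply/(halfP _ Tx); (try lra); left; lra.
have [x4|x4] := ltP (x ord0 i) (a / 2 + 2^-1).
  by left; right; apply/(halfP _ Tx); (try lra); left; lra.
by right; apply/(halfP _ Tx); (try lra); left; lra.
Qed.

Let st_measurable E : measurable E -> st E.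
Proof.
move=> mE; have stC := stable_setC mT w0 iw algP.
have stU := stable_bigcup mT w0 iw algP.
have st0 := stable_set0 mT w0 iw algP.
move: E mE; apply: smallest_sub.
  split=> //; first by move=> A sA; rewrite setTD; exact: stC.
rewrite -bigcup_seq/=; apply: bigcup_sub => i _ _ [Y mY <-]; rewrite setTI.
pose G := [set Y : set (measurableTypeR R) | st ((@rV_coord R n i) @^-1` Y)].
have sG : sigma_algebra setT G.
  split; rewrite /G/=.
  - by rewrite preimage_set0.
  - by move=> A sA; rewrite setTD preimage_setC; exact: stC.
  - by move=> F sF; rewrite preimage_bigcup; exact: stU.
move: mY; rewrite RGenOInfty.measurableE.
apply: (smallest_sub sG) => _ [a ->]; rewrite /G/=.
rewrite (_ : _ @^-1` _ = ray i a); first exact: st_ray.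
by apply/seteqP; split=> x /=; rewrite in_itv/= andbT.
Qed.

(** Rays in each coordinate are stable and generate the Borel sets, so all Borel sets
are stable. *)
Lemma trig_dense g : bounded_measurable g ->
  forall e, 0 < e -> exists2 p, trig_poly p &
    \int[mu]_(x in T) (w x * (g x - p x) ^+ 2) < e.
Proof.
move=> bg; have [] := approximable_bounded mT w0 iw algP st_measurable bg.
by [].
Qed.

End torus_density.

(** * Square mass from Fourier coefficients *)

Section uniqueness.
Variables (R : realType) (n : nat).
Local Notation mu := (lebesgue_rV R n).
Local Notation T := (@torus R n).
Variables (u v : 'rV[R]_n -> R) (M : R).
Hypotheses (iu : mu.-integrable T (EFin \o u)) (iv : mu.-integrable T (EFin \o v)).
Hypothesis coefs : forall S, uniq S ->
  \sum_(nu <- S) (cre T u v nu ^+ 2 + cim T u v nu ^+ 2) <= M.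

Let mT := @measurable_torus R n.

Let ibm p : bounded_measurable p -> mu.-integrable T (EFin \o p).
Proof.
move=> [mp [C pC]]; apply: (integrable_torus (C := C)) => //.
exact: measurable_funTS.
Qed.

Let imul (f p : 'rV[R]_n -> R) : mu.-integrable T (EFin \o f) -> bounded_measurable p ->
  mu.-integrable T (EFin \o (fun x => f x * p x)).
Proof.
move=> fi [mp [C pC]]; apply: (integrable_mulr_bounded mT fi (C := C)) => //.
exact: measurable_funTS.
Qed.

(** Coefficientwise, 2 Re (c conj d) <= |c|^2 + |d|^2. *)
Let pairing_le p q : trig_poly p -> trig_poly q ->
  2 * \int[mu]_(x in T) (u x * p x + v x * q x) <=
  M + \int[mu]_(x in T) (p x ^+ 2 + q x ^+ 2).
Proof.
move=> tp tq; have [l [a [b [ul -> ->]]]] := trig_pair_poly tp tq.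
have [_ ->] := integral_pairing mT iu iv l a b.
rewrite parseval//; apply: (@le_trans _ _ (\sum_(nu <- l)
  (cre T u v nu ^+ 2 + cim T u v nu ^+ 2) + \sum_(nu <- l) (a nu ^+ 2 + b nu ^+ 2))); last first.
  by rewrite lerD2r coefs.
rewrite -big_split/= mulr_sumr; apply: ler_sum => nu _.
have := sqr_ge0 (a nu - cre T u v nu); have := sqr_ge0 (b nu - cim T u v nu); nra.
Qed.

(** With this weight, closeness in L^2 (w dx) controls both the integral against u or
v and the L^2 norm on the torus. *)
Let w x := 1 + `|u x| + `|v x|.
Let w0 x : 0 <= w x. Proof. by rewrite /w !addr_ge0. Qed.
Let iw : mu.-integrable T (EFin \o w).
Proof.
apply: integrable_addr => //; last exact: integrable_norm.
apply: integrable_addr => //; last exact: integrable_norm.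
by apply: ibm; exact: bounded_measurable_cst.
Qed.
Let W := \int[mu]_(x in T) w x.

Let bmX (f : 'rV[R]_n -> R) : bounded_measurable f -> bounded_measurable (fun x => f x ^+ 2).
Proof. by move=> bf; under eq_fun do rewrite expr2; exact: bounded_measurableM. Qed.

Let approx_pair f g t : mu.-integrable T (EFin \o f) -> (forall x, `|f x| <= w x) ->
  bounded_measurable g -> 0 < t -> t <= 1 -> exists2 p, trig_poly p &
  \int[mu]_(x in T) (f x * g x) <= \int[mu]_(x in T) (f x * p x) + t * (W + 1) /\
  \int[mu]_(x in T) (p x ^+ 2) <= (1 + t) * \int[mu]_(x in T) (g x ^+ 2) + 2 * t.
Proof.
move=> fi fw bg t0 t1; have t2 : 0 < t ^+ 2 by rewrite exprn_gt0.
have [p tp hp] := trig_dense w0 iw bg t2; have bp := trig_bounded tp.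
have id2 : mu.-integrable T (EFin \o (fun x => w x * (g x - p x) ^+ 2)).
  by apply: imul => //; apply: bmX; exact: bounded_measurableB.
exists p => //; split.
  have ifg := imul fi bg; have ifp := imul fi bp.
  rewrite -lerBlDl -RintegralB//.
  apply: (@le_trans _ _ (\int[mu]_(x in T) (t * w x + t^-1 * (w x * (g x - p x) ^+ 2)))).
    apply: le_Rintegral => //; first exact: integrable_subr.
      by apply: integrable_addr => //; exact: integrable_scaler.
    move=> x _; rewrite -mulrBr; set dd := g x - p x.
    apply: le_trans (ler_norm _) _; rewrite normrM.
    apply: (@le_trans _ _ (w x * `|dd|)); first by rewrite ler_wpM2r.
    rewrite [t^-1 * _]mulrCA [t * _]mulrC -mulrDr ler_wpM2l//.
    have tt : t * t^-1 = 1 by rewrite mulfV// gt_eqF.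
    have ti : 0 < t^-1 by rewrite invr_gt0.
    have := sqr_ge0 (t - `|dd|); rewrite -[dd ^+ 2]real_normK ?num_real// => h.
    have := mulr_ge0 (ltW ti) h.
    rewrite (_ : t^-1 * _ =
      t * t^-1 * t - 2 * (t * t^-1) * `|dd| + t^-1 * `|dd| ^+ 2); last by ring.
    by rewrite tt; have := normr_ge0 dd; lra.
  rewrite RintegralD//; [|exact: integrable_scaler..].
  rewrite !RintegralZl// -/W mulrDr mulr1 lerD2l.
  by rewrite ler_pdivrMl// -expr2 ltW.
have ip2 := ibm (bmX bp); have ig2 := ibm (bmX bg).
apply: (@le_trans _ _ (\int[mu]_(x in T) ((1 + t) * g x ^+ 2 +
    (1 + t^-1) * (w x * (g x - p x) ^+ 2)))).
  apply: le_Rintegral => //.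
    by apply: integrable_addr => //; exact: integrable_scaler.
  move=> x _; have h := sqr_ge0 (t * g x + (g x - p x)).
  have ti : 0 < t^-1 by rewrite invr_gt0.
  have w1 : 1 <= w x by rewrite /w -addrA lerDl addr_ge0.
  apply: (@le_trans _ _ ((1 + t) * g x ^+ 2 + (1 + t^-1) * (g x - p x) ^+ 2)).
    rewrite -subr_ge0 (_ : _ - _ = t^-1 * (t * g x + (g x - p x)) ^+ 2).
      by rewrite mulr_ge0// ltW.
    by field; rewrite gt_eqF.
  rewrite lerD2l ler_wpM2l ?addr_ge0 ?(ltW ti)//.
  by rewrite ler_peMl// sqr_ge0.
rewrite RintegralD//; [|exact: integrable_scaler..].
rewrite !RintegralZl// lerD2l.
have ti : 0 < t^-1 by rewrite invr_gt0.
have k0 : 0 <= 1 + t^-1 by rewrite addr_ge0 ?(ltW ti).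
apply: le_trans (ler_wpM2l k0 (ltW hp)) _.
rewrite mulrDl mul1r (_ : t^-1 * t ^+ 2 = t); last by field; rewrite gt_eqF.
nra.
Qed.

Let U := u \_ T.
Let V := v \_ T.
Let mU : measurable_fun setT U.
Proof. by apply/(measurable_restrictT _ mT); exact: measurable_integrand iu. Qed.
Let mV : measurable_fun setT V.
Proof. by apply/(measurable_restrictT _ mT); exact: measurable_integrand iv. Qed.

Let A (K : nat) : set 'rV[R]_n := T `&` [set x | `|U x| <= K%:R] `&` [set x | `|V x| <= K%:R].

Let mA K : measurable (A K).
Proof.
have m (f : 'rV[R]_n -> R) : measurable_fun setT f -> measurable [set x | `|f x| <= K%:R].
  move=> mf; have mnf : measurable_fun setT (fun x => `|f x|) by exact: measurableT_comp.
  rewrite -[X in measurable X]setTI.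
  have := mnf measurableT `]-oo, K%:R]%classic (measurable_itv _).
  by congr measurable; apply/seteqP; split=> x /=; rewrite in_itv.
by apply: measurableI; [apply: measurableI => //; exact: m|exact: m].
Qed.

Let trunc_bounded K (f : 'rV[R]_n -> R) :
  measurable_fun setT f -> (forall x, A K x -> `|f x| <= K%:R) ->
  bounded_measurable (fun x => \1_(A K) x * f x).
Proof.
move=> mf fK; split; first by apply: measurable_funM => //; exact: measurable_indic.
exists K%:R => x; rewrite indicE; have [/set_mem Ax|_] := boolP (x \in A K).
  by rewrite mul1r fK.
by rewrite mul0r normr0.
Qed.

(** Take p + i q close to the truncation of f = u + i v to A K in the pairing
inequality: the pairing tends to the square mass m of the truncation, so that
2 m <= M + m. *)
Let trunc_le K : \int[mu]_(x in T) (\1_(A K) x * (u x ^+ 2 + v x ^+ 2)) <= M.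
Proof.
pose g1 x := \1_(A K) x * U x; pose g2 x := \1_(A K) x * V x.
have b1 : bounded_measurable g1 by apply: trunc_bounded => // x [[]].
have b2 : bounded_measurable g2 by apply: trunc_bounded => // x [].
have E1 x : T x -> u x * g1 x = g1 x ^+ 2.
  move=> Tx; rewrite /g1 /U patchE mem_set// indicE.
  by case: (_ \in _); rewrite ?mul0r ?mulr0 ?expr0n// !mul1r expr2.
have E2 x : T x -> v x * g2 x = g2 x ^+ 2.
  move=> Tx; rewrite /g2 /V patchE mem_set// indicE.
  by case: (_ \in _); rewrite ?mul0r ?mulr0 ?expr0n// !mul1r expr2.
have uw x : `|u x| <= w x by rewrite /w -addrA addrCA lerDl addr_ge0.
have vw x : `|v x| <= w x by rewrite /w lerDr addr_ge0.
set m1 := \int[mu]_(x in T) (g1 x ^+ 2); set m2 := \int[mu]_(x in T) (g2 x ^+ 2).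
have -> : \int[mu]_(x in T) (\1_(A K) x * (u x ^+ 2 + v x ^+ 2)) = m1 + m2.
  rewrite -RintegralD//; [|exact: (ibm (bmX _))..].
  apply: eq_Rintegral => x /set_mem Tx; rewrite /g1 /g2 /U /V !patchE mem_set// indicE.
  by case: (_ \in _); rewrite ?mul0r ?expr0n ?addr0// !mul1r.
have m10 : 0 <= m1 by apply: Rintegral_ge0 => x _; exact: sqr_ge0.
have m20 : 0 <= m2 by apply: Rintegral_ge0 => x _; exact: sqr_ge0.
have W0 : 0 <= W by apply: Rintegral_ge0.
have key t : 0 < t -> t <= 1 -> m1 + m2 <= M + t * (m1 + m2 + 4 * (W + 1) + 4).
  move=> t0 t1.
  have [p tp [p1 p2]] := approx_pair iu uw b1 t0 t1.
  have [q tq [q1 q2]] := approx_pair iv vw b2 t0 t1.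
  have := pairing_le tp tq.
  rewrite RintegralD//; [|exact: imul (trig_bounded _)..].
  rewrite RintegralD//; [|exact: (ibm (bmX (trig_bounded _)))..].
  have e1 : \int[mu]_(x in T) (u x * g1 x) = m1.
    by apply: eq_Rintegral => x /set_mem Tx; exact: E1.
  have e2 : \int[mu]_(x in T) (v x * g2 x) = m2.
    by apply: eq_Rintegral => x /set_mem Tx; exact: E2.
  rewrite e1 in p1; rewrite e2 in q1; rewrite -/m1 in p2; rewrite -/m2 in q2.
  nra.
apply/ler_addgt0Pr => e e0; pose c := m1 + m2 + 4 * (W + 1) + 4.
have c0 : 0 < c by rewrite /c; lra.
pose t := Num.min 1 (e / c).
have t0 : 0 < t by rewrite lt_min ltr01 divr_gt0.
have t1 : t <= 1 by rewrite ge_min lexx.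
apply: le_trans (key t t0 t1) _; rewrite lerD2l -/c -ler_pdivlMr//.
by rewrite ge_min lexx orbT.
Qed.

(** A converse to Bessel's inequality: an integrable function, not known to be square
integrable, with square summable coefficients. The truncations exhaust it. *)
Lemma l2_le_of_coefs : (\int[mu]_(x in T) (u x ^+ 2 + v x ^+ 2)%:E <= M%:E)%E.
Proof.
have mf : measurable_fun T (fun x => (u x ^+ 2 + v x ^+ 2)%:E).
  apply/measurable_EFinP; apply: measurable_funD; apply: measurable_funX.
    exact: measurable_integrand iu.
  exact: measurable_integrand iv.
have f0 x : T x -> (0 <= (u x ^+ 2 + v x ^+ 2)%:E)%E.
  by move=> _; rewrite lee_fin addr_ge0// sqr_ge0.
have ndA : nondecreasing_seq A.
  move=> K K' KK'; apply/subsetPset => x [[Tx h1] h2].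
  by split; [split=> //|]; apply: le_trans (_ : K%:R <= K'%:R); rewrite ?ler_nat.
have AT : \bigcup_K A K = T.
  apply/seteqP; split=> [x [K _ [[]]]//|x Tx].
  pose K := (Num.bound `|U x| + Num.bound `|V x|)%N.
  have hK (y : R) : (Num.bound `|y| <= K)%N -> `|y| <= K%:R.
    move=> yK; apply: (@le_trans _ _ (Num.bound `|y|)%:R); last by rewrite ler_nat.
    by apply: ltW; exact: archi_boundP.
  by exists K => //; split; [split=> //|]; apply: hK; rewrite ?leq_addl ?leq_addr.
have AKT K : A K `<=` T by move=> x [[]].
have lim : (\int[mu]_(x in A K) (u x ^+ 2 + v x ^+ 2)%:E)%E @[K --> \oo] -->
    (\int[mu]_(x in \bigcup_K A K) (u x ^+ 2 + v x ^+ 2)%:E)%E.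
  apply: ge0_nondecreasing_set_cvg_integral => // K; last by move=> x /AKT/f0.
  exact: measurable_funS mf.
rewrite -AT -(cvg_lim _ lim)//; apply: lime_le; first by apply/cvg_ex; eexists; exact: lim.
apply: nearW => K.
have Tk : T `&` A K = A K by apply/seteqP; split=> [x []//|x Ax]; split=> //; exact: AKT Ax.
have iA : mu.-integrable (A K) (EFin \o (fun x => u x ^+ 2 + v x ^+ 2)).
  apply: (integrable_torus (C := K%:R ^+ 2 + K%:R ^+ 2)) => //.
  by apply/measurable_EFinP; exact: measurable_funS mf.
  move=> x [[Tx]] /=; rewrite /U /V !patchE mem_set// => h1 h2.
  rewrite ger0_norm ?addr_ge0 ?sqr_ge0// -[u x ^+ 2]real_normK ?num_real//.
  by rewrite -[v x ^+ 2]real_normK ?num_real// lerD// lerXn2r ?nnegrE.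
rewrite (EFin_Rintegral (mA K) iA) lee_fin; apply: le_trans (trunc_le K).
rewrite -[in leLHS]Tk Rintegral_mkcondr le_eqVlt; apply/orP; left; apply/eqP.
by apply: eq_Rintegral => x _; rewrite patch_indic/= mulrC.
Qed.

End uniqueness.

(** * From complex to real functions *)

Section dictionary.
Variables (R : realType) (n : nat).
Local Notation mu := (lebesgue_rV R n).
Local Notation T := (@torus R n).
Local Notation Re := (@complex.Re R).
Local Notation Im := (@complex.Im R).
Implicit Types (f h : 'rV[R]_n -> R[i]).

Lemma Re_mul_cis (z : R[i]) (t : R) : Re (z * cis (- t)) = Re z * cos t + Im z * sin t.
Proof. by case: z => a b /=; rewrite cosN sinN; ring. Qed.

Lemma Im_mul_cis (z : R[i]) (t : R) : Im (z * cis (- t)) = Im z * cos t - Re z * sin t.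
Proof. by case: z => a b /=; rewrite cosN sinN; ring. Qed.

Lemma Re_fourier_coef f nu :
  Re (fourier_coef f nu) = cre T (fun x => Re (f x)) (fun x => Im (f x)) nu.
Proof. by apply: eq_Rintegral => x _; rewrite Re_mul_cis. Qed.

Lemma Im_fourier_coef f nu :
  Im (fourier_coef f nu) = cim T (fun x => Re (f x)) (fun x => Im (f x)) nu.
Proof. by apply: eq_Rintegral => x _; rewrite Im_mul_cis. Qed.

Lemma Re_fourier h xi : Re (fourier h xi) =
  \int[mu]_x (Re (h x) * cos (2 * pi * dotmul xi x) + Im (h x) * sin (2 * pi * dotmul xi x)).
Proof. by apply: eq_Rintegral => x _; rewrite Re_mul_cis. Qed.

Lemma Im_fourier h xi : Im (fourier h xi) =
  \int[mu]_x (Im (h x) * cos (2 * pi * dotmul xi x) - Re (h x) * sin (2 * pi * dotmul xi x)).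
Proof. by apply: eq_Rintegral => x _; rewrite Im_mul_cis. Qed.

Lemma complex_ge0 (z : R[i]) : (0 <= z) = (Im z == 0) && (0 <= Re z).
Proof. by rewrite lecE. Qed.

Lemma complex_le0 (z : R[i]) : (z <= 0) = (Im z == 0) && (Re z <= 0).
Proof. by rewrite lecE eq_sym. Qed.

Lemma continuous_Re h : continuous (h : 'rV[R]_n -> R[i]^o) ->
  continuous (fun x => Re (h x)).
Proof.
move=> ch x; apply/(@cvgrPdist_lt _ _ _ _ (nbhs_filter x)) => e e0.
have := ch x => /(@cvgrPdist_lt _ _ _ _ (nbhs_filter x)) /(_ (real_complex R e)).
rewrite ltcR => /(_ e0); apply: filterS => y; rewrite -ltcR; apply: le_lt_trans.
have := normc_ge_Re (h x - h y : R[i]).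
by rewrite (_ : Re (h x - h y) = Re (h x) - Re (h y))//; case: (h x); case: (h y).
Qed.

Lemma continuous_real_complex (r : 'rV[R]_n -> R) : continuous r ->
  continuous ((fun x => (r x)%:C) : 'rV[R]_n -> R[i]^o).
Proof.
move=> cr x; apply/(@cvgrPdist_lt _ _ _ _ (nbhs_filter x)) => e e0.
have e1 : 0 < Re e by move: e0; rewrite ltcE => /andP[].
have eE : e = (Re e)%:C.
  by move: e0; rewrite ltcE => /andP[/eqP]; case: (e) => a b /= -> _.
have := cr x => /(@cvgrPdist_lt _ _ _ _ (nbhs_filter x)) /(_ _ e1); apply: filterS => y.
by rewrite -ltcR -eE; rewrite -rmorphB normc_def/= expr0n/= addr0 sqrtr_sqr.
Qed.

Lemma normc_sqr (z : R[i]) : Normc.normc z ^+ 2 = Re z ^+ 2 + Im z ^+ 2.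
Proof. by case: z => a b; rewrite /Normc.normc/= sqr_sqrtr// addr_ge0// sqr_ge0. Qed.

Lemma integrable_mul_sin_dotmul (r : 'rV[R]_n -> R) al :
  mu.-integrable setT (EFin \o r) ->
  mu.-integrable setT (EFin \o (fun x => r x * sin (dotmul al x))).
Proof.
move=> ir; apply: (@integrable_mulr_bounded _ _ _ _ _ measurableT _ _ 1) => //.
  by under eq_fun do rewrite -[dotmul _ _]addr0; exact: measurable_sin_dotmul.
by move=> x _; exact: sin_max.
Qed.

(** Averaging the Fourier transform of h over xi and - xi leaves the cosine
transform of Re h, which alone matters: Im h may be dropped. *)
Lemma pos_def_Re h : continuous_L1 h -> (forall xi, 0 <= fourier h xi) ->
  pos_def (fun x => Re (h x)).
Proof.
move=> [_ [ir ii]] hp; split=> // al.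
have p0 : 2 * pi != 0 :> R by rewrite mulf_neq0// gt_eqF// pi_gt0.
pose xi := (2 * pi)^-1 *: al.
have E x : 2 * pi * dotmul xi x = dotmul al x.
  by rewrite /xi dotmulZl mulrA mulfV// mul1r.
have EN x : 2 * pi * dotmul (- xi) x = - dotmul al x.
  by rewrite dotmulNl mulrN E.
have ic := integrable_mul_cos_dotmul al ir.
have iS := integrable_mul_sin_dotmul al ii.
have := hp xi; have := hp (- xi); rewrite !complex_ge0 !Re_fourier.
move=> /andP[_ h2] /andP[_ h1].
have {}h1 : 0 <= \int[mu]_x (Re (h x) * cos (dotmul al x) + Im (h x) * sin (dotmul al x)).
  by apply: le_trans h1 _; rewrite le_eqVlt; apply/orP; left; apply/eqP;
    apply: eq_Rintegral => x _; rewrite E.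
have {}h2 : 0 <= \int[mu]_x (Re (h x) * cos (dotmul al x) - Im (h x) * sin (dotmul al x)).
  by apply: le_trans h2 _; rewrite le_eqVlt; apply/orP; left; apply/eqP;
    apply: eq_Rintegral => x _; rewrite EN cosN sinN mulrN.
rewrite RintegralD// in h1; rewrite RintegralB// in h2; lra.
Qed.

Lemma integral_Re h : fourier h 0 = 1 -> \int[mu]_x Re (h x) = 1.
Proof.
move=> /(congr1 Re); rewrite Re_fourier/= => <-; apply: eq_Rintegral => x _.
by rewrite dotmul0l mulr0 cos0 sin0 mulr1 mulr0 addr0.
Qed.

Variable D : set 'rV[R]_n.
Hypotheses (bD : origin_symmetric_convex_body D) (DT : D `<=` T).

(** The local bound controls all finite sums of squares of coefficients, hence the
square mass over the torus. *)
Lemma wiener_inequality f h :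
  L1_plus f -> (sqr_mass D f < +oo)%E ->
  continuous_L1 h -> (forall xi, 0 <= fourier h xi) ->
  (forall x, ~ D x -> h x <= 0) -> fourier h 0 = 1 ->
  (sqr_mass T f <= (Re (h 0))%:E * sqr_mass D f)%E.
Proof.
move=> [[iu iv] fp] fD ch hp hD h1.
have mD := body_measurable bD; have mT := @measurable_torus R n.
pose u x := Re (f x); pose v x := Im (f x).
have sqE A : sqr_mass A f = (\int[mu]_(x in A) (u x ^+ 2 + v x ^+ 2)%:E)%E.
  by apply: eq_integral => x _; rewrite normc_sqr.
have i2 : mu.-integrable D (EFin \o (fun x => u x ^+ 2 + v x ^+ 2)).
  apply/integrableP; split.
    apply/measurable_EFinP; apply: measurable_funD; apply: measurable_funX.
      exact: measurable_integrand (integrableS mT mD DT iu).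
    exact: measurable_integrand (integrableS mT mD DT iv).
  apply: le_lt_trans fD; rewrite sqE le_eqVlt; apply/orP; left.
  by apply/eqP; apply: eq_integral => x _ /=; rewrite ger0_norm// addr_ge0// sqr_ge0.
have cre_ge0 nu : 0 <= cre T u v nu.
  by have := fp nu; rewrite complex_ge0 Re_fourier_coef => /andP[].
have cim0 nu : cim T u v nu = 0.
  by have := fp nu; rewrite complex_ge0 Im_fourier_coef => /andP[/eqP].
have pr := pos_def_Re ch hp; have cr := continuous_Re ch.1.
have rD x : ~ D x -> Re (h x) <= 0.
  by move=> /hD; rewrite complex_le0 => /andP[].
have loc := local_l2_bound bD DT pr cr rD (integral_Re h1) iu iv i2 cre_ge0 cim0.
rewrite !sqE (EFin_Rintegral mD i2) -EFinM; apply: l2_le_of_coefs => // S uS.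
rewrite (eq_bigr (fun nu => cre T u v nu ^+ 2)); first exact: loc.
by move=> nu _; rewrite cim0 expr0n addr0.
Qed.

(** D contains a cube and lies in the cell. *)
Lemma vol_body : exists2 c, 0 < c & vol D = c%:E.
Proof.
have mD := body_measurable bD; have [rho rho0 cubeD] := body_cube bD.
have muD : (mu D <= 1)%E.
  by rewrite -(@vol_torus R n); apply: le_measure; rewrite ?inE//; exact: measurable_torus.
have fD : mu D \is a fin_num.
  by rewrite ge0_fin_numE// (le_lt_trans muD) ?ltry.
exists (fine (mu D)); last by rewrite fineK.
have [i1 E1] := integral_scaled_torus n rho0.
apply: (@lt_le_trans _ _ (rho ^+ n)); first by rewrite exprn_gt0.
have := @Rintegral_indic_mul R _ _ mu D (fun=> 1); rewrite Rintegral_cst// mul1r => <-.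
have iD : mu.-integrable setT (EFin \o (fun x => \1_D x * 1)).
  apply/integrableP; split.
    by apply/measurable_EFinP; apply: measurable_funM => //; exact: measurable_indic.
  rewrite (eq_integral (fun x => (\1_D x)%:E)).
    by rewrite integral_indic// setIT ltey_eq fD.
  by move=> x _ /=; rewrite mulr1 ger0_norm// indicE.
rewrite -E1; apply: le_Rintegral => // x _; rewrite mulr1 !indicE ler_nat.
have [/set_mem xT|_] := boolP (rho^-1 *: x \in T); last by [].
rewrite mem_set//; apply: cubeD => i.
have /andP[x1 x2] := xT i; rewrite mxE in x1 x2.
rewrite ltr_norml; apply/andP; split.
  by move: x1; rewrite ler_pdivlMl//; lra.
by move: x2; rewrite ltr_pdivrMl//; lra.
Qed.

(** A product of triangles, normalized at 0 and supported in a cube inside D. Its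
Fourier transform is a product of Fejer kernels. *)
Lemma turan_nonempty : exists h : 'rV[R]_n -> R[i],
  [/\ continuous_L1 h, forall xi, 0 <= fourier h xi,
      closure [set x | h x != 0] `<=` D & h 0 = 1].
Proof.
have [rho rho0 cubeD] := body_cube bD.
pose t : R -> R := triangle rho; pose c : R := rho ^- n.
pose r (x : 'rV[R]_n) : R := c * tensor t x.
have c0 : 0 < c by rewrite invr_gt0 exprn_gt0.
have mt := measurable_triangle rho; have it := integrable_triangle rho.
have ir : mu.-integrable setT (EFin \o r).
  by apply: integrable_scaler => //; exact: integrable_tensor.
have cr : continuous r.
  move=> x; apply: (@continuousM _ _ (fun=> c) (tensor t)); first exact: cst_continuous.
  have := @cvg_big R _ *%R 1 xpredT mul_continuous _ (nbhs x) (index_enum 'I_n)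
    (fun i y => t (y ord0 i)) (fun i => t (x ord0 i)) (nbhs_filter x).
  apply=> i _.
  apply: (@continuous_comp _ _ _ (fun y : 'rV[R]_n => y ord0 i) t); last exact: continuous_triangle.
  exact: coord_continuous.
exists (fun x => (r x)%:C); split.
- split; first exact: continuous_real_complex.
  by split; [exact: ir|exact: (integrable0 mu setT)].
- move=> xi.
  have pP i : exists p : R, 0 <= p /\ forall b,
      \int[@lebesgue_measure R]_x (t x * cos ((2 * pi * xi ord0 i) * x + b)) = p * cos b.
    by have [p p0 pE] := triangle_fourier_ge0 (2 * pi * xi ord0 i) rho0; exists p.
  pose p i := projT1 (cid (pP i)).
  have [p0 pE] : (forall i, 0 <= p i) /\ forall i b,
      \int[@lebesgue_measure R]_x (t x * cos ((2 * pi * xi ord0 i) * x + b)) = p i * cos b.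
    by split=> i; have [] := projT2 (cid (pP i)).
  have E b : \int[mu]_x (r x * cos (2 * pi * dotmul xi x + b)) = c * ((\prod_i p i) * cos b).
    rewrite -(integral_tensor_cos (al := (2 * pi) *: xi) mt it)//; last first.
      by move=> i b'; rewrite mxE pE.
    rewrite -RintegralZl//; last first.
      apply: (@integrable_mulr_bounded _ _ _ _ _ measurableT _ _ 1) => //.
      - exact: integrable_tensor.
      - exact: measurable_cos_dotmul.
      - by move=> x _; exact: cos_max.
    by apply: eq_Rintegral => x _; rewrite dotmulZl mulrA.
  rewrite complex_ge0 Re_fourier Im_fourier; apply/andP; split.
    apply/eqP; have := E (pi / 2); rewrite cos_pihalf !mulr0 => <-.
    apply: eq_Rintegral => x _ /=; rewrite mul0r sub0r cosDpihalf mulrN.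
    by [].
  have := E 0; rewrite cos0 mulr1 => E0.
  rewrite (_ : Rintegral _ _ _ = c * \prod_i p i).
    by rewrite mulr_ge0 ?(ltW c0)// prodr_ge0.
  by rewrite -E0; apply: eq_Rintegral => x _ /=; rewrite mul0r !addr0.
- have cD := body_closed bD; rewrite [X in _ `<=` X](closure_id D).1//.
  apply: closure_subset => x /= rx; apply: cubeD => i; rewrite ltNge; apply/negP => xi.
  case/negP: rx; apply/eqP; rewrite /r /tensor (bigD1 i)//= /t /triangle.
  rewrite (_ : Num.max 0 (rho - `|x ord0 i|) = 0) ?mul0r ?mulr0//.
  by apply/max_idPl; rewrite subr_le0.
- rewrite /r /tensor (eq_bigr (fun=> rho)); last first.
    by move=> i _; rewrite mxE /t /triangle normr0 subr0; apply/max_idPr; exact: ltW.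
  by rewrite prodr_const card_ord mulVf// expf_neq0// gt_eqF.
Qed.

Lemma fourier_scale h (c : R) xi : cintegrable setT h ->
  fourier (fun x => h x * c%:C) xi = fourier h xi * c%:C.
Proof.
move=> [ir ii].
have ReM (z : R[i]) : Re (z * c%:C) = Re z * c by case: z => a b /=; ring.
have ImM (z : R[i]) : Im (z * c%:C) = Im z * c by case: z => a b /=; ring.
have E x : 2 * pi * dotmul xi x = dotmul ((2 * pi) *: xi) x by rewrite dotmulZl.
have ci (f : 'rV[R]_n -> R) := @integrable_mul_cos_dotmul R n f ((2 * pi) *: xi).
have si (f : 'rV[R]_n -> R) := @integrable_mul_sin_dotmul f ((2 * pi) *: xi).
apply/eqP; rewrite eq_complex ReM ImM !Re_fourier !Im_fourier.
apply/andP; split; apply/eqP; rewrite -RintegralZr//.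
- by apply: eq_Rintegral => x _; rewrite ReM ImM; ring.
- by under eq_fun do rewrite E; apply: integrable_addr => //; [exact: ci|exact: si].
- by apply: eq_Rintegral => x _; rewrite ReM ImM; ring.
- by under eq_fun do rewrite E; apply: integrable_subr => //; [exact: ci|exact: si].
Qed.

End dictionary.

(** * The three constants *)

Section extended_inverse.
Variable R : realType.
Local Open Scope ereal_scope.
Implicit Types x y : \bar R.

(** With 0^-1 = +oo, inversion is a decreasing involution of [0, +oo]. *)
Lemma le_inve_swap x y : 0 <= x -> 0 <= y -> y <= x^-1 -> x <= y^-1.
Proof.
case: x => [a| |]//; case: y => [b| |]//=; rewrite ?invey ?lee_fin ?inve0 ?leey//.
- move=> a0 b0; rewrite !inver; have [->|an] := eqVneq a 0%R.
    by move=> _; case: ifP => [_|/eqP _]; rewrite ?leey// lee_fin invr_ge0.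
  case: ifP => [_|/negbT bn]; first by rewrite leey.
  have a1 : (0 < a)%R by rewrite lt_neqAle eq_sym an.
  have b1 : (0 < b)%R by rewrite lt_neqAle eq_sym bn.
  by rewrite !lee_fin -[X in (_ <= X -> _)%R]mul1r -[X in (_ -> _ <= X)%R]mul1r
     !ler_pdivlMr// mulrC.
- move=> a0 _; rewrite inver; case: ifP => [/eqP -> //|_]; by rewrite leye_eq.
- move=> _ b0 b1; rewrite inver; case: ifP => // /negP[]; apply/eqP.
  by apply/eqP; rewrite eq_le b1.
Qed.

End extended_inverse.

Section constants.
Variables (R : realType) (n : nat).
Local Notation mu := (lebesgue_rV R n).
Local Notation T := (@torus R n).
Local Notation Re := (@complex.Re R).
Local Notation Im := (@complex.Im R).
Implicit Types (f h : 'rV[R]_n -> R[i]).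
Variable D : set 'rV[R]_n.
Hypotheses (bD : origin_symmetric_convex_body D) (DT : D `<=` T).
Local Open Scope ereal_scope.

(** The function h / c competes in the Delsarte problem: it vanishes off D. *)
Lemma delsarte_le_turan h c : (0 < c)%R -> continuous_L1 h ->
  (forall xi, 0 <= fourier h xi)%R -> closure [set x | h x != 0%R] `<=` D -> h 0%R = 1%R ->
  Re (fourier h 0%R) = c -> delsarte_constant D <= c^-1%:E.
Proof.
move=> c0 [ch ih] hp hD h0 hc; apply: ereal_inf_lbound.
have f0 : fourier h 0%R = c%:C.
  apply/eqP; rewrite eq_complex hc eqxx.
  by have := hp 0%R; rewrite complex_ge0 => /andP[].
have ciR : (0 <= (c^-1)%:C :> R[i])%R by rewrite lecR invr_ge0 ltW.
exists (fun x => h x * (c^-1)%:C)%R; last by rewrite h0 mul1r.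
have ReM (z : R[i]) (a : R) : Re (z * a%:C)%R = (Re z * a)%R by case: z => ? ? /=; ring.
have ImM (z : R[i]) (a : R) : Im (z * a%:C)%R = (Im z * a)%R by case: z => ? ? /=; ring.
split.
- split; last first.
    split.
      under eq_fun do rewrite ReM mulrC.
      by have := integrable_scaler measurableT c^-1 ih.1; apply.
    under eq_fun do rewrite ImM mulrC.
    by have := integrable_scaler measurableT c^-1 ih.2; apply.
  move=> x; have := ch x => hx.
  under eq_fun do rewrite mulrC.
  by have := @cvgZl_tmp R[i] R[i]^o _ _ (nbhs_filter x) (c^-1)%:C h _ hx; apply.
- by move=> xi; rewrite fourier_scale// mulr_ge0.
- move=> x Dx; rewrite (_ : h x = 0)%R ?mul0r//; apply/eqP/negPn/negP => hx.
  by apply: Dx; apply: hD; exact: subset_closure.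
- by rewrite fourier_scale// f0 -rmorphM/= mulfV// gt_eqF.
Qed.

(** The supremum is over a nonempty set, hence nonnegative; over the empty set it
would be -oo, whose inverse in the extended reals is -oo again. *)
Lemma delsarte_le_inv_turan : delsarte_constant D <= (turan_constant D)^-1.
Proof.
have [h1 hT] := turan_nonempty bD.
have t0 : 0 <= turan_constant D.
  apply: (@le_trans _ _ (Re (fourier h1 0%R))%:E).
    by have [_ /(_ 0%R)] := hT; rewrite complex_ge0 => /andP[].
  by apply: ereal_sup_ubound; exists h1.
have [d0|d0] := leP (delsarte_constant D) 0.
  by apply: le_trans d0 _; rewrite inve_ge0.
apply: le_inve_swap => //; first exact: ltW.
apply: ge_ereal_sup => _ [h [ch hp hD h0] <-].
have c0 : (0 <= Re (fourier h 0%R))%R.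
  by have := hp 0%R; rewrite complex_ge0 => /andP[].
apply: le_inve_swap; [by []|exact: ltW|].
rewrite inver; case: ifPn => [_|cn]; first by rewrite leey.
by apply: (delsarte_le_turan _ ch hp hD h0) => //; rewrite lt_neqAle eq_sym cn.
Qed.

Lemma sqr_mass_eq0 f : cintegrable T f -> sqr_mass T f <= 0 ->
  {ae mu, forall x, T x -> f x = 0%R}.
Proof.
move=> [iu iv] m0; have mT := @measurable_torus R n.
have mf : measurable_fun T (fun x => (Re (f x) ^+ 2 + Im (f x) ^+ 2)%R%:E).
  apply/measurable_EFinP; apply: measurable_funD; apply: measurable_funX.
    exact: measurable_integrand iu.
  exact: measurable_integrand iv.
have : \int[mu]_(x in T) `|(Re (f x) ^+ 2 + Im (f x) ^+ 2)%R%:E| = 0.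
  apply/eqP; rewrite eq_le integral_ge0// andbT; apply: le_trans m0.
  rewrite le_eqVlt; apply/orP; left; apply/eqP; apply: eq_integral => x _.
  by rewrite normc_sqr gee0_abs// lee_fin addr_ge0// sqr_ge0.
move/(ae_eq_integral_abs _ mT mf); apply: filterS => x /= h Tx.
have /eqP := h Tx; rewrite eqe paddr_eq0 ?sqr_ge0// !sqrf_eq0.
by move=> fx; apply/eqP; rewrite eq_complex.
Qed.

Lemma inv_vol_wiener_le_delsarte :
  (vol D)^-1 * wiener_constant D <= delsarte_constant D.
Proof.
have [v v0 volE] := vol_body bD DT.
apply: le_ereal_inf_tmp => _ [h [ch hp hD h1] <-].
have vn : v != 0%R by rewrite gt_eqF.
rewrite volE inver (negbTE vn) muleC -[X in _ * X]/(v^-1)%:E lee_pdivrMr//.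
apply: ge_ereal_sup => _ [f [fp fn fD] <-].
have main := wiener_inequality bD DT fp fD ch hp hD h1.
have M0 : 0 <= sqr_mass D f by apply: integral_ge0 => x _; rewrite lee_fin sqr_ge0.
move: fD M0 main; case: (sqr_mass D f) => [m| |]// _; rewrite lee_fin => m0 main.
(* If f had no mass on D, it would have none on the torus. *)
have m1 : (0 < m)%R.
  rewrite lt_neqAle m0 andbT eq_sym; apply/negP => /eqP mE; apply: fn.
  by apply: sqr_mass_eq0; [exact: fp.1|rewrite mE mule0 in main].
rewrite volE inver (negbTE vn) -EFinM inver mulf_eq0 invr_eq0 (negbTE vn) (gt_eqF m1)/=.
rewrite invfM invrK.
apply: (@le_trans _ _ ((Re (h 0%R))%:E * m%:E * (v / m)%:E)).
  by apply: lee_wpmul2r => //; rewrite lee_fin divr_ge0 ?ltW.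
by rewrite -!EFinM lee_fin le_eqVlt; apply/orP; left; apply/eqP; field; rewrite gt_eqF.
Qed.

End constants.

Local Open Scope ereal_scope.

Theorem theorem7 (R : realType) (n : nat) (D : set 'rV[R]_n) :
  (0 < n)%N -> origin_symmetric_convex_body D -> D `<=` @torus R n ->
  (vol D)^-1 * wiener_constant D <= delsarte_constant D /\
  delsarte_constant D <= (turan_constant D)^-1.
Proof.
move=> _ bD DT; split; first exact: inv_vol_wiener_le_delsarte.
exact: delsarte_le_inv_turan.
Qed.
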